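(* For any irreducible quantum flag manifold $\mathcal{O}_q(G/L_S)$ with $q\in I$, where $I$ is an open interval around $1$ on which the quantum Fubini--Study metric $g_\kappa$ is positive definite, the de Rham cohomology $H^\bullet$ of the Heckenberger--Kolb calculus $\Omega^\bullet_q(G/L_S)$ satisfies $$H^{2k}\neq0,\qquad\text{for all }k=1,\dots,M,$$ where $2M$ is the total degree of $\Omega^\bullet_q(G/L_S)$.
   Context: **Quantum groups.** Let $\mathfrak{g}$ be a complex simple Lie algebra of rank $r$ with simple roots $\alpha_1,\dots,\alpha_r$, fundamental weights $\varpi_i$, invariant form $(\cdot,\cdot)$ on weights, and half-sum of positive roots $\rho$; let $G$ be the corresponding compact, connected, simply connected group. For $q\in\mathbb{R}_{>0}$, $q\ne1$, $U_q(\mathfrak{g})$ is the Drinfeld--Jimbo algebra with generators $E_i,F_i,K_i^{\pm1}$, coproduct $\Delta E_i=E_i\otimes K_i+1\otimes E_i$, $\Delta F_i=F_i\otimes1+K_i^{-1}\otimes F_i$, $\Delta K_i=K_i\otimes K_i$, and compact real form $K_i^*=K_i$, $E_i^*=K_iF_i$, $F_i^*=E_iK_i^{-1}$. For $q=1$ all objects are the classical ones. $V_\mu$ is the type-1 irreducible module of dominant integral highest weight $\mu$; $c^V_{f,v}(X)=f(Xv)$; $\mathcal{O}_q(G)\subset U_q(\mathfrak{g})^\circ$ is the Hopf $*$-algebra spanned by the matrix coefficients of all $V_\mu$, with $*$ dual to the real form. For a subset $S$ of simple roots, $U_q(\mathfrak{l}_S)=\langle K_i,E_j,F_j: i=1,\dots,r,\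 j\in S\rangle$, and $\mathcal{O}_q(G/L_S)=\{b\in\mathcal{O}_q(G): b_{(1)}b_{(2)}(X)=\epsilon(X)b\ \ \forall X\in U_q(\mathfrak{l}_S)\}$ (Sweedler notation). It is an irreducible quantum flag manifold when $S=\{\alpha_1,\dots,\alpha_r\}\setminus\{\alpha_x\}$ with $\alpha_x$ of coefficient $1$ in the highest root. Put $B=\mathcal{O}_q(G/L_S)$, $A=\mathcal{O}_q(G)$, $B^+=B\cap\ker\epsilon$, and $\Phi(\mathcal{F})=\mathcal{F}/B^+\mathcal{F}$ with cosets $[f]$. Let $\{v_i\}_{i=1}^N$ be a weight basis of $V_{\varpi_x}$, $v_N$ of highest weight, $\{f_i\}$ its dual basis, and $z_{ij}=c^{V_{\varpi_x}}_{f_i,v_N}c^{V_{\varpi_x}^\vee}_{v_j,f_N}$; these generate $B$. **Calculus.** A differential calculus over $B$ is a dg-algebra $(\Omega^\bullet,\mathrm{d})$ with $\Omega^0=B$, generated by $a,\mathrm{d}b$; it is left $A$-covariant if the coaction $\Delta:B\to A\otimes B$ extends to a (necessarily unique) left $A$-comodule algebra structure for which $\mathrm{d}$ is a comodule map. The Heckenberger--Kolb calculus $\Omega^\bullet=\Omega^\bullet_q(G/L_S)$ is the unique finite-dimensional left $A$-covariant differential calculus over $B$ with $\dim\Phi(\Omega^k)=\binom{2M}{k}$, $k=0,\dots,2M$, where $M$ is the complex dimension of the classical $G/L_S$. Its de Rham cohomology is $H^k=\ker(\mathrm{d}|_{\Omega^k})/\mathrm{d}\Omega^{k-1}$. It is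 a $*$-calculus: $*$ extends to a conjugate-linear involution with $\mathrm{d}(\omega^* )=(\mathrm{d}\omega)^*$ and $(\omega\wedge\nu)^*=(-1)^{kl}\nu^*\wedge\omega^*$ for $\omega\in\Omega^k,\nu\in\Omega^l$. It has a covariant complex structure, unique up to exchanging the two gradings: an $\mathbb{Z}_{\ge0}^2$-algebra grading $\Omega^{(\bullet,\bullet)}$ by subcomodules with $\Omega^k=\bigoplus_{a+b=k}\Omega^{(a,b)}$, $(\Omega^{(a,b)})^*=\Omega^{(b,a)}$, $\mathrm{d}=\partial+\overline{\partial}$ of degrees $(1,0),(0,1)$. With $J_{(1)}=\{i:(\varpi_x,\varpi_x-\alpha_x-\mathrm{wt}(v_i))=0\}$, the elements $[\partial z_{iN}]$ and $[\overline{\partial}z_{Ni}]$, $i\in J_{(1)}$, are bases of $\Phi(\Omega^{(1,0)})$ and $\Phi(\Omega^{(0,1)})$. **Kähler form and metric.** $\kappa=\pm\mathbf{i}\sum_{i,j,k}q^{(2\rho,\mathrm{wt}(v_i))}z_{ij}\,\mathrm{d}z_{jk}\wedge\mathrm{d}z_{ki}$, a real left $A$-coinvariant $(1,1)$-form (unique up to real scalar), with the sign, independent of $q$, chosen so that at $q=1$ $[\kappa]$ is a positive multiple of $\mathbf{i}\sum_{i\in J_{(1)}}[\partial z_{iN}\wedge(\partial z_{iN})^*]$. For all $q\in\mathbb{R}_{>0}$ outside a (possibly empty) finite set $F$, $(\Omega^{(\bullet,\bullet)},\kappa)$ is a Kähler structure: $\kappa$ is central, real, closed and, with $L(\omega)=\kappa\wedge\omega$,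 the maps $L^{M-k}:\Omega^k\to\Omega^{2M-k}$ are isomorphisms for $k=0,\dots,M-1$; take $I\subset\mathbb{R}_{>0}\setminus F$. With $P^{(a,b)}=\{\alpha\in\Omega^{(a,b)}:L^{M-a-b+1}\alpha=0\}$, $a+b\le M$, the Hodge map is the linear map with $\ast_\kappa(L^j\alpha)=(-1)^{k(k+1)/2}\mathbf{i}^{a-b}\frac{j!}{(M-j-k)!}L^{M-j-k}\alpha$ for $\alpha\in P^{(a,b)}$, $k=a+b$, $0\le j\le M-k$. The metric is $g_\kappa(\omega,\nu)=\ast_\kappa(\omega\wedge\ast_\kappa(\nu^* ))\in B$ for forms of equal degree and $0$ otherwise; it is positive definite if $g_\kappa(\omega,\omega)\in B_{>0}$ for all $\omega\ne0$, where $B_{>0}$ is the set of non-zero finite sums $\sum\lambda_ib_i^*b_i$, $\lambda_i>0$, $b_i\in B$. *)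

(* Defs.v *)
From HB Require Import structures.
From mathcomp Require Import all_boot all_order all_algebra.
From mathcomp Require Import complex.
From mathcomp Require Import boolp classical_sets functions cardinality fsbigop.
From mathcomp Require Import reals topology normedtype.

Set Implicit Arguments.
Unset Strict Implicit.
Unset Printing Implicit Defensive.
Import Order.TTheory GRing.Theory Num.Theory.
Local Open Scope classical_set_scope.
Local Open Scope ring_scope.

(** ** Simple Lie algebras, roots and weights

    A complex simple Lie algebra is given by its Cartan matrix
    [cmat i j = <alpha_i^vee, alpha_j>] and [slen i = (alpha_i, alpha_i) / 2],
    the invariant form being normalised so that short roots have squared
    length 2.  Roots are row vectors in the basis of simple roots, weights are
    row vectors in the basis of fundamental weights. *)

Record cartan_datum (r : nat) := CartanDatum {
  cmat : 'M[int]_r;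
  slen : 'I_r -> nat }.

Record is_simple (r : nat) (D : cartan_datum r) : Prop := IsSimple {
  simple_rank : (0 < r)%N;
  simple_diag : forall i, cmat D i i = 2;
  simple_offdiag : forall i j, i != j -> cmat D i j <= 0;
  simple_slen_gt0 : forall i, (0 < slen D i)%N;
  simple_slen_norm : exists i, slen D i = 1%N;
  simple_sym : forall i j,
    (slen D i)%:Z * cmat D i j = (slen D j)%:Z * cmat D j i;
  simple_posdef : forall u : 'rV[int]_r, u != 0 ->
    0 < \sum_i \sum_j (slen D i)%:Z * cmat D i j * u 0 i * u 0 j;
  simple_indecomposable : forall J : {set 'I_r}, J != finset.set0 ->
    J != finset.setT ->
    exists i, exists j, [/\ i \in J, j \notin J & cmat D i j != 0] }.

Section Roots.
Context (r : nat) (D : cartan_datum r).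

Definition simple_root (i : 'I_r) : 'rV[int]_r := delta_mx 0 i.

Definition reflection (i : 'I_r) (b : 'rV[int]_r) : 'rV[int]_r :=
  b - (\sum_j cmat D i j * b 0 j) *: simple_root i.

Inductive is_root : 'rV[int]_r -> Prop :=
| root_simple i : is_root (simple_root i)
| root_reflection i b : is_root b -> is_root (reflection i b).

Definition positive_roots : set 'rV[int]_r :=
  [set b | is_root b /\ forall i, 0 <= b 0 i].

Definition is_highest_root (t : 'rV[int]_r) : Prop :=
  is_root t /\ forall b, is_root b -> forall i, b 0 i <= t 0 i.

(** [alpha_x] has coefficient 1 in the highest root. *)
Definition cominuscule (x : 'I_r) : Prop :=
  exists2 t, is_highest_root t & t 0 x = 1.

(** The complex dimension of [G/L_S], [S] the complement of [alpha_x], is the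
    number of positive roots that do not lie in the span of [S]. *)
Definition flag_dim (x : 'I_r) (M : nat) : Prop :=
  ([set b | positive_roots b /\ b 0 x != 0] #= `I_M)%card.

Definition two_rho : 'rV[int]_r := \sum_(b \in positive_roots) b.

Definition fund_weight (i : 'I_r) : 'rV[int]_r := delta_mx 0 i.

Definition root_to_weight (b : 'rV[int]_r) : 'rV[int]_r :=
  \row_i \sum_j cmat D i j * b 0 j.

Definition dominant (l : 'rV[int]_r) : Prop := forall i, 0 <= l 0 i.

(** [(b, l)] for [b] in the root lattice and [l] in the weight lattice; it is
    determined by [(alpha_i, varpi_j) = delta_ij (alpha_i, alpha_i) / 2]. *)
Definition rw_form (b l : 'rV[int]_r) : int :=
  \sum_i (slen D i)%:Z * b 0 i * l 0 i.

(** [(l, m)] for [l] and [m] in the weight lattice: since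
    [alpha_j = \sum_i cmat i j varpi_i], the Gram matrix [G] of the fundamental
    weights satisfies [cmat^T G = diag slen]. *)
Definition weight_gram : 'M[rat]_r :=
  invmx (map_mx intr (cmat D)^T) *m diag_mx (\row_i (slen D i)%:R).

Definition weight_form (l m : 'rV[int]_r) : rat :=
  (map_mx intr l *m weight_gram *m (map_mx intr m)^T) 0 0.

End Roots.

(** ** The Drinfeld-Jimbo algebra

    [U_q(g)] is presented by generators and relations, for all [q > 0] at once.
    The generator [H_i] stands for [(K_i - K_i^-1) / (q_i - q_i^-1)]; it is
    redundant for [q != 1], and for [q = 1] (where [K_i = 1]) it is the
    classical [H_i], so that the presentation becomes Serre's presentation of
    the enveloping algebra [U(g)].

    A [word] is a monomial in the generators.  Linear functionals on [U_q(g)]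
    are represented by their values on monomials, i.e. by functions
    [word -> R[i]]; the embedding of [U_q(g)^*] into the functions on words is
    dual to the quotient map from the free algebra onto [U_q(g)]. *)

Inductive gen (r : nat) :=
| GE of 'I_r | GF of 'I_r | GK of 'I_r | GKinv of 'I_r | GH of 'I_r.
Arguments GE {r}. Arguments GF {r}. Arguments GK {r}. Arguments GKinv {r}.
Arguments GH {r}.

Notation word r := (seq (gen r)).

Section HopfStructure.
Context (r : nat).

(** The coproduct of a word, as a formal sum of pure tensors of words. *)
Definition coprod_gen (g : gen r) : seq (word r * word r) :=
  match g with
  | GE i => [:: ([:: GE i], [:: GK i]); ([::], [:: GE i])]
  | GF i => [:: ([:: GF i], [::]); ([:: GKinv i], [:: GF i])]
  | GK i => [:: ([:: GK i], [:: GK i])]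
  | GKinv i => [:: ([:: GKinv i], [:: GKinv i])]
  | GH i => [:: ([:: GH i], [:: GK i]); ([:: GKinv i], [:: GH i])]
  end.

Definition coprod (w : word r) : seq (word r * word r) :=
  foldr (fun g s => [seq (p.1 ++ t.1, p.2 ++ t.2) | p <- coprod_gen g, t <- s])
        [:: ([::], [::])] w.

Definition grouplike_gen (g : gen r) : bool :=
  match g with GK _ | GKinv _ => true | _ => false end.

(** The antipode of a word is plus or minus a word; the boolean is true when
    the sign is minus. *)
Definition antipode_gen (g : gen r) : bool * word r :=
  match g with
  | GE i => (true, [:: GE i; GKinv i])
  | GF i => (true, [:: GK i; GF i])
  | GK i => (false, [:: GKinv i])
  | GKinv i => (false, [:: GK i])
  | GH i => (true, [:: GH i])
  end.

Definition antipode_sign (w : word r) : bool :=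
  odd (count (fun g => (antipode_gen g).1) w).

Definition antipode_word (w : word r) : word r :=
  flatten (rev [seq (antipode_gen g).2 | g <- w]).

(** The compact real form, a conjugate-linear anti-multiplicative map. *)
Definition star_gen (g : gen r) : word r :=
  match g with
  | GE i => [:: GK i; GF i]
  | GF i => [:: GE i; GKinv i]
  | _ => [:: g]
  end.

Definition star_word (w : word r) : word r :=
  flatten (rev [seq star_gen g | g <- w]).

(** The generators of [U_q(l_S)]. *)
Definition levi_gen (S : {set 'I_r}) (g : gen r) : bool :=
  match g with GE i | GF i => i \in S | _ => true end.

End HopfStructure.

Section QuantumNumbers.
Context (F : fieldType).
Implicit Types (t : F) (n k : nat).

Definition qnum t n : F := \sum_(s < n) t ^ (n%:Z - 1 - (s.*2)%:Z).
Definition qfact t n : F := \prod_(1 <= s < n.+1) qnum t s.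
Definition qbinom t n k : F := qfact t n / (qfact t k * qfact t (n - k)).

End QuantumNumbers.

Section QuantumGroup.
Context (R : realType) (r : nat) (D : cartan_datum r) (q : R).
Local Notation C := R[i].
Local Notation functional := (word r -> C).

Definition qC : C := real_complex R q.
Definition qi (i : 'I_r) : C := qC ^+ slen D i.

Section Representations.
Context (n : nat) (V : gen r -> 'M[C]_n).

Definition qserre (X : 'I_r -> gen r) (i j : 'I_r) : 'M[C]_n :=
  let m := `|1 - cmat D i j|%N in
  \sum_(s < m.+1) ((-1) ^+ s * qbinom (qi i) m s) *:
    (V (X i) ^+ s * V (X j) * V (X i) ^+ (m - s)).

(** [V] is a representation of [U_q(g)] on column vectors. *)
Record is_Uq_rep : Prop := IsUqRep {
  rep_KKinv : forall i, V (GK i) * V (GKinv i) = 1;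
  rep_KinvK : forall i, V (GKinv i) * V (GK i) = 1;
  rep_KK : forall i j, V (GK i) * V (GK j) = V (GK j) * V (GK i);
  rep_KE : forall i j, V (GK i) * V (GE j) =
    (qC ^ ((slen D i)%:Z * cmat D i j)) *: (V (GE j) * V (GK i));
  rep_KF : forall i j, V (GK i) * V (GF j) =
    (qC ^ (- ((slen D i)%:Z * cmat D i j))) *: (V (GF j) * V (GK i));
  rep_EF : forall i j, V (GE i) * V (GF j) - V (GF j) * V (GE i) =
    if i == j then V (GH i) else 0;
  rep_H : forall i, (qi i - (qi i)^-1) *: V (GH i) = V (GK i) - V (GKinv i);
  rep_serreE : forall i j, i != j -> qserre GE i j = 0;
  rep_serreF : forall i j, i != j -> qserre GF i j = 0;
  rep_classical_K : q = 1 -> forall i, V (GK i) = 1;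
  rep_classical_HH : q = 1 -> forall i j,
    V (GH i) * V (GH j) = V (GH j) * V (GH i);
  rep_classical_HE : q = 1 -> forall i j,
    V (GH i) * V (GE j) - V (GE j) * V (GH i) = (cmat D i j)%:~R *: V (GE j);
  rep_classical_HF : q = 1 -> forall i j,
    V (GH i) * V (GF j) - V (GF j) * V (GH i) =
      - ((cmat D i j)%:~R *: V (GF j)) }.

Definition act (w : word r) : 'M[C]_n := \prod_(g <- w) V g.

(** [c^V_{f,v}] *)
Definition matrix_coef (f : 'rV[C]_n) (v : 'cV[C]_n) : functional :=
  fun w => (f *m act w *m v) 0 0.

(** The dual module, in the dual basis: [(X f)(v) = f (S(X) v)]. *)
Definition dual_rep (g : gen r) : 'M[C]_n :=
  ((-1) ^+ (antipode_gen g).1 *: act (antipode_gen g).2)^T.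

Definition irreducible_rep : Prop :=
  (0 < n)%N /\
  forall U : {vspace 'cV[C]_n},
    (forall g v, v \in U -> V g *m v \in U) -> U = 0%VS \/ U = fullv.

Definition is_weight_vector (l : 'rV[int]_r) (v : 'cV[C]_n) : Prop :=
  v != 0 /\ forall i,
    V (GK i) *m v = (qC ^ rw_form D (simple_root i) l) *: v /\
    (q = 1 -> V (GH i) *m v = (l 0 i)%:~R *: v).

Definition is_highest_vector (l : 'rV[int]_r) (v : 'cV[C]_n) : Prop :=
  is_weight_vector l v /\ forall i, V (GE i) *m v = 0.

(** [V] is a model of [V_l]. *)
Definition is_irrep (l : 'rV[int]_r) : Prop :=
  [/\ is_Uq_rep, irreducible_rep & exists v, is_highest_vector l v].

End Representations.


Definition counit : functional := fun w => (all (@grouplike_gen r) w)%:R.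

Definition conv (a b : functional) : functional :=
  fun w => \sum_(p <- coprod w) a p.1 * b p.2.

Definition fstar (a : functional) : functional := fun w =>
  (-1) ^+ antipode_sign w * conjc (a (star_word (antipode_word w))).

(** [translate a X = a_(1)(X) a_(2)] *)
Definition translate (a : functional) (X : word r) : functional :=
  fun Y => a (X ++ Y).

Definition is_matrix_coef (a : functional) : Prop :=
  exists n (V : gen r -> 'M[C]_n) (l : 'rV[int]_r) f v,
    [/\ dominant l, is_irrep V l & a = matrix_coef V f v].

(** [O_q(G)] *)
Definition OqG : set functional := [set a |
  exists m (c : 'I_m -> C) (e : 'I_m -> functional),
    (forall k, is_matrix_coef (e k)) /\
    forall w, a w = \sum_(k < m) c k * e k w].

(** [O_q(G/L_S)] *)
Definition OqGL (S : {set 'I_r}) : set functional := [set b |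
  OqG b /\ forall w X, all (levi_gen S) X -> b (w ++ X) = counit X * b w].

End QuantumGroup.

(** ** Differential calculi

    The data of a bigraded differential *-calculus over [B] with a coaction of
    [A = O_q(G)], together with a model of [V_(varpi_x)] in a weight basis
    [v_i] and its weights.  The module is [C^(n.+1)] with [v_i] the standard
    basis; [v_N] is the last basis vector.

    - [cinc] is the identification of [B] with the forms of degree 0;
    - [cdeg k] and [cbideg a b] are the projections onto the homogeneous
      components of degree [k] and bidegree [(a, b)];
    - [A] consists of functionals on [U_q(g)], so a map from [W] to the tensor
      product of [A] and [W] is the same as a map from [W] to functions on
      words with values of the form [X |-> \sum_i a_i(X) w_i]; thus
      [ccoact w X = w_(-1)(X) w_(0)]. *)

Record calculus_data (R : realType) (r : nat) := CalculusData {
  cdim : nat;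
  cV : gen r -> 'M[R[i]]_cdim.+1;
  cwt : 'I_cdim.+1 -> 'rV[int]_r;
  cforms : algType R[i];
  cinc : (word r -> R[i]) -> cforms;
  cdeg : nat -> {linear cforms -> cforms};
  cbideg : nat -> nat -> {linear cforms -> cforms};
  cd : {linear cforms -> cforms};
  cdel : {linear cforms -> cforms};
  cdelbar : {linear cforms -> cforms};
  cstar : cforms -> cforms;
  ccoact : cforms -> word r -> cforms;
  chodge : {linear cforms -> cforms} }.

Section Calculus.
Context (R : realType) (r : nat) (D : cartan_datum r) (x : 'I_r) (q : R).
Context (T : calculus_data R r).
Local Notation C := R[i].
Local Notation W := (cforms T).
Local Notation inc := (@cinc R r T).
Local Notation co := (@ccoact R r T).
Local Notation star := (@cstar R r T).
Local Notation d := (cd T).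
Local Notation del := (cdel T).
Local Notation delbar := (cdelbar T).
Local Notation hodge := (chodge T).
Local Notation N := (@ord_max (cdim T)).

Definition OqFlag : set (word r -> C) :=
  OqGL D q (finset.setC (finset.set1 x)).
Local Notation A := (OqG D q).
Local Notation B := OqFlag.

Definition Om (k : nat) : set W := [set w | cdeg T k w = w].
Definition Om2 (a b : nat) : set W := [set w | cbideg T a b w = w].

(** [B^+ F] *)
Definition Bplus (F : set W) : set W := [set w |
  exists m (b : 'I_m -> word r -> C) (f : 'I_m -> W),
    (forall k, B (b k) /\ b k [::] = 0) /\ (forall k, F (f k)) /\
    w = \sum_(k < m) inc (b k) * f k].

(** The cosets [[e i]], [i] in [J], form a basis of [Phi(F) = F / B^+ F]. *)
Definition Phi_basis (F : set W) (I : finType) (J : {set I}) (e : I -> W) :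
    Prop :=
  [/\ forall i, i \in J -> F (e i),
      forall w, F w ->
        exists c : I -> C, Bplus F (w - \sum_(i in J) c i *: e i)
    & forall c : I -> C, Bplus F (\sum_(i in J) c i *: e i) ->
        forall i, i \in J -> c i = 0].

Definition Phi_dim (F : set W) (m : nat) : Prop :=
  exists e : 'I_m -> W, Phi_basis F finset.setT e.

Record is_calculus : Prop := IsCalculus {
  deg_proj : forall k l w,
    cdeg T k (cdeg T l w) = if k == l then cdeg T l w else 0;
  deg_sum : forall w, exists m,
    (forall k, (m <= k)%N -> cdeg T k w = 0) /\ w = \sum_(k < m) cdeg T k w;
  deg_mul : forall k l u v, Om k u -> Om l v -> Om (k + l) (u * v);
  (* Omega^0 = B *)
  inc_linear : forall (c : C) a b, B a -> B b ->
    inc (fun X => c * a X + b X) = c *: inc a + inc b;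
  inc_mul : forall a b, B a -> B b -> inc (conv a b) = inc a * inc b;
  inc_one : inc (@counit R r) = 1;
  inc_inj : forall a b, B a -> B b -> inc a = inc b -> a = b;
  inc_image : inc @` B = Om 0;
  d_deg : forall k w, Om k w -> Om k.+1 (d w);
  d_d : forall w, d (d w) = 0;
  d_leibniz : forall k u v, Om k u ->
    d (u * v) = d u * v + (-1) ^+ k * (u * d v);
  (* Omega is generated by the elements a and db *)
  calculus_generated : forall P : set W,
    P 1 -> (forall b, B b -> P (inc b)) -> (forall b, B b -> P (d (inc b))) ->
    (forall (c : C) u v, P u -> P v -> P (c *: u + v)) ->
    (forall u v, P u -> P v -> P (u * v)) ->
    forall w, P w }.

Record is_covariant : Prop := IsCovariant {
  co_linear : forall (c : C) u v X, co (c *: u + v) X = c *: co u X + co v X;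
  co_tensor : forall w, exists m (a : 'I_m -> word r -> C) (u : 'I_m -> W),
    (forall k, A (a k)) /\ forall X, co w X = \sum_(k < m) a k X *: u k;
  co_counit : forall w, co w [::] = w;
  co_coassoc : forall w X Y, co (co w X) Y = co w (X ++ Y);
  co_one : forall X, co 1 X = @counit R r X *: 1;
  co_mul : forall u v X,
    co (u * v) X = \sum_(p <- coprod X) co u p.1 * co v p.2;
  co_inc : forall b X, B b -> co (inc b) X = inc (translate b X);
  co_d : forall w X, co (d w) X = d (co w X) }.

(** The Heckenberger-Kolb calculus, [M] the complex dimension of [G/L_S].  For
    [q = 1] it is the classical de Rham complex, which is graded commutative. *)
Record is_HK_calculus (M : nat) : Prop := IsHKCalculus {
  HK_calculus : is_calculus;
  HK_covariant : is_covariant;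
  HK_dim : forall k, (k <= M.*2)%N -> Phi_dim (Om k) 'C(M.*2, k);
  HK_total_degree : forall k, (M.*2 < k)%N -> forall w, Om k w -> w = 0;
  HK_classical : q = 1 -> forall k l u v, Om k u -> Om l v ->
    u * v = (-1) ^+ (k * l) * (v * u) }.

Record is_star_calculus : Prop := IsStarCalculus {
  star_add : forall u v, star (u + v) = star u + star v;
  star_scale : forall (c : C) u, star (c *: u) = conjc c *: star u;
  star_invol : forall u, star (star u) = u;
  star_inc : forall b, B b -> star (inc b) = inc (fstar b);
  star_mul : forall k l u v, Om k u -> Om l v ->
    star (u * v) = (-1) ^+ (k * l) * (star v * star u);
  star_d : forall u, d (star u) = star (d u) }.

(** The representation of highest weight [varpi_x] in a weight basis. *)
Definition is_fund_rep : Prop :=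
  [/\ is_irrep D q (@cV R r T) (fund_weight x),
      forall j, is_weight_vector D q (@cV R r T) (cwt j) (delta_mx j 0)
    & is_highest_vector D q (@cV R r T) (fund_weight x) (delta_mx N 0)].

(** [z_ij = c_{f_i,v_N} c^dual_{v_j,f_N}] *)
Definition zfun (i j : 'I_(cdim T).+1) : word r -> C :=
  conv (matrix_coef (@cV R r T) (delta_mx 0 i) (delta_mx N 0))
       (matrix_coef (dual_rep (@cV R r T)) (delta_mx 0 j) (delta_mx N 0)).
Definition z (i j : 'I_(cdim T).+1) : W := inc (zfun i j).

(** [J_(1)] *)
Definition J1 : {set 'I_(cdim T).+1} :=
  [set i | weight_form D (fund_weight x)
     (fund_weight x - root_to_weight D (simple_root x) - cwt i) == 0]%SET.

Record is_complex_structure : Prop := IsComplexStructure {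
  bideg_proj : forall a b a' b' w,
    cbideg T a b (cbideg T a' b' w) =
    if (a == a') && (b == b') then cbideg T a' b' w else 0;
  bideg_deg : forall k w, cdeg T k w = \sum_(a < k.+1) cbideg T a (k - a) w;
  bideg_mul : forall a b a' b' u v, Om2 a b u -> Om2 a' b' v ->
    Om2 (a + a') (b + b') (u * v);
  bideg_co : forall a b w X, Om2 a b w -> Om2 a b (co w X);
  bideg_star : forall a b, star @` Om2 a b = Om2 b a;
  d_split : forall w, d w = del w + delbar w;
  del_bideg : forall a b w, Om2 a b w -> Om2 a.+1 b (del w);
  delbar_bideg : forall a b w, Om2 a b w -> Om2 a b.+1 (delbar w);
  (* this selects one of the two mutually opposite complex structures *)
  del_basis : Phi_basis (Om2 1 0) J1 (fun i => del (z i N));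
  delbar_basis : Phi_basis (Om2 0 1) J1 (fun i => delbar (z N i)) }.

(** The Kaehler form; the sign is [(-1) ^+ e]. *)
Definition kappa (e : bool) : W :=
  ((-1) ^+ e * 'i%C) *: \sum_i \sum_j \sum_k
    (qC q ^ rw_form D (two_rho D) (cwt i)) *: (z i j * (d (z j k) * d (z k i))).

(** The condition that fixes the sign of the Kaehler form at [q = 1]. *)
Definition kappa_sign (e : bool) : Prop :=
  exists2 c : R, 0 < c &
    Bplus (Om 2) (kappa e - (real_complex R c * 'i%C) *:
      \sum_(i in J1) del (z i N) * star (del (z i N))).

Definition lefschetz (e : bool) (w : W) : W := kappa e * w.

Record is_kaehler (M : nat) (e : bool) : Prop := IsKaehler {
  kappa_bideg : Om2 1 1 (kappa e);
  kappa_coinv : forall X, co (kappa e) X = @counit R r X *: kappa e;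
  kappa_central : forall w, kappa e * w = w * kappa e;
  kappa_real : star (kappa e) = kappa e;
  kappa_closed : d (kappa e) = 0;
  lefschetz_iso : forall k, (k < M)%N ->
    forall w, Om (M.*2 - k) w ->
      exists! u, Om k u /\ iter (M - k) (lefschetz e) u = w }.

Definition primitive (M : nat) (e : bool) (a b : nat) : set W :=
  [set w | Om2 a b w /\ iter (M - a - b).+1 (lefschetz e) w = 0].

Definition is_hodge_map (M : nat) (e : bool) : Prop :=
  forall a b j w, (a + b <= M)%N -> (j <= M - (a + b))%N ->
    primitive M e a b w ->
    let k := (a + b)%N in
    hodge (iter j (lefschetz e) w) =
      ((-1) ^+ 'C(k.+1, 2) * 'i%C ^ (a%:Z - b%:Z) *
       (j`!%:R / (M - j - k)`!%:R)) *: iter (M - j - k) (lefschetz e) w.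

(** The metric: forms of different degrees are orthogonal. *)
Definition metric (M : nat) (u v : W) : W :=
  \sum_(k < M.*2.+1) hodge (cdeg T k u * hodge (star (cdeg T k v))).

(** [B_(>0)] *)
Definition Bpos : set W := [set w | w != 0 /\
  exists m (c : 'I_m -> R) (b : 'I_m -> word r -> C),
    (forall k, 0 < c k /\ B (b k)) /\
    w = \sum_(k < m) real_complex R (c k) *: (star (inc (b k)) * inc (b k))].

Definition metric_posdef (M : nat) : Prop :=
  forall w, w != 0 -> Bpos (metric M w w).

Definition is_HK_complex (M : nat) : Prop :=
  [/\ is_HK_calculus M, is_star_calculus, is_fund_rep & is_complex_structure].

(** [H^k != 0] for [k > 0]: there is a closed [k]-form that is not exact. *)
Definition cohomology_neq0 (k : nat) : Prop :=
  exists w, [/\ Om k w, d w = 0 & ~ exists2 u, Om k.-1 u & w = d u].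

End Calculus.

(* Main.v *)
Require Import Defs.
From mathcomp Require Import functions mxtens.
From mathcomp Require Import all_boot all_order all_algebra.
From mathcomp Require Import complex.
From mathcomp Require Import boolp classical_sets reals topology normedtype.
From mathcomp Require Import ring lra zify.
Import Order.TTheory GRing.Theory Num.Theory.
Import numFieldNormedType.Exports.

(** The powers of the Kaehler form [kappa] represent nonzero classes. Suppose
    that the closed form [kappa^k] is exact. As [kappa] is closed and central,
    the top power [kappa^M] is then exact too, say [kappa^M = d nu]. Since
    [kappa^M] is coinvariant, [nu] can be averaged to a coinvariant form
    ([exists_coinvariant]), which by the hard Lefschetz isomorphism is
    [kappa^(M-1) mu] for a coinvariant one-form [mu]. But coinvariant one-forms
    are zero ([coinvariant_Om1_eq0]), so [kappa^M = 0]; this contradicts the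
    Lefschetz isomorphism from degree [0] to degree [2M].

    To see that a coinvariant one-form [mu] vanishes, split it into its parts of
    bidegree [(1,0)] and [(0,1)]. The torus acts on the class of [del z_iN] by
    the weight [wt v_i - varpi_x], which is not zero for [i] in [J_(1)], so
    that the class of a coinvariant [(1,0)]-form is zero: the form lies in
    [B^+ Omega] ([coinvariant_Bplus]). Its metric is then a function all of
    whose translates vanish at the identity, hence zero, and positive
    definiteness shows that the form is zero ([coinvariant_Bplus_eq0]). The other
    bidegree is similar.

    Two steps rest on complete reducibility. Averaging replaces the Haar state by
    the semisimplicity of finite sums of row modules of irreducible
    representations ([OqG_semisimple]). And the functions [z_ij] must be known to
    lie in [B]: they are coefficients of a Levi-invariant vector in the tensor
    product of [V_(varpi_x)] and its dual ([zcoef_OqGL]), and one needs that the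
    coefficients of such a tensor product are sums of coefficients of irreducible
    representations ([graded_OqG]).

    Complete reducibility ([hspan_all]) is proved for all modules with a weight
    basis, from the existence of an operator that commutes with the action and
    separates comparable dominant weights ([casimir_exists]). For [q != 1] this
    operator is built from the canonical element of the form on the free algebra
    for which the skew derivations are adjoint to multiplication by letters; for
    [q = 1] it is built from the trace form of the module. In both cases the
    pairing is degenerate, and the key point is that its radical acts by zero
    ([null_F_word], [trace_nondeg]): the operators in the radical commute with
    all the [E_i] and lower weights, and an operator that commutes with [E_i] and
    has negative [alpha_i]-weight is zero ([comm_E_eq0]). The same principle
    gives the Serre relations ([serreF]). *)

Set Implicit Arguments.
Unset Strict Implicit.
Unset Printing Implicit Defensive.
Local Open Scope ring_scope.

(** * Quantum integers *)

Section QuantumIntegers.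
Context (F : fieldType).

(** The quantum integer [[p]_t], completed by its limit at [t = 1]; it gives
    the eigenvalues of [H_i] for all [q] at once. *)
Definition qint (t : F) (p : int) : F :=
  if t == 1 then p%:~R else (t ^ p - t ^ (- p)) / (t - t^-1).

Lemma qintN t p : qint t (- p) = - qint t p.
Proof.
rewrite /qint; case: eqP => _; first by rewrite rmorphN.
by rewrite opprK -mulNr opprB.
Qed.

Lemma qint0 t : qint t 0 = 0.
Proof. by rewrite /qint; case: eqP => _ //; rewrite oppr0 subrr mul0r. Qed.

(** Both sides are [(t^(l+p) - t^(l-p)) / (t - t^-1)]. This governs how [H_i]
    acts on tensor products and how it commutes with operators of weight [p]. *)
Lemma qint_skew t l p : t != 0 -> (t != 1 -> t - t^-1 != 0) ->
  qint t (l + p) - t ^ (- p) * qint t l = qint t p * t ^ l.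
Proof.
move=> t0; rewrite /qint; case: eqP => [->|_] t1.
  by rewrite !exp1rz mul1r mulr1 -rmorphB /= addrC addKr.
have {}t1 := t1 isT.
have lp : t ^ l * t ^ (- l) = 1 by rewrite -expfzDr // subrr expr0z.
have tu : t * t^-1 = 1 by rewrite divff.
rewrite opprD !expfzDr //.
move: (t ^ l) (t ^ (- l)) (t ^ p) (t ^ (- p)) lp => a b c e ab.
apply: (mulIf t1); rewrite mulrBl divfK // -mulrA divfK //.
by rewrite [RHS]mulrC mulrA mulrCA divff // mulr1; ring.
Qed.

End QuantumIntegers.

Section RealQuantumIntegers.
Context (R : realType).
Implicit Types t : R.

Lemma qint_lt0 t p : 0 < t -> p < 0 -> qint t p < 0.
Proof.
move=> t0 p0; rewrite /qint; case: eqP => [_|/eqP t1]; first by rewrite ltrz0.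
have tp : t ^ p = (t ^+ `|p|)^-1 by case: p p0 => // n _; rewrite NegzE.
have tmp : t ^ (- p) = t ^+ `|p| by case: p p0 {tp} => // n _; rewrite NegzE opprK.
have n0 : (0 < `|p|)%N by rewrite absz_gt0 lt_eqF.
rewrite tp tmp; have [tl|tg|te] := ltgtP t 1; last by rewrite te eqxx in t1.
- rewrite pmulr_rlt0 ?subr_gt0 ?invr_lt0 ?subr_lt0.
    by apply: (lt_trans (y := 1)); rewrite // invf_gt1.
  apply: (lt_trans (y := 1)); first by rewrite exprn_ilt1 ?ltW // -lt0n.
  by rewrite invf_gt1 ?exprn_gt0 // exprn_ilt1 ?ltW // -lt0n.
- rewrite pmulr_llt0 ?invr_gt0 ?subr_gt0 ?subr_lt0.
    apply: (lt_trans (y := 1)); last by rewrite exprn_egt1 // -lt0n.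
    by rewrite invf_lt1 ?exprn_gt0 // exprn_egt1 // -lt0n.
  by apply: (lt_trans (y := 1)); rewrite // invf_lt1.
Qed.

Lemma qint_complex t p : qint (real_complex R t) p = real_complex R (qint t p).
Proof.
rewrite /qint -[X in _ == X](rmorph1 (real_complex R)).
rewrite (inj_eq (fmorph_inj _)); case: eqP => _; first by rewrite rmorph_int.
by rewrite fmorph_div !rmorphB /= !fmorphXz fmorphV.
Qed.

Lemma sub_inv_neq0 t : 0 < t -> t != 1 -> t - t^-1 != 0.
Proof.
move=> t0; apply: contraNneq => /eqP; rewrite subr_eq0 => /eqP e.
have : t ^+ 2 = 1 by rewrite expr2 {2}e divff // gt_eqF.
by move=> /eqP; rewrite sqrf_eq1 => /orP[//|/eqP e1]; move: t0; rewrite e1 ltr0N1.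
Qed.

End RealQuantumIntegers.

(** * Representations graded by weights *)

Section Grading.
Context (K : fieldType) (r m : nat) (b : 'I_m -> 'rV[int]_r).
Implicit Types (X Y : 'M[K]_m) (g h : 'rV[int]_r) (f : 'rV[int]_r -> K).

Definition homog g X := forall a c, X a c != 0 -> b a = b c + g.

Definition weight_op f : 'M[K]_m := diag_mx (\row_j f (b j)).

Definition weight_vec g (v : 'cV[K]_m) := forall a, v a 0 != 0 -> b a = g.

Lemma homogD g X Y : homog g X -> homog g Y -> homog g (X + Y).
Proof.
move=> hX hY a c; rewrite mxE => XY0; have [X0|/hX//] := eqVneq (X a c) 0.
by apply: hY; apply: contraNneq XY0 => Y0; rewrite X0 Y0 addr0.
Qed.

Lemma homogZ g k X : homog g X -> homog g (k *: X).
Proof.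
by move=> hX a c; rewrite mxE mulf_eq0 negb_or => /andP[_ /hX].
Qed.

Lemma homogN g X : homog g X -> homog g (- X).
Proof. by rewrite -scaleN1r; apply: homogZ. Qed.

Lemma homogB g X Y : homog g X -> homog g Y -> homog g (X - Y).
Proof. by move=> hX hY; apply: homogD => //; apply: homogN. Qed.

Lemma homogM g h X Y : homog g X -> homog h Y -> homog (g + h) (X *m Y).
Proof.
move=> hX hY a c; rewrite mxE => n0.
have [d] : exists d, X a d * Y d c != 0.
  apply/existsP; apply: contraNT n0; rewrite negb_exists => /forallP z.
  by rewrite big1 // => d _; apply/eqP; rewrite -[_ == _]negbK.
rewrite mulf_eq0 negb_or => /andP[/hX-> /hY->].
by rewrite -addrA [h + g]addrC.
Qed.

Lemma homog1 : homog 0 1%:M.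
Proof.
by move=> a c; rewrite mxE; have [->|_] := eqVneq a c; rewrite ?addr0 ?eqxx.
Qed.

Lemma homog_weight_op f : homog 0 (weight_op f).
Proof.
by move=> a c; rewrite !mxE; have [->|_] := eqVneq a c; rewrite ?addr0 ?eqxx.
Qed.

Lemma weight_opM g f X : homog g X ->
  weight_op f *m X = X *m weight_op (fun d => f (d + g)).
Proof.
move=> hX; apply/matrixP => a c; rewrite mul_diag_mx mul_mx_diag !mxE.
by have [->|/hX->] := eqVneq (X a c) 0; rewrite ?mulr0 ?mul0r // mulrC.
Qed.

Lemma weight_op_vec g f (v : 'cV[K]_m) : weight_vec g v -> 
  weight_op f *m v = f g *: v.
Proof.
move=> hv; apply/colP => a; rewrite mul_diag_mx !mxE.
by have [->|/hv->] := eqVneq (v a 0) 0; rewrite ?mulr0.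
Qed.

Lemma homog_vec g h X (v : 'cV[K]_m) :
  homog h X -> weight_vec g v -> weight_vec (g + h) (X *m v).
Proof.
move=> hX hv a; rewrite mxE => n0.
have [d] : exists d, X a d * v d 0 != 0.
  apply/existsP; apply: contraNT n0; rewrite negb_exists => /forallP z.
  by rewrite big1 // => d _; apply/eqP; rewrite -[_ == _]negbK.
by rewrite mulf_eq0 negb_or => /andP[/hX-> /hv->].
Qed.

Lemma weight_vecZ g k (v : 'cV[K]_m) : weight_vec g v -> weight_vec g (k *: v).
Proof. by move=> hv a; rewrite mxE mulf_eq0 negb_or => /andP[_ /hv]. Qed.

Lemma weight_vecD g (u v : 'cV[K]_m) :
  weight_vec g u -> weight_vec g v -> weight_vec g (u + v).
Proof.
move=> hX hY a; rewrite mxE => XY0; have [X0|/hX//] := eqVneq (u a 0) 0.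
by apply: hY; apply: contraNneq XY0 => Y0; rewrite X0 Y0 addr0.
Qed.

(** Only finitely many weights occur. *)
Lemma homog_far (i : 'I_r) : exists B : nat, 
  (forall g X, homog g X -> (B%:Z < `|g 0 i|) -> X = 0).
Proof.
(* No weight difference has a larger coordinate. *)
pose B := (\sum_a \sum_c absz ((b a - b c)%R ord0 i))%N; exists B => g X hX Bg.
apply/matrixP => a c; rewrite [RHS]mxE; apply/eqP; apply: contraTT Bg => /hX e.
rewrite -leNgt; have -> : g = b a - b c by rewrite e addrAC subrr add0r.
rewrite -abszE lez_nat /B (bigD1 a) //= (bigD1 c) //=.
by rewrite -addnA leq_addr.
Qed.

Lemma weight_vec_far (i : 'I_r) : exists B : nat, 
  (forall g v, weight_vec g v -> (B%:Z < `|g 0 i|) -> v = 0).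
Proof.
pose B := (\sum_a absz (b a ord0 i))%N; exists B => g v hv Bg.
apply/colP => a; rewrite [RHS]mxE; apply/eqP; apply: contraTT Bg => /hv e.
by rewrite -leNgt -e -abszE lez_nat /B (bigD1 a) //= leq_addr.
Qed.

End Grading.

Section Weights.
Context (r : nat) (D : cartan_datum r).
Local Notation al := (@simple_root r).

Lemma root_to_weightD g h :
  root_to_weight D (g + h) = root_to_weight D g + root_to_weight D h.
Proof.
apply/rowP => i; rewrite !mxE -big_split; apply: eq_bigr => j _.
by rewrite mxE mulrDr.
Qed.

Lemma root_to_weightN g : root_to_weight D (- g) = - root_to_weight D g.
Proof.
apply/rowP => i; rewrite !mxE -sumrN; apply: eq_bigr => j _.
by rewrite mxE mulrN.
Qed.

Lemma root_to_weight_simple i j : root_to_weight D (al j) 0 i = cmat D i j.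
Proof.
rewrite mxE (bigD1 j) //= big1 => [|k /negPf kj].
  by rewrite mxE !eqxx mulr1 addr0.
by rewrite mxE kj andbF mulr0.
Qed.

Definition coroot (l0 b : 'rV[int]_r) (i : 'I_r) : int :=
  (l0 + root_to_weight D b) 0 i.

Lemma corootD l0 b g i :
  coroot l0 (b + g) i = coroot l0 b i + root_to_weight D g 0 i.
Proof. by rewrite /coroot root_to_weightD addrA mxE. Qed.

Lemma root_to_weight_string i k : cmat D i i = 2 ->
  root_to_weight D (- (al i *+ k)) 0 i = - (2 * k%:Z).
Proof.
move=> cii; elim: k => [|k IH].
  by rewrite mulr0n oppr0 mxE big1 // => s _; rewrite mxE mulr0.
rewrite mulrS opprD root_to_weightD mxE IH root_to_weightN mxE.
by rewrite root_to_weight_simple cii; lia.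
Qed.

End Weights.

Section GradedRepresentations.
Context (R : realType) (r : nat) (D : cartan_datum r) (q : R).
Local Notation C := R[i].
Local Notation al := (@simple_root r).
Hypothesis (q0 : 0 < q).

(** Modules with a weight basis, the [j]-th basis vector having weight
    [l0 + b j]. Recording weights as integer vectors instead of eigenvalues
    treats [q = 1] on the same footing as [q != 1]. The Serre relations follow
    from the other ones on such a module ([serreE] and [serreF]), so tensor
    products and duals need no verification of them. *)
Record graded_rep m (V : gen r -> 'M[C]_m) (l0 : 'rV[int]_r)
    (b : 'I_m -> 'rV[int]_r) : Prop := GradedRep {
  gr_K : forall i,
    V (GK i) = weight_op b (fun d => qi D q i ^ coroot D l0 d i);
  gr_Kinv : forall i,
    V (GKinv i) = weight_op b (fun d => qi D q i ^ (- coroot D l0 d i));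
  gr_H : forall i,
    V (GH i) = weight_op b (fun d => qint (qi D q i) (coroot D l0 d i));
  gr_E : forall i, homog b (al i) (V (GE i));
  gr_F : forall i, homog b (- al i) (V (GF i));
  gr_EF : forall i j, V (GE i) *m V (GF j) - V (GF j) *m V (GE i) =
    if i == j then V (GH i) else 0 }.

Arguments gr_E {m V l0 b}.
Arguments gr_F {m V l0 b}.

Lemma qiE i : qi D q i = real_complex R (q ^+ slen D i).
Proof. by rewrite /qi /qC rmorphXn. Qed.

Lemma qi_neq0 i : qi D q i != 0.
Proof. by rewrite qiE fmorph_eq0 expf_neq0 // gt_eqF. Qed.

Lemma qi_sub_inv i : qi D q i != 1 -> qi D q i - (qi D q i)^-1 != 0.
Proof.
rewrite qiE -[X in _ != X](rmorph1 (real_complex R)).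
rewrite (inj_eq (fmorph_inj _)) => q1.
by rewrite -fmorphV -rmorphB fmorph_eq0 sub_inv_neq0 // exprn_gt0.
Qed.

(** All the summands are negative. *)
Lemma sum_qint_neq0 i p k : p < 0 ->
  \sum_(s < k.+1) qint (qi D q i) (p - 2 * s%:Z) != 0.
Proof.
move=> p0; rewrite qiE (eq_bigr _ (fun s _ => qint_complex _ _)) -rmorph_sum.
rewrite fmorph_eq0 lt_eqF // big_ord_recl /= ltr_wnDr //; last first.
  by apply: qint_lt0; rewrite ?exprn_gt0 //; lia.
by apply: sumr_le0 => s _; rewrite ltW // qint_lt0 ?exprn_gt0 //; lia.
Qed.

Section Fixed.
Context (m : nat) (V : gen r -> 'M[C]_m) (l0 : 'rV[int]_r).
Context (b : 'I_m -> 'rV[int]_r) (rV : graded_rep V l0 b).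
Context (cii : forall i, cmat D i i = 2).

(** The iterated adjoint action of [F_i] on an operator of [alpha_i]-weight [p]. *)
Fixpoint adF i (p : int) (X : 'M[C]_m) k : 'M[C]_m :=
  if k is k'.+1 then
    V (GF i) *m adF i p X k'
      - qi D q i ^ (- (p - 2 * k'%:Z)) *: (adF i p X k' *m V (GF i))
  else X.

Lemma homog_adF i p g X k :
  homog b g X -> homog b (g - (al i) *+ k) (adF i p X k).
Proof.
move=> hX; elim: k => [|k IH] /=; first by rewrite subr0.
have -> : g - al i *+ k.+1 = - al i + (g - al i *+ k).
  by rewrite mulrS opprD addrCA.
apply: homogB; first by apply: homogM IH; apply: gr_F rV i.
apply: homogZ; rewrite [- al i + _]addrC.
by apply: homogM IH _; apply: gr_F rV i.
Qed.

Lemma adF_step i g X (p := root_to_weight D g 0 i) : homog b g X ->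
  V (GH i) *m X - qi D q i ^ (- p) *: (X *m V (GH i)) =
  qint (qi D q i) p *: (X *m V (GK i)).
Proof.
move=> hX; rewrite (gr_H rV) (gr_K rV) (weight_opM _ hX).
rewrite /weight_op !mul_mx_diag; apply/matrixP => a c; rewrite !mxE.
rewrite corootD -/p mulrCA -mulrBr qint_skew ?qi_neq0 //; last exact: qi_sub_inv.
by rewrite mulrCA.
Qed.

(** The [sl_2]-string of a highest weight vector, for the adjoint action on
    operators: the factor is the sum of the quantum integers of the weights
    along the string. *)
Lemma comm_adF i g X k (p := root_to_weight D g 0 i) : homog b g X ->
  V (GE i) *m X = X *m V (GE i) ->
  V (GE i) *m adF i p X k.+1 - adF i p X k.+1 *m V (GE i) =
  (\sum_(s < k.+1) qint (qi D q i) (p - 2 * s%:Z)) *: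
     (adF i p X k *m V (GK i)).
Proof.
set t := qi D q i; set E := V (GE i); set F := V (GF i) => hX EX.
have EF Y : E *m F *m Y = F *m E *m Y + V (GH i) *m Y.
  by rewrite -mulmxDl; congr (_ *m _); apply/eqP; rewrite addrC -subr_eq (gr_EF rV) eqxx.
have EF' Y : Y *m E *m F = Y *m F *m E + Y *m V (GH i).
  by rewrite -!mulmxA -mulmxDr; congr (_ *m _); apply/eqP; rewrite addrC -subr_eq (gr_EF rV) eqxx.
have step k' (Y := adF i p X k') (p' := p - 2 * k'%:Z) :
    E *m adF i p X k'.+1 - adF i p X k'.+1 *m E =
    F *m (E *m Y - Y *m E) - t ^ (- p') *: ((E *m Y - Y *m E) *m F)
      + qint t p' *: (Y *m V (GK i)).
  have hY : homog b (g - al i *+ k') Y by apply: homog_adF.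
  have -> : p' = root_to_weight D (g - al i *+ k') 0 i.
    by rewrite root_to_weightD mxE -/p root_to_weight_string.
  rewrite -(adF_step i hY) -/(adF i p X k').
  have -> : root_to_weight D (g - al i *+ k') 0 i = p'.
    by rewrite root_to_weightD mxE -/p root_to_weight_string.
  rewrite [adF i p X k'.+1]/= -/Y -/t -/F -/p'.
  rewrite !(mulmxBr, mulmxBl) -?scalemxAl -?scalemxAr.
  rewrite mulmxA EF !mulmxA EF'.
  rewrite scalerBr !scalerDr; do 6 move: (_ *m _) => ?; move: (t ^ _) => z.
  by apply/matrixP => x y; rewrite !mxE; ring.
elim: k => [|k IH].
  by rewrite step /= EX subrr mulmx0 mul0mx scaler0 subr0 add0r big_ord1.
have -> : \sum_(s < k.+2) qint t (p - 2 * s%:Z) =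
    \sum_(s < k.+1) qint t (p - 2 * s%:Z) + qint t (p - 2 * k.+1%:Z).
  by rewrite big_ord_recr.
rewrite step IH scalerDl; congr (_ + _).
rewrite [adF i p X k.+1]/= -/t -/F.
rewrite -!scalemxAl -scalemxAr scalerA mulrC -scalerA -scalerBr; congr (_ *: _).
rewrite mulmxBl -scalemxAl !mulmxA -/F; congr (_ - _).
have KF : V (GK i) *m F = t ^ (- 2) *: (F *m V (GK i)).
  rewrite (gr_K rV) (weight_opM _ (gr_F rV i)) /weight_op !mul_mx_diag.
  apply/matrixP => x y; rewrite !mxE mulrCA corootD root_to_weightN mxE.
  by rewrite root_to_weight_simple cii addrC expfzDr ?qi_neq0.
rewrite -!mulmxA KF -scalemxAr scalerA -expfzDr ?qi_neq0 //.
by congr (_ ^ _ *: _); lia.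
Qed.

(** An operator of negative [alpha_i]-weight that commutes with [E_i] is a
    highest weight vector of negative weight for the adjoint action, hence
    zero. *)
Lemma comm_E_eq0 i g X : homog b g X -> root_to_weight D g 0 i < 0 ->
  V (GE i) *m X = X *m V (GE i) -> X = 0.
Proof.
move=> hX p0 EX; set p := root_to_weight D g 0 i in p0.
have [B hB] := homog_far C b i.
have z : adF i p X (B + `|g 0 i|).+1 = 0.
  apply: (hB _ _ (@homog_adF i p g X (B + `|g 0%R i|).+1 hX)); rewrite mxE mxE mulmxnE mxE !eqxx.
  by rewrite mulr1n natz; clear; move: (g 0 i) => x; lia.
elim: (_ + _).+1 z => [//|k IH] z; apply: IH.
have := comm_adF k hX EX; rewrite -/p z mulmx0 mul0mx subrr => /esym/eqP.
rewrite scaler_eq0 (negPf (sum_qint_neq0 _ _ p0)) /= => /eqP XK.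
have : adF i p X k *m V (GK i) *m V (GKinv i) = 0 by rewrite XK mul0mx.
rewrite -mulmxA (gr_K rV) (gr_Kinv rV) /weight_op mulmx_diag.
set d := diag_mx _; suff -> : d = 1%:M by rewrite mulmx1.
apply/matrixP => x y; rewrite !mxE -expfzDr ?qi_neq0 // subrr expr0z.
by [].
Qed.

End Fixed.
End GradedRepresentations.
Arguments gr_E {R r D q m V l0 b}.
Arguments gr_F {R r D q m V l0 b}.

(** * Strings and the quantum Serre relations *)

Section QuantumBinomials.
Context (F : fieldType) (t : F).
Hypotheses (t0 : t != 0) (qnum0 : forall n, qnum t n.+1 != 0).

Lemma qnumD a c : qnum t (a + c) = t ^ (- c%:Z) * qnum t a + t ^ a%:Z * qnum t c.
Proof.
rewrite /qnum addnC big_split_ord /= addrC !mulr_sumr; congr (_ + _);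
  apply: eq_bigr => s _; rewrite -expfzDr //; congr (_ ^ _); lia.
Qed.

Lemma qfactS n : qfact t n.+1 = qfact t n * qnum t n.+1.
Proof. by rewrite /qfact big_nat_recr. Qed.

Lemma qfact_neq0 n : qfact t n != 0.
Proof.
elim: n => [|n IH]; first by rewrite /qfact big_nil oner_eq0.
by rewrite qfactS mulf_neq0.
Qed.

Lemma qbinom0 n : qbinom t n 0 = 1.
Proof.
by rewrite /qbinom subn0 /qfact big_nil mul1r divff // qfact_neq0.
Qed.

Lemma qbinomnn n : qbinom t n n = 1.
Proof.
by rewrite /qbinom subnn {3}/qfact big_nil mulr1 divff // qfact_neq0.
Qed.

Lemma qbinom_sub n k : (k <= n)%N -> qbinom t n (n - k) = qbinom t n k.
Proof. by move=> kn; rewrite /qbinom subKn // [X in _ / X]mulrC. Qed.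

Lemma qbinomS n k : (k < n)%N -> qbinom t n.+1 k.+1 =
  t ^ (- k.+1%:Z) * qbinom t n k.+1 + t ^ (n - k)%:Z * qbinom t n k.
Proof.
move=> kn; rewrite /qbinom !qfactS subSS.
have -> : (n - k = (n - k.+1).+1)%N by lia.
rewrite qfactS; have -> : (n.+1 = (n - k.+1).+1 + k.+1)%N by lia.
rewrite qnumD.
have := qfact_neq0 k; have := qfact_neq0 (n - k.+1).
have := qnum0 k; have := qnum0 (n - k.+1).
move: (qfact t k) (qfact t (n - k.+1)) (qnum t k.+1) (qnum t (n - k.+1).+1).
move: (t ^ _) (t ^ _) => x y a c d e e0 d0 c0 a0.
by field; rewrite a0 c0 d0 e0.
Qed.

End QuantumBinomials.

Section Twist.
Context (R : realType) (r : nat) (D : cartan_datum r) (q : R).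
Local Notation C := R[i].
Local Notation al := (@simple_root r).
Hypothesis (q0 : 0 < q).

(** The Chevalley involution, which carries statements about lowering operators
    over to raising operators. *)
Definition chevalley_twist m (V : gen r -> 'M[C]_m) (g : gen r) : 'M[C]_m :=
  match g with
  | GE i => V (GF i) | GF i => V (GE i)
  | GK i => V (GKinv i) | GKinv i => V (GK i) | GH i => - V (GH i)
  end.

Lemma coroot_opp l0 b i : coroot D (- l0) (- b) i = - coroot D l0 b i.
Proof. by rewrite /coroot root_to_weightN -opprD mxE. Qed.

Lemma graded_twist m (V : gen r -> 'M[C]_m) l0 b : graded_rep D q V l0 b ->
  graded_rep D q (chevalley_twist V) (- l0) (fun j => - b j).
Proof.
move=> rV; split=> [i|i|i|i|i|i j] /=.
- rewrite (gr_Kinv rV); congr diag_mx; apply/rowP => j.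
  by rewrite !mxE coroot_opp.
- rewrite (gr_K rV); congr diag_mx; apply/rowP => j.
  by rewrite !mxE coroot_opp opprK.
- rewrite (gr_H rV) -linearN; congr diag_mx; apply/rowP => j.
  by rewrite !mxE coroot_opp qintN.
- by move=> a c /(gr_F rV i a c) ->; rewrite opprB addrC.
- by move=> a c /(gr_E rV i a c) ->; rewrite opprD.
- rewrite -opprB (gr_EF rV) eq_sym; case: eqP => [->//|_]; first by rewrite oppr0.
Qed.

Section Dominance.
Context (m : nat) (V : gen r -> 'M[C]_m) (l0 : 'rV[int]_r).
Context (b : 'I_m -> 'rV[int]_r) (rV : graded_rep D q V l0 b).
Context (cii : forall i, cmat D i i = 2).

Record submodule (S : 'cV[C]_m -> Prop) : Prop := Submodule {
  sub0 : S 0;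
  subZD : forall c u v, S u -> S v -> S (c *: u + v);
  sub_act : forall g u, S u -> S (V g *m u) }.

Section Sub.
Context (S : 'cV[C]_m -> Prop) (hS : submodule S).

Lemma subD u v : S u -> S v -> S (u + v).
Proof. by move=> Su Sv; rewrite -[u]scale1r; apply: subZD. Qed.

Lemma subZ c u : S u -> S (c *: u).
Proof.
by move=> Su; rewrite -[c *: u]addr0; apply: subZD => //; apply: sub0.
Qed.

Lemma subB u v : S u -> S v -> S (u - v).
Proof. by move=> Su Sv; rewrite -scaleN1r addrC; apply: subZD. Qed.

Lemma sub_sum (I : Type) (s : seq I) (P : pred I) (G : I -> 'cV[C]_m) :
  (forall i, P i -> S (G i)) -> S (\sum_(i <- s | P i) G i).
Proof. by move=> hG; apply: (big_ind S) => //; [exact: sub0|exact: subD]. Qed.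

(** The [sl_2]-string of a highest weight vector, modulo a submodule. *)
Lemma E_F_string i u g k : weight_vec b g u -> S (V (GE i) *m u) ->
  S (V (GE i) *m iter k.+1 (mulmx (V (GF i))) u -
     (\sum_(s < k.+1) qint (qi D q i) (coroot D l0 g i - 2 * s%:Z)) *:
       iter k (mulmx (V (GF i))) u).
Proof.
move=> hu SE; set F := V (GF i); set E := V (GE i).
have EF v : E *m (F *m v) = F *m (E *m v) + V (GH i) *m v.
  rewrite !mulmxA -mulmxDl; congr (_ *m _); apply/eqP.
  by rewrite addrC -subr_eq (gr_EF rV) eqxx.
have wk k' : weight_vec b (g - al i *+ k') (iter k' (mulmx F) u).
  elim: k' => [|k' IH]; first by rewrite subr0.
  by rewrite iterS mulrSr opprD addrA; apply: homog_vec IH; apply: gr_F rV i.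
have H k' : V (GH i) *m iter k' (mulmx F) u =
    qint (qi D q i) (coroot D l0 g i - 2 * k'%:Z) *: iter k' (mulmx F) u.
  rewrite (gr_H rV) (weight_op_vec _ (wk k')) corootD.
  by rewrite root_to_weight_string.
elim: k => [|k IH].
  rewrite big_ord1 iterS EF H [iter 0 _ _]/= addrK.
  exact: (sub_act hS).
rewrite iterS EF H.
have -> : \sum_(s < k.+2) qint (qi D q i) (coroot D l0 g i - 2 * s%:Z) =
    \sum_(s < k.+1) qint (qi D q i) (coroot D l0 g i - 2 * s%:Z) +
    qint (qi D q i) (coroot D l0 g i - 2 * k.+1%:Z) by rewrite big_ord_recr.
rewrite scalerDl opprD addrACA subrr addr0 {2}iterS scalemxAr -mulmxBr.
exact: (sub_act hS).
Qed.

(** A vector that is annihilated by [E_i] modulo a submodule and has negative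
    [alpha_i]-weight generates an infinite string unless it lies in the
    submodule. *)
Lemma highest_neg i u g : weight_vec b g u -> S (V (GE i) *m u) ->
  coroot D l0 g i < 0 -> S u.
Proof.
move=> hu SE neg; have [B hB] := weight_vec_far C b i.
have z : S (iter (B + absz (g ord0 i)).+1 (mulmx (V (GF i))) u).
  set n := (_ + _).+1.
  have wn : weight_vec b (g - al i *+ n) (iter n (mulmx (V (GF i))) u).
    elim: n => [|n IH]; first by rewrite subr0.
    by rewrite iterS mulrSr opprD addrA; apply: homog_vec IH; apply: gr_F rV i.
  rewrite (hB _ _ wn); first exact: sub0 hS.
  rewrite mxE mxE mulmxnE mxE !eqxx mulr1n natz /n.
  by clear; move: (g ord0 i) => x; lia.
elim: (_ + _).+1 z => [//|k IH] z; apply: IH.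
have h := E_F_string k hu SE; have {z}z := sub_act hS (GE i) z.
have {h z} := subB z h; rewrite opprB addrCA subrr addr0 => h.
have := subZ (\sum_(s < k.+1) qint (qi D q i) (coroot D l0 g i - 2 * s%:Z))^-1 h.
by rewrite scalerA mulVf ?scale1r // sum_qint_neq0.
Qed.

End Sub.
End Dominance.

Section Serre.
Context (m : nat) (V : gen r -> 'M[C]_m) (l0 : 'rV[int]_r).
Context (b : 'I_m -> 'rV[int]_r) (rV : graded_rep D q V l0 b).
Context (cii : forall i, cmat D i i = 2).
Context (cij : forall i j, i != j -> cmat D i j <= 0).

Lemma qnum_qi_neq0 i n : qnum (qi D q i) n.+1 != 0.
Proof.
rewrite /qnum qiE (eq_bigr (fun s : 'I_n.+1 => real_complex R
   ((q ^+ slen D i) ^ (n.+1%:Z - 1 - (s.*2)%:Z)))); last first.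
  by move=> s _; rewrite fmorphXz.
rewrite -rmorph_sum fmorph_eq0 gt_eqF // big_ord_recl ltr_wpDr //.
  by apply: sumr_ge0 => s _; rewrite ltW // exprz_gt0 // exprn_gt0.
by rewrite exprz_gt0 // exprn_gt0.
Qed.

(** The quantum binomial theorem, for left multiplication by [F_i] and right
    multiplication weighted by a power of [q_i] that changes along the string. *)
Lemma adF_expand i p X k : let t := qi D q i in let F := V (GF i) in
  adF D q V i p X k = \sum_(s < k.+1) ((-1) ^+ s * t ^ (s%:Z * (k%:Z - 1 - p)) *
    qbinom t k s) *: (F ^+ (k - s) * X * F ^+ s).
Proof.
move=> t F; have t0 : t != 0 by apply: qi_neq0.
have qn n : qnum t n.+1 != 0 by apply: qnum_qi_neq0.
elim: k => [|k IH].
  by rewrite big_ord1 /= qbinom0 // mul0r expr0z !expr0 !mulr1 scale1r mul1r.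
pose a s := (-1) ^+ s * t ^ (s%:Z * (k%:Z - 1 - p)) * qbinom t k s.
pose G s := F ^+ (k.+1 - s) * X * F ^+ s.
have -> : adF D q V i p X k.+1 = \sum_(s < k.+2) (if (s <= k)%N then a s else 0) *: G s
    - \sum_(s < k.+2) (if (s : nat) is s'.+1 then t ^ (- (p - 2 * k%:Z)) * a s' else 0) *: G s.
  rewrite /= -/t -/F IH; congr (_ - _).
    rewrite mulmx_sumr [RHS]big_ord_recr /= ltnn scale0r addr0.
    apply: eq_bigr => s _; rewrite -ltnS ltn_ord -scalemxAr -/(a s) /G.
    by rewrite subSn -1?ltnS // exprS !mulmxE !mulrA.
  rewrite mulmx_suml scaler_sumr [RHS]big_ord_recl /= scale0r add0r.
  apply: eq_bigr => s _; rewrite -scalemxAl scalerA -/(a s) /G /bump /= add1n.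
  by rewrite subSS exprSr !mulmxE !mulrA.
rewrite -sumrB; apply: eq_bigr => s _; rewrite -scalerBl -/(G s); congr (_ *: _).
case: s => -[|s] /= ls; first by rewrite /a !expr0 !mul0r !qbinom0 // subr0.
rewrite /a.
have [ks|ks] := ltnP s k; last first.
  have -> : s = k by lia.
  rewrite !qbinomnn // !mulr1 sub0r exprS mulrCA -expfzDr // mulN1r mulNr.
  by congr (- (_ * _ ^ _)); lia.
rewrite qbinomS // [(-1) ^+ s.+1]exprS !mulN1r !mulNr -opprD; congr (- _).
have e1 : t ^ (s.+1%:Z * (k.+1%:Z - 1 - p)) * t ^ (- s.+1%:Z) =
    t ^ (s.+1%:Z * (k%:Z - 1 - p)) by rewrite -expfzDr //; congr (_ ^ _); lia.
have e2 : t ^ (s.+1%:Z * (k.+1%:Z - 1 - p)) * t ^ (k - s)%:Z =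
    t ^ (- (p - 2 * k%:Z)) * t ^ (s%:Z * (k%:Z - 1 - p)).
  by rewrite -!expfzDr //; congr (_ ^ _); rewrite -subzn ?(ltnW ks) //; lia.
move: e1 e2; move: (t ^ _) (t ^ _) (t ^ _) (t ^ _) (t ^ _) (t ^ _).
move=> x1 x2 x3 x4 x5 x6 <- e2; set a1 := (-1) ^+ s.
have -> : x2 * (a1 * x1 * qbinom t k s) = a1 * (x2 * x1) * qbinom t k s by ring.
by rewrite -e2; ring.
Qed.

Lemma adF_serre_eq0 i j : i != j ->
  adF D q V i (- cmat D i j) (V (GF j)) `|1 - cmat D i j|%N = 0.
Proof.
move=> ij; set p := - cmat D i j; have p0 : 0 <= p by rewrite oppr_ge0 cij.
have -> : `|1 - cmat D i j|%N = `|p|.+1 by rewrite -/p; lia.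
have pE : root_to_weight D (- al j) 0 i = p.
  by rewrite root_to_weightN mxE root_to_weight_simple.
have EX : V (GE i) *m V (GF j) = V (GF j) *m V (GE i).
  by apply/eqP; rewrite -subr_eq0 (gr_EF rV) (negPf ij).
have hX : homog b (- al j) (V (GF j)) by apply: (gr_F rV).
have hS : homog b (- al j - al i *+ `|p|.+1)
  (adF D q V i p (V (GF j)) `|p|.+1) by apply: (homog_adF rV).
apply: (comm_E_eq0 q0 rV cii (i := i) hS).
  by rewrite root_to_weightD mxE [X in X + _]pE root_to_weight_string //; lia.
have := comm_adF q0 rV cii `|p| hX EX; cbv zeta; rewrite pE => e.
apply/eqP; rewrite -subr_eq0 e; suff -> : \sum_(s < `|p|.+1)
  qint (qi D q i) (p - 2 * s%:Z) = 0 by rewrite scale0r.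
set S := \sum_(_ < _) _.
have : S + S = 0.
  rewrite {1}/S (reindex_inj rev_ord_inj) -big_split /= big1 // => s _.
  rewrite [X in qint _ X + _](_ : _ = - (p - 2 * s%:Z)) ?qintN ?addNr //.
  by have := ltn_ord s; rewrite subSS; lia.
by rewrite -mulr2n => /eqP; rewrite mulrn_eq0 => /eqP.
Qed.

(** The quantum Serre relations are the statement that the adjoint string of
    [F_j] under [F_i] stops: its first excess term commutes with [E_i] and has
    negative weight. *)
Lemma serreF i j : i != j -> qserre D q V (@GF r) i j = 0.
Proof.
move=> ij; have := adF_serre_eq0 ij; rewrite adF_expand.
set m' := `|1 - cmat D i j|%N; set t := qi D q i; set F := V (GF i) => e.
have t0 : t != 0 by apply: qi_neq0.
have mE : m'%:Z - 1 - - cmat D i j = 0 by have := cij ij; rewrite /m'; lia.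
rewrite -(scaler0 _ ((-1) ^+ m')) -e scaler_sumr /qserre.
rewrite (reindex_inj rev_ord_inj); apply: eq_bigr => s _ /=.
rewrite subSS mE mulr0 expr0z mulr1 scalerA subKn -1?ltnS //.
rewrite qbinom_sub -1?ltnS // -/m'; congr (_ *: _).
rewrite [RHS]mulrA -exprD; congr (_ * _).
rewrite -signr_odd -[RHS]signr_odd oddD oddB -1?ltnS //.
Qed.

End Serre.

Lemma serreE m (V : gen r -> 'M[C]_m) l0 b i j : graded_rep D q V l0 b ->
  (forall i, cmat D i i = 2) -> (forall i j, i != j -> cmat D i j <= 0) ->
  i != j -> qserre D q V (@GE r) i j = 0.
Proof. by move=> /graded_twist rV cii cij; apply: (serreF rV cii cij). Qed.

End Twist.

(** * Skew derivations of the free algebra *)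

Section SkewDerivations.
Context (K : fieldType) (I : finType) (c : I -> I -> K).
Hypothesis (c_sym : forall i j, c i j = c j i).

Definition char_word (y : I -> K) (w : seq I) : K := \prod_(j <- w) y j.

Lemma char_word_cons y j w : char_word y (j :: w) = y j * char_word y w.
Proof. by rewrite /char_word big_cons. Qed.

Lemma char_word_rcons y j w : char_word y (rcons w j) = char_word y w * y j.
Proof. by rewrite /char_word -cats1 big_cat big_seq1. Qed.

Section Deletions.
Context (L : lmodType K).
Implicit Types f g : seq I -> L.

(** The two skew derivations of the free algebra on [I], transposed so that
    they act on functions of words: [rdel i f w] and [ldel i f w] extend [f]
    linearly and evaluate it on the sum of the words obtained from [w] by
    deleting one letter [i], weighted by the letters that stood to its right,
    respectively to its left. *)
Fixpoint rdel i f w : L :=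
  if w is j :: w' then
    (i == j)%:R *: (char_word (c i) w' *: f w') + rdel i (fun u => f (j :: u)) w'
  else 0.

Fixpoint ldel i f w : L :=
  if w is j :: w' then
    (i == j)%:R *: f w' + c i j *: ldel i (fun u => f (j :: u)) w'
  else 0.

Lemma eq_rdel i f g w : (forall u, size w = (size u).+1 -> f u = g u) ->
  rdel i f w = rdel i g w.
Proof.
elim: w f g => //= j w IH f g fg; rewrite fg //; congr (_ + _).
by apply: IH => u e; apply: fg; rewrite /= e.
Qed.

Lemma eq_ldel i f g w : (forall u, size w = (size u).+1 -> f u = g u) ->
  ldel i f w = ldel i g w.
Proof.
elim: w f g => //= j w IH f g fg; rewrite fg //; congr (_ + _ *: _).
by apply: IH => u e; apply: fg; rewrite /= e.
Qed.

Lemma rdel_lin i k f g w :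
  rdel i (fun u => k *: f u + g u) w = k *: rdel i f w + rdel i g w.
Proof.
elim: w f g => [|j w IH] f g /=; first by rewrite scaler0 addr0.
rewrite IH !scalerDr -!addrA; congr (_ + _).
  by rewrite !scalerA; congr (_ *: _); ring.
by rewrite addrCA.
Qed.

Lemma ldel_lin i k f g w :
  ldel i (fun u => k *: f u + g u) w = k *: ldel i f w + ldel i g w.
Proof.
elim: w f g => [|j w IH] f g /=; first by rewrite scaler0 addr0.
rewrite IH !scalerDr !scalerA -!addrA ![k * _]mulrC; congr (_ + _).
by rewrite addrCA.
Qed.

Lemma rdel0 i w : rdel i (fun _ => 0) w = 0.
Proof. by elim: w => //= j w ->; rewrite !scaler0 addr0. Qed.

Lemma ldel0 i w : ldel i (fun _ => 0) w = 0.
Proof. by elim: w => //= j w ->; rewrite !scaler0 addr0. Qed.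

Lemma rdelZ i k f w : rdel i (fun u => k *: f u) w = k *: rdel i f w.
Proof.
have := rdel_lin i k f (fun _ => 0) w; rewrite rdel0 addr0 => <-.
by apply: eq_rdel => u _; rewrite addr0.
Qed.

Lemma ldelZ i k f w : ldel i (fun u => k *: f u) w = k *: ldel i f w.
Proof.
have := ldel_lin i k f (fun _ => 0) w; rewrite ldel0 addr0 => <-.
by apply: eq_ldel => u _; rewrite addr0.
Qed.

Lemma rdelD i f g w : rdel i (fun u => f u + g u) w = rdel i f w + rdel i g w.
Proof.
have := rdel_lin i 1 f g w; rewrite scale1r => <-.
by apply: eq_rdel => u _; rewrite scale1r.
Qed.

Lemma ldelD i f g w : ldel i (fun u => f u + g u) w = ldel i f w + ldel i g w.
Proof.
have := ldel_lin i 1 f g w; rewrite scale1r => <-.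
by apply: eq_ldel => u _; rewrite scale1r.
Qed.

Lemma rdel_char i y f w :
  y i *: rdel i (fun u => char_word y u *: f u) w = char_word y w *: rdel i f w.
Proof.
elim: w f => [|j w IH] f /=; first by rewrite !scaler0.
rewrite char_word_cons !scalerDr; congr (_ + _).
  have [->|_] := eqVneq i j; last by rewrite !scale0r !scaler0.
  by rewrite !scalerA; congr (_ *: _); ring.
rewrite -scalerA -IH scalerA [y j * _]mulrC -[RHS]scalerA; congr (_ *: _).
rewrite -rdelZ.
by apply: eq_rdel => u _; rewrite char_word_cons scalerA.
Qed.

Lemma ldel_char i y f w :
  y i *: ldel i (fun u => char_word y u *: f u) w = char_word y w *: ldel i f w.
Proof.
elim: w f => [|j w IH] f /=; first by rewrite !scaler0.
rewrite char_word_cons !scalerDr; congr (_ + _).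
  have [->|_] := eqVneq i j; last by rewrite !scale0r !scaler0.
  by rewrite !scalerA; congr (_ *: _); ring.
have -> : ldel i (fun u => char_word y (j :: u) *: f (j :: u)) w =
    y j *: ldel i (fun u => char_word y u *: f (j :: u)) w.
  by rewrite -ldelZ; apply: eq_ldel => u _; rewrite char_word_cons scalerA.
have -> : (y j * char_word y w) *: (c i j *: ldel i (fun u => f (j :: u)) w) =
  (y j * c i j) *: (char_word y w *: ldel i (fun u => f (j :: u)) w).
  by rewrite !scalerA; congr (_ *: _); ring.
by rewrite -IH !scalerA; congr (_ *: _); ring.
Qed.

(** The free algebra is an algebra in a braided category, for which left and
    right deletions commute; hence the form defined from left deletions is
    also compatible with right ones. *)
Lemma ldel_rdel i j f w :
  ldel i (rdel j f) w = rdel j (ldel i f) w.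
Proof.
elim: w f => [|k w IH] f //=.
rewrite ldelD rdelD IH scalerDr addrCA; congr (_ + (_ + _)).
  rewrite ldelZ; have [->|_] := eqVneq j k; last by rewrite !scale0r scaler0.
  by rewrite !scale1r c_sym ldel_char.
- by rewrite rdelZ.
- by rewrite rdelZ; congr (_ *: _); apply: (IH (fun u => f (k :: u))).
Qed.

End Deletions.

Lemma linear_rdel (L L' : lmodType K) (h : {linear L -> L'}) i (f : seq I -> L) w :
  rdel i (fun u => h (f u)) w = h (rdel i f w).
Proof.
elim: w f => [|j w IH] f /=; first by rewrite linear0.
by rewrite (IH (fun u => f (j :: u))) (linearD h) !(linearZ_LR h).
Qed.

Lemma linear_ldel (L L' : lmodType K) (h : {linear L -> L'}) i (f : seq I -> L) w :
  ldel i (fun u => h (f u)) w = h (ldel i f w).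
Proof.
elim: w f => [|j w IH] f /=; first by rewrite linear0.
by rewrite (IH (fun u => f (j :: u))) (linearD h) !(linearZ_LR h).
Qed.

Lemma rdel_scale (L : lmodType K) i (f : seq I -> K^o) (v : L) w :
  rdel i (fun u => f u *: v) w = rdel i f w *: v.
Proof.
elim: w f => [|j w IH] f /=; first by rewrite scale0r.
by rewrite (IH (fun u => f (j :: u))) scalerDl !scalerA.
Qed.

Lemma ldel_scale (L : lmodType K) i (f : seq I -> K^o) (v : L) w :
  ldel i (fun u => f u *: v) w = ldel i f w *: v.
Proof.
elim: w f => [|j w IH] f /=; first by rewrite scale0r.
by rewrite (IH (fun u => f (j :: u))) scalerDl !scalerA.
Qed.

Lemma sum_rdel (L : lmodType K) (J : finType) i (f : J -> seq I -> L) w :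
  rdel i (fun u => \sum_a f a u) w = \sum_a rdel i (f a) w.
Proof.
elim: w f => [|j w IH] f /=; first by rewrite big1.
by rewrite IH !scaler_sumr -big_split.
Qed.

Lemma sum_ldel (L : lmodType K) (J : finType) i (f : J -> seq I -> L) w :
  ldel i (fun u => \sum_a f a u) w = \sum_a ldel i (f a) w.
Proof.
elim: w f => [|j w IH] f /=; first by rewrite big1.
by rewrite IH !scaler_sumr -big_split.
Qed.

Lemma ldel_swap i j (h : seq I -> seq I -> K^o) w w' :
  ldel j (fun u => ldel i (fun v => h v u) w) w' =
  ldel i (fun v => ldel j (h v) w') w.
Proof.
elim: w h => [|k w IH] h /=; first by rewrite ldel0.
rewrite ldelD !ldelZ; congr (_ + _ *: _); exact: IH.
Qed.

(** The bilinear form on the free algebra for which the skew derivations are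
    adjoint to the multiplications by letters (Lusztig's form). Its radical
    contains the Serre relations. *)
Fixpoint word_form (w w' : seq I) : K^o :=
  if w is i :: u then ldel i (word_form u) w' else (w' == [::])%:R.

Lemma word_form_rcons w j w' : word_form (rcons w j) w' = rdel j (word_form w) w'.
Proof.
elim: w w' => [|i w IH] w' /=; last first.
  by rewrite -ldel_rdel; apply: eq_ldel => u _; apply: IH.
case: w' => [|k [|l w']] //=.
  by rewrite /char_word big_nil scale1r scaler0.
by rewrite ldel0 rdel0 !(scaler0, addr0).
Qed.

Lemma word_form_consr w i w' :
  word_form w (i :: w') = ldel i (fun u => word_form u w') w.
Proof.
elim: w w' => [|j w IH] w' //=.
rewrite [j == i]eq_sym c_sym; congr (_ + _ *: _).
rewrite -ldel_swap; apply: eq_ldel => u _; exact: IH.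
Qed.

Lemma word_form_sym w w' : word_form w w' = word_form w' w.
Proof.
elim: w' w => [|i w' IH] w; first by case: w.
by rewrite word_form_consr; apply: eq_ldel => u _; apply: IH.
Qed.

Lemma word_form_rconsr w i w' :
  word_form w (rcons w' i) = rdel i (fun u => word_form u w') w.
Proof.
by rewrite word_form_sym word_form_rcons; apply: eq_rdel => u _; apply: word_form_sym.
Qed.

(** Words with different content are orthogonal, so a multiplicative weight
    may be moved from one argument to the other. *)
Lemma word_form_char y w w' : (forall i, y i != 0) ->
  char_word y w * word_form w w' = char_word y w' * word_form w w'.
Proof.
move=> y0; elim: w w' => [|i w IH] w' /=.
  by case: eqP => [->|_]; rewrite ?mulr0.
rewrite char_word_cons; have := ldel_char i y (word_form w) w'.
rewrite /GRing.scale /= => <-; rewrite -mulrA; congr (_ * _).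
rewrite -[_ * _](ldelZ i (char_word y w) (word_form w) w').
by apply: (@eq_ldel K^o) => u _; apply: IH.
Qed.

End SkewDerivations.

(** * Canonical elements of degenerate pairings *)

Section CanonicalTensor.
Context (K : fieldType) (m : nat).

Section Transfer.
Context (N1 N0 : nat) (G1 t1 : 'M[K]_N1) (G0 t0 : 'M[K]_N0).
Context (rho : 'M[K]_(N1, N0)) (pi : 'M[K]_(N0, N1)).
Context (A0 : 'I_N0 -> 'M[K]_m) (B1 : 'I_N1 -> 'M[K]_m).
Hypotheses (G1t : G1^T *m t1 *m G1^T = G1^T) (G0t : G0^T *m t0 *m G0^T = G0^T).
Hypothesis adj : rho *m G0 = G1 *m pi^T.
Hypothesis null_A : forall c : 'rV[K]_N0, c *m G0 = 0 ->
  \sum_u c 0 u *: A0 u = 0.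
Hypothesis null_B : forall c : 'cV[K]_N1, G1 *m c = 0 ->
  \sum_u c u 0 *: B1 u = 0.

(** A canonical tensor transforms under adjoint maps [rho] and [pi] as if the
    pairings were perfect: pseudo-inverses [t1] and [t0] suffice, because the
    two sides differ by a tensor that the pairings annihilate on both sides,
    and the families [A0] and [B1] kill the radicals. *)
Lemma transfer Z :
  \sum_w \sum_w' t1 w w' *: ((\sum_u rho w u *: A0 u) *m Z *m B1 w') =
  \sum_u \sum_x t0 u x *: (A0 u *m Z *m \sum_v pi x v *: B1 v).
Proof.
(* The defect of the transfer identity, annihilated on both sides. *)
pose Dm := rho^T *m t1 - t0 *m pi.
have D0 : G0^T *m Dm *m G1^T = 0.
  rewrite mulmxBr mulmxBl !mulmxA -trmx_mul adj trmx_mul trmxK.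
  rewrite -!mulmxA [G1^T *m (t1 *m _)]mulmxA G1t -[pi *m G1^T]trmxK trmx_mul trmxK.
  by rewrite -adj trmx_mul !mulmxA G0t subrr.
apply/eqP; rewrite -subr_eq0; apply/eqP.
have -> : \sum_w \sum_w' t1 w w' *: ((\sum_u rho w u *: A0 u) *m Z *m B1 w') =
    \sum_w' (\sum_u (rho^T *m t1) u w' *: A0 u) *m Z *m B1 w'.
  rewrite exchange_big; apply: eq_bigr => w' _.
  rewrite !mulmx_suml; under eq_bigr do rewrite !mulmx_suml scaler_sumr.
  rewrite exchange_big; apply: eq_bigr => u _ /=.
  rewrite mxE scaler_suml !mulmx_suml; apply: eq_bigr => w _.
  by rewrite -!scalemxAl scalerA mulrC mxE.
have -> : \sum_u \sum_x t0 u x *: (A0 u *m Z *m \sum_v pi x v *: B1 v) =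
    \sum_w' (\sum_u (t0 *m pi) u w' *: A0 u) *m Z *m B1 w'.
  under [LHS]eq_bigr do under eq_bigr do rewrite mulmx_sumr scaler_sumr.
  under [LHS]eq_bigr do rewrite exchange_big.
  rewrite exchange_big; apply: eq_bigr => w' _ /=.
  rewrite !mulmx_suml; apply: eq_bigr => u _.
  rewrite mxE -!scalemxAl scaler_suml; apply: eq_bigr => x _.
  by rewrite -scalemxAr scalerA.
rewrite -sumrB.
pose Y w' := (\sum_u Dm u w' *: A0 u) *m Z.
rewrite (eq_bigr (fun w' => Y w' *m B1 w')); last first.
  move=> w' _; rewrite -mulmxBl -mulmxBl -sumrB; congr (_ *m _ *m _).
  by apply: eq_bigr => u _; rewrite -scalerBl /Dm !mxE.
have Y0 z : \sum_w' G1 z w' *: Y w' = 0.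
  rewrite /Y; under eq_bigr do rewrite mulmx_suml scaler_sumr.
  rewrite exchange_big /=.
  have := null_A (c := row z (Dm *m G1^T)^T).
  rewrite -row_mul -[(_)^T *m G0]trmxK trmx_mul trmxK !mulmxA D0 trmx0 row0.
  move=> /(_ erefl) /(congr1 (mulmx^~ Z)); rewrite mul0mx => e; rewrite -[RHS]e.
  rewrite mulmx_suml; apply: eq_bigr => u _; rewrite !mxE -scalemxAl scaler_suml.
  by apply: eq_bigr => w' _; rewrite -scalemxAl scalerA mulrC !mxE.
apply/matrixP => x y; rewrite summxE.
under eq_bigr do rewrite mxE.
rewrite exchange_big big1 ?mxE // => s _ /=.
have := null_B (c := \col_w' Y w' x s) => h.
have {h}/h : G1 *m \col_w' Y w' x s = 0.
  apply/colP => z; have /matrixP/(_ x s) := Y0 z.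
  rewrite summxE mxE => e; rewrite mxE [RHS]mxE -[RHS]e.
  by apply: eq_bigr => w' _; rewrite !mxE.
move=> /matrixP/(_ s y); rewrite summxE mxE => e; rewrite -[RHS]e.
by apply: eq_bigr => w' _; rewrite !mxE.
Qed.

End Transfer.

Section Words.
Context (I : finType) (c : I -> I -> K).
Hypothesis (c_sym : forall i j, c i j = c j i).

Definition nwords k := #|{: k.-tuple I}|.
Definition nth_word k (a : 'I_(nwords k)) : seq I := tval (enum_val a).

Lemma size_nth_word k (a : 'I_(nwords k)) : size (nth_word a) = k.
Proof. exact: size_tuple. Qed.

Lemma nth_word_inj k : injective (@nth_word k).
Proof. by move=> a a' /val_inj/enum_val_inj. Qed.

Lemma nth_word_ex k w : size w = k -> exists a : 'I_(nwords k), nth_word a = w.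
Proof.
move=> /eqP sw; exists (enum_rank (Tuple sw)).
by rewrite /nth_word enum_rankK.
Qed.

Lemma sum_nth_word (L : lmodType K) k w (f : seq I -> L) : size w = k ->
  \sum_(a < nwords k) (nth_word a == w)%:R *: f (nth_word a) = f w.
Proof.
move=> /nth_word_ex[a <-]; rewrite (bigD1 a) //= eqxx scale1r big1 ?addr0 // => a'.
by rewrite -(inj_eq (@nth_word_inj k)) => /negPf ->; rewrite scale0r.
Qed.

Definition gram k : 'M[K]_(nwords k) :=
  \matrix_(a, a') word_form c (nth_word a) (nth_word a').

Lemma gramT k : (gram k)^T = gram k.
Proof. by apply/matrixP => a a'; rewrite !mxE word_form_sym. Qed.

(** A pseudo-inverse, since the form on words is degenerate. *)
Definition dual_gram k : 'M[K]_(nwords k) := pinvmx (gram k).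

Lemma dual_gramP k : (gram k)^T *m dual_gram k *m (gram k)^T = (gram k)^T.
Proof. by rewrite gramT mulmxKpV. Qed.

(** The linear extension of [A] to the free algebra kills the radical of the
    form in degree [k]. *)
Definition null k (A : seq I -> 'M[K]_m) := forall x : 'rV[K]_(nwords k),
  x *m gram k = 0 -> \sum_a x 0 a *: A (nth_word a) = 0.

Lemma null_col k A : null k A -> forall x : 'cV[K]_(nwords k),
  gram k *m x = 0 -> \sum_a x a 0 *: A (nth_word a) = 0.
Proof.
move=> nA x; rewrite -[gram k *m x]trmxK trmx_mul gramT => /(congr1 trmx).
rewrite trmxK trmx0 => /nA e; rewrite -[RHS]e.
by apply: eq_bigr => a _; rewrite mxE.
Qed.

Lemma null_char k A y : (forall i, y i != 0) -> null k A ->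
  null k (fun w => char_word y w *: A w).
Proof.
move=> y0 nA x xG.
pose x' := \row_a (x 0 a * char_word y (nth_word a)).
have /nA e : x' *m gram k = 0.
  apply/rowP => b; have /rowP/(_ b) := xG; rewrite !mxE => e.
  apply: (etrans _ (mulr0 (char_word y (nth_word b)))).
  rewrite -[X in _ = _ * X]e mulr_sumr.
  apply: eq_bigr => a _; rewrite !mxE -mulrA.
  by rewrite word_form_char // mulrCA.
rewrite -[RHS]e; apply: eq_bigr => a _; by rewrite mxE scalerA.
Qed.

(** The canonical element of the form in degree [k], with its legs sent to
    operators by [A] and [B] and [Z] put between them. It does not depend on
    the choice of the pseudo-inverse when [A] and [B] kill the radical. *)
Definition tensor k (A : seq I -> 'M[K]_m) Z (B : seq I -> 'M[K]_m) : 'M[K]_m :=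
  \sum_a \sum_a' dual_gram k a a' *: (A (nth_word a) *m Z *m B (nth_word a')).

Definition rdel_mx k i : 'M[K]_(nwords k.+1, nwords k) :=
  \matrix_(a, u) rdel c i (fun v => (nth_word u == v)%:R : K^o) (nth_word a).
Definition ldel_mx k i : 'M[K]_(nwords k.+1, nwords k) :=
  \matrix_(a, u) ldel c i (fun v => (nth_word u == v)%:R : K^o) (nth_word a).
Definition rcons_mx k i : 'M[K]_(nwords k, nwords k.+1) :=
  \matrix_(x, v) (nth_word v == rcons (nth_word x) i)%:R.
Definition cons_mx k i : 'M[K]_(nwords k, nwords k.+1) :=
  \matrix_(x, v) (nth_word v == i :: nth_word x)%:R.

Lemma rdel_mxE (L : lmodType K) k i (f : seq I -> L) (a : 'I_(nwords k.+1)) :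
  rdel c i f (nth_word a) = \sum_u rdel_mx k i a u *: f (nth_word u).
Proof.
rewrite (eq_rdel c i (g := fun v => \sum_(u < nwords k)
    (nth_word u == v)%:R *: f (nth_word u))); last first.
  by move=> v; rewrite size_nth_word => -[e]; rewrite sum_nth_word.
rewrite sum_rdel; apply: eq_bigr => u _; rewrite mxE.
exact: rdel_scale.
Qed.

Lemma ldel_mxE (L : lmodType K) k i (f : seq I -> L) (a : 'I_(nwords k.+1)) :
  ldel c i f (nth_word a) = \sum_u ldel_mx k i a u *: f (nth_word u).
Proof.
rewrite (eq_ldel c i (g := fun v => \sum_(u < nwords k)
    (nth_word u == v)%:R *: f (nth_word u))); last first.
  by move=> v; rewrite size_nth_word => -[e]; rewrite sum_nth_word.
rewrite sum_ldel; apply: eq_bigr => u _; rewrite mxE.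
exact: ldel_scale.
Qed.

Lemma rcons_mxE (L : lmodType K) k i (f : seq I -> L) (x : 'I_(nwords k)) :
  \sum_v rcons_mx k i x v *: f (nth_word v) = f (rcons (nth_word x) i).
Proof.
rewrite -[RHS](@sum_nth_word _ k.+1); last by rewrite size_rcons size_nth_word.
by apply: eq_bigr => v _; rewrite mxE.
Qed.

Lemma cons_mxE (L : lmodType K) k i (f : seq I -> L) (x : 'I_(nwords k)) :
  \sum_v cons_mx k i x v *: f (nth_word v) = f (i :: nth_word x).
Proof.
rewrite -[RHS](@sum_nth_word _ k.+1); last by rewrite /= size_nth_word.
by apply: eq_bigr => v _; rewrite mxE.
Qed.

Lemma rdel_adj k i : rdel_mx k i *m gram k = gram k.+1 *m (rcons_mx k i)^T.
Proof.
apply/matrixP => a b; rewrite !mxE.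
transitivity (rdel c i (fun u => word_form c u (nth_word b)) (nth_word a)).
  by rewrite rdel_mxE; apply: eq_bigr => u _; rewrite [gram k _ _]mxE.
rewrite -word_form_rconsr // -(@rcons_mxE K^o).
by apply: eq_bigr => v _; rewrite [gram _ _ _]mxE [(_^T) _ _]mxE mulrC.
Qed.

Lemma ldel_adj k i : ldel_mx k i *m gram k = gram k.+1 *m (cons_mx k i)^T.
Proof.
apply/matrixP => a b; rewrite !mxE.
transitivity (ldel c i (fun u => word_form c u (nth_word b)) (nth_word a)).
  by rewrite ldel_mxE; apply: eq_bigr => u _; rewrite [gram k _ _]mxE.
rewrite -word_form_consr // -(@cons_mxE K^o).
by apply: eq_bigr => v _; rewrite [gram _ _ _]mxE [(_^T) _ _]mxE mulrC.
Qed.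

(** Deletion of a letter in one leg of the canonical element is adjoint to
    multiplication by that letter in the other leg. *)
Lemma tensor_rdel k i A Z B : null k A -> null k.+1 B ->
  tensor k.+1 (rdel c i A) Z B = tensor k A Z (fun w => B (rcons w i)).
Proof.
move=> nA nB; rewrite /tensor.
under [LHS]eq_bigr do under eq_bigr do rewrite rdel_mxE.
rewrite (transfer (dual_gramP _) (dual_gramP _) (rdel_adj k i)) //; last first.
  by apply: null_col.
by apply: eq_bigr => u _; apply: eq_bigr => x _; rewrite rcons_mxE.
Qed.

Lemma tensor_ldel k i A Z B : null k A -> null k.+1 B ->
  tensor k.+1 (ldel c i A) Z B = tensor k A Z (fun w => B (i :: w)).
Proof.
move=> nA nB; rewrite /tensor.
under [LHS]eq_bigr do under eq_bigr do rewrite ldel_mxE.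
rewrite (transfer (dual_gramP _) (dual_gramP _) (ldel_adj k i)) //; last first.
  by apply: null_col.
by apply: eq_bigr => u _; apply: eq_bigr => x _; rewrite cons_mxE.
Qed.

Lemma tensor_rdelr k i A Z B : null k.+1 A -> null k B ->
  tensor k.+1 A Z (rdel c i B) = tensor k (fun w => A (rcons w i)) Z B.
Proof.
move=> nA nB; rewrite /tensor.
under [LHS]eq_bigr do under eq_bigr do rewrite rdel_mxE.
rewrite -(transfer (dual_gramP k) (dual_gramP _) (rho := rcons_mx k i)) //; last 2 first.
- by rewrite -[LHS]trmxK trmx_mul gramT -rdel_adj trmx_mul gramT.
- by apply: null_col.
by apply: eq_bigr => u _; apply: eq_bigr => x _; rewrite rcons_mxE.
Qed.

Lemma tensor_ldelr k i A Z B : null k.+1 A -> null k B ->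
  tensor k.+1 A Z (ldel c i B) = tensor k (fun w => A (i :: w)) Z B.
Proof.
move=> nA nB; rewrite /tensor.
under [LHS]eq_bigr do under eq_bigr do rewrite ldel_mxE.
rewrite -(transfer (dual_gramP k) (dual_gramP _) (rho := cons_mx k i)) //; last 2 first.
- by rewrite -[LHS]trmxK trmx_mul gramT -ldel_adj trmx_mul gramT.
- by apply: null_col.
by apply: eq_bigr => u _; apply: eq_bigr => x _; rewrite cons_mxE.
Qed.

Lemma tensor_char k y A Z B : (forall i, y i != 0) -> null k A -> null k B ->
  tensor k (fun w => char_word y w *: A w) Z B =
  tensor k A Z (fun w => char_word y w *: B w).
Proof.
move=> y0 nA nB; rewrite /tensor.
pose d : 'M[K]_(nwords k) := diag_mx (\row_a char_word y (nth_word a)).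
have dE (f : seq I -> 'M[K]_m) (a : 'I_(nwords k)) :
    \sum_u d a u *: f (nth_word u) = char_word y (nth_word a) *: f (nth_word a).
  rewrite (bigD1 a) //= big1 => [|u /negPf ua]; first by rewrite !mxE eqxx addr0.
  by rewrite !mxE eq_sym ua scale0r.
have adj : d *m gram k = gram k *m d^T.
  rewrite tr_diag_mx mul_diag_mx mul_mx_diag; apply/matrixP => a b.
  by rewrite !mxE word_form_char // mulrC.
under [LHS]eq_bigr do under eq_bigr do rewrite -dE.
rewrite (transfer (dual_gramP _) (dual_gramP _) adj) //; last by apply: null_col.
by apply: eq_bigr => u _; apply: eq_bigr => x _; rewrite dE.
Qed.

End Words.
End CanonicalTensor.

(** * Words in the raising and lowering operators *)

Section Words.
Context (R : realType) (r : nat) (D : cartan_datum r) (q : R).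
Local Notation C := R[i].
Local Notation al := (@simple_root r).
Hypotheses (q0 : 0 < q) (simpleD : is_simple D).

Let cii : forall i, cmat D i i = 2 := simple_diag simpleD.

Definition word_weight (w : seq 'I_r) : 'rV[int]_r := \sum_(j <- w) al j.

Lemma word_weight_cons j w : word_weight (j :: w) = al j + word_weight w.
Proof. by rewrite /word_weight big_cons. Qed.

Lemma word_weight_ge0 w i : 0 <= word_weight w 0 i.
Proof.
rewrite /word_weight summxE; apply: sumr_ge0 => j _.
by rewrite mxE.
Qed.

Lemma sum_word_weight w : \sum_i word_weight w 0 i = (size w)%:Z.
Proof.
elim: w => [|j w IH]; first by rewrite big1 // => i _; rewrite /word_weight big_nil mxE.
rewrite word_weight_cons (eq_bigr (fun i => al j 0 i + word_weight w 0 i)).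
  rewrite big_split /= IH (bigD1 j) //= big1 => [|i /negPf ij].
    by rewrite mxE !eqxx addr0 -[RHS]/(Posz (1 + size w)) PoszD.
  by rewrite mxE ij andbF.
by move=> i _; rewrite mxE.
Qed.

(** By positive definiteness of the invariant form. *)
Lemma exists_root_to_weight_gt0 (g : 'rV[int]_r) : g != 0 ->
  (forall i, 0 <= g 0 i) -> exists i, 0 < root_to_weight D g 0 i.
Proof.
move=> g0 gp; have := simple_posdef simpleD g0.
have -> : \sum_i \sum_j (slen D i)%:Z * cmat D i j * g 0 i * g 0 j =
    \sum_i (slen D i)%:Z * g 0 i * root_to_weight D g 0 i.
  apply: eq_bigr => i _; rewrite mxE mulr_sumr; apply: eq_bigr => j _; ring.
move=> pos; apply/existsP; apply: contraLR pos => /existsPn n0.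
rewrite -leNgt; apply: sumr_le0 => i _; apply: mulr_ge0_le0.
  by apply: mulr_ge0.
by rewrite leNgt.
Qed.

Section Fixed.
Context (m : nat) (V : gen r -> 'M[C]_m) (l0 : 'rV[int]_r).
Context (b : 'I_m -> 'rV[int]_r) (rV : graded_rep D q V l0 b).

Definition F_word (w : seq 'I_r) : 'M[C]_m :=
  foldr (fun i X => V (GF i) *m X) 1%:M w.
Definition E_word (w : seq 'I_r) : 'M[C]_m :=
  foldr (fun i X => V (GE i) *m X) 1%:M w.

Lemma F_word_rcons w i : F_word (rcons w i) = F_word w *m V (GF i).
Proof. by elim: w => [|j w IH] /=; rewrite ?mulmx1 ?mul1mx // IH mulmxA. Qed.

Lemma E_word_rcons w i : E_word (rcons w i) = E_word w *m V (GE i).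
Proof. by elim: w => [|j w IH] /=; rewrite ?mulmx1 ?mul1mx // IH mulmxA. Qed.

Lemma homog_F_word w : homog b (- word_weight w) (F_word w).
Proof.
elim: w => [|j w IH]; first by rewrite /word_weight big_nil oppr0; apply: homog1.
by rewrite word_weight_cons opprD; apply: homogM IH; apply: gr_F rV j.
Qed.

Lemma homog_E_word w : homog b (word_weight w) (E_word w).
Proof.
elim: w => [|j w IH]; first by rewrite /word_weight big_nil; apply: homog1.
by rewrite word_weight_cons; apply: homogM IH; apply: gr_E rV j.
Qed.

Lemma E_word_long : exists B : nat, forall w, (B <= size w)%N -> E_word w = 0.
Proof.
pose B := (\sum_a \sum_c absz (\sum_i (b a - b c) ord0 i)%R)%N.
exists B.+1 => w Bw; apply/matrixP => a c; rewrite [RHS]mxE; apply/eqP.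
apply: contraTT Bw => /(homog_E_word) e; rewrite -ltnNge ltnS.
have : \sum_i (b a - b c) ord0 i = (size w)%:Z.
  by rewrite e addrAC subrr add0r sum_word_weight.
move=> e'; rewrite /B (bigD1 a) //= (bigD1 c) //= e' absz_nat -addnA.
exact: leq_addr.
Qed.

Definition component g (X : 'M[C]_m) : 'M[C]_m :=
  \matrix_(a, c) if b a == b c + g then X a c else 0.

Lemma homog_component g X : homog b g (component g X).
Proof.
by move=> a c; rewrite mxE; have [//|_] := eqVneq (b a) (b c + g); rewrite eqxx.
Qed.

Lemma component_mulr g h X Y : homog b h Y ->
  component g X *m Y = component (g + h) (X *m Y).
Proof.
move=> hY; apply/matrixP => a c; rewrite !mxE.
transitivity (\sum_j if b a == b c + (g + h) then X a j * Y j c else 0).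
  apply: eq_bigr => j _; rewrite mxE.
  have [->|/hY->] := eqVneq (Y j c) 0; first by rewrite !mulr0 if_same.
  by rewrite addrCA addrA [g + _]addrC addrAC; case: ifP; rewrite ?mul0r.
by case: ifP => // _; rewrite big1.
Qed.

Lemma component_mull g h X Y : homog b h Y ->
  Y *m component g X = component (g + h) (Y *m X).
Proof.
move=> hY; apply/matrixP => a c; rewrite !mxE.
transitivity (\sum_j if b a == b c + (g + h) then Y a j * X j c else 0).
  apply: eq_bigr => j _; rewrite mxE.
  have [->|/hY->] := eqVneq (Y a j) 0; first by rewrite !mul0r if_same.
  by rewrite addrA (inj_eq (addIr _)); case: ifP; rewrite ?mulr0.
by case: ifP => // _; rewrite big1.
Qed.

(** Taking components of a single weight reduces this to [comm_E_eq0]: the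
    components commute with the [E_i] as well, since these are homogeneous. *)
Lemma comm_all_E_eq0 X : (forall i, V (GE i) *m X = X *m V (GE i)) ->
  (forall a c, X a c != 0 -> exists i, root_to_weight D (b a - b c) 0 i < 0) ->
  X = 0.
Proof.
move=> EX neg; apply/matrixP => a c; rewrite [RHS]mxE; apply/eqP.
apply/negPn/negP => X0; have [i hi] := neg a c X0.
have : component (b a - b c) X = 0.
  apply: (comm_E_eq0 q0 rV cii (i := i) (g := b a - b c)) => //.
    exact: homog_component.
  rewrite (component_mull _ _ (gr_E rV i)) (component_mulr _ _ (gr_E rV i)).
  by rewrite EX.
move=> /matrixP/(_ a c); rewrite !mxE addrC subrK eqxx => /eqP.
by rewrite (negPf X0).
Qed.

End Fixed.
End Words.

(** * Commutation relations for words *)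

Section CasimirWeights.
Context (r : nat) (D : cartan_datum r) (l0 : 'rV[int]_r).
Local Notation al := (@simple_root r).
Hypotheses (simpleD : is_simple D).

(** [(lambda, lambda + 2 rho) - (l0, l0 + 2 rho)] for [lambda = l0 + b]. *)
Definition casimir_weight (b : 'rV[int]_r) : int :=
  \sum_i (slen D i)%:Z * b 0 i * (root_to_weight D b 0 i + 2 * l0 0 i + 2).

Lemma slen_root_to_weight i (b : 'rV[int]_r) :
  \sum_j (slen D j)%:Z * b 0 j * cmat D j i = (slen D i)%:Z * root_to_weight D b 0 i.
Proof.
rewrite mxE mulr_sumr; apply: eq_bigr => j _.
by rewrite mulrAC (simple_sym simpleD j i) mulrA.
Qed.

Lemma casimir_weightD b i : casimir_weight (b + al i) =
  casimir_weight b + 2 * (slen D i)%:Z * (coroot D l0 b i + 2).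
Proof.
rewrite /casimir_weight /coroot.
transitivity (\sum_j ((slen D j)%:Z * b 0 j * (root_to_weight D b 0 j + 2 * l0 0 j + 2)
  + (slen D j)%:Z * b 0 j * cmat D j i
  + (i == j)%:R * ((slen D i)%:Z * (root_to_weight D b 0 i + cmat D i i + 2 * l0 0 i + 2)))).
  apply: eq_bigr => j _.
  have -> : (b + al i) 0 j = b 0 j + (i == j)%:R by rewrite !mxE eq_sym.
  rewrite root_to_weightD mxE root_to_weight_simple.
  by have [->|_] := eqVneq i j; rewrite /=; ring.
have sumE (c : int) : \sum_j (i == j)%:R * c = c.
  rewrite (bigD1 i) //= eqxx mul1r big1 ?addr0 // => j /negPf ij.
  by rewrite eq_sym ij mul0r.
rewrite !big_split /= slen_root_to_weight sumE (simple_diag simpleD).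
by rewrite [(l0 + _) 0 i]mxE; ring.
Qed.

(** The difference is [(g, lambda + lambda' + 2 rho)] for the dominant weights
    [lambda = l0 + b] and [lambda' = l0 + b + g]. *)
Lemma casimir_weightB (b g : 'rV[int]_r) : (forall i, 0 <= g 0 i) -> g != 0 ->
  (forall i, 0 <= coroot D l0 b i) -> (forall i, 0 <= coroot D l0 (b + g) i) ->
  casimir_weight b < casimir_weight (b + g).
Proof.
move=> gp g0 db dbg; rewrite -subr_gt0.
have -> : casimir_weight (b + g) - casimir_weight b = \sum_i (slen D i)%:Z * g 0 i *
    (coroot D l0 b i + coroot D l0 (b + g) i + 2).
  transitivity (\sum_i ((slen D i)%:Z * g 0 i *
    (coroot D l0 b i + coroot D l0 (b + g) i + 2)
    + (slen D i)%:Z * b 0 i * root_to_weight D g 0 i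
    - (slen D i)%:Z * g 0 i * root_to_weight D b 0 i)).
    rewrite -sumrB; apply: eq_bigr => i _.
    rewrite /coroot !root_to_weightD !mxE; ring.
  rewrite !big_split /= -addrA; apply/eqP.
  rewrite -subr_eq0 addrAC subrr add0r sumrN subr_eq0; apply/eqP.
  have swap (u v : 'rV[int]_r) : \sum_i (slen D i)%:Z * u 0 i * root_to_weight D v 0 i =
    \sum_i \sum_j (slen D i)%:Z * cmat D i j * u 0 i * v 0 j.
    by apply: eq_bigr => i _; rewrite mxE mulr_sumr; apply: eq_bigr => j _; ring.
  rewrite !swap exchange_big; apply: eq_bigr => i _; apply: eq_bigr => j _.
  by rewrite (simple_sym simpleD); ring.
have [i gi] : exists i, 0 < g 0 i.
  apply/existsP; apply: contraNT g0 => /existsPn n0; apply/eqP/rowP => i.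
  by rewrite mxE; apply/eqP; rewrite eq_le gp andbT leNgt.
have s0 j := simple_slen_gt0 simpleD j.
rewrite (bigD1 i) //= ltr_pwDl //.
  by have := db i; have := dbg i; have := s0 i; move: (coroot _ _ _ _) => x; nia.
apply: sumr_ge0 => j _; have := db j; have := dbg j; have := s0 j; have := gp j.
by move: (coroot _ _ _ _) => x; nia.
Qed.

End CasimirWeights.

Section QuantumCasimir.
Context (R : realType) (r : nat) (D : cartan_datum r) (q : R).
Local Notation C := R[i].
Local Notation al := (@simple_root r).
Local Notation t := (qi D q).
Hypotheses (q0 : 0 < q) (simpleD : is_simple D).

Let cii : forall i, cmat D i i = 2 := simple_diag simpleD.

(** The scalars [q ^ (- (alpha_i, alpha_j))]. *)
Definition braid (i j : 'I_r) : C := t i ^ (- cmat D i j).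

Lemma qC_neq0 : qC q != 0 :> C.
Proof. by rewrite fmorph_eq0 gt_eqF. Qed.

Lemma qi_expz i p : t i ^ p = qC q ^ ((slen D i)%:Z * p).
Proof. by rewrite /qi exprnP exprz_exp. Qed.

Lemma braidE i j : braid i j = t i ^ (- cmat D i j).
Proof. by []. Qed.

Lemma braid_sym i j : braid i j = braid j i.
Proof.
by rewrite /braid !qi_expz !mulrN (simple_sym simpleD).
Qed.

Lemma braid_neq0 i j : braid i j != 0.
Proof. by rewrite expfz_neq0 // qi_neq0. Qed.

Definition kap i : C := (t i - (t i)^-1)^-1.

Lemma char_word_neq0 (y : 'I_r -> C) w : (forall i, y i != 0) -> char_word y w != 0.
Proof.
by move=> y0; rewrite /char_word; apply: (big_ind (fun z => z != 0));
  rewrite ?oner_eq0 // => a c; apply: mulf_neq0.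
Qed.

Lemma char_word_inv (y : 'I_r -> C) w :
  char_word (fun i => (y i)^-1) w = (char_word y w)^-1.
Proof. by rewrite /char_word prodfV. Qed.

Lemma char_wordM (y y' : 'I_r -> C) w :
  char_word (fun i => y i * y' i) w = char_word y w * char_word y' w.
Proof. by rewrite /char_word big_split. Qed.

Section Fixed.
Context (m : nat) (V : gen r -> 'M[C]_m) (l0 : 'rV[int]_r).
Context (b : 'I_m -> 'rV[int]_r) (rV : graded_rep D q V l0 b).
Local Notation F_word := (F_word V).
Local Notation E_word := (E_word V).
Local Notation phi i := (char_word (braid i)).

Lemma KF i j : V (GK i) *m V (GF j) = braid i j *: (V (GF j) *m V (GK i)).
Proof.
rewrite (gr_K rV) (weight_opM _ (gr_F rV j)) /weight_op !mul_mx_diag.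
apply/matrixP => a c; rewrite !mxE mulrCA; congr (_ * _).
by rewrite corootD root_to_weightN mxE root_to_weight_simple addrC expfzDr ?qi_neq0.
Qed.

Lemma KinvF i j : V (GKinv i) *m V (GF j) = (braid i j)^-1 *: (V (GF j) *m V (GKinv i)).
Proof.
rewrite (gr_Kinv rV) (weight_opM _ (gr_F rV j)) /weight_op !mul_mx_diag.
apply/matrixP => a c; rewrite !mxE mulrCA; congr (_ * _).
rewrite corootD root_to_weightN mxE root_to_weight_simple /braid invr_expz.
by rewrite -expfzDr ?qi_neq0 //; congr (_ ^ _); lia.
Qed.

Lemma KE i j : V (GK i) *m V (GE j) = (braid i j)^-1 *: (V (GE j) *m V (GK i)).
Proof.
rewrite (gr_K rV) (weight_opM _ (gr_E rV j)) /weight_op !mul_mx_diag.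
apply/matrixP => a c; rewrite !mxE mulrCA; congr (_ * _).
rewrite corootD root_to_weight_simple /braid invr_expz.
by rewrite -expfzDr ?qi_neq0 //; congr (_ ^ _); lia.
Qed.

Lemma KinvE i j : V (GKinv i) *m V (GE j) = braid i j *: (V (GE j) *m V (GKinv i)).
Proof.
rewrite (gr_Kinv rV) (weight_opM _ (gr_E rV j)) /weight_op !mul_mx_diag.
apply/matrixP => a c; rewrite !mxE mulrCA; congr (_ * _).
rewrite corootD root_to_weight_simple /braid.
by rewrite -expfzDr ?qi_neq0 //; congr (_ ^ _); lia.
Qed.

Lemma KF_word i w : V (GK i) *m F_word w = phi i w *: (F_word w *m V (GK i)).
Proof.
elim: w => [|j w IH] /=; first by rewrite /char_word big_nil scale1r mulmx1 mul1mx.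
by rewrite mulmxA KF -scalemxAl -mulmxA IH -scalemxAr scalerA char_word_cons mulmxA.
Qed.

Lemma KinvF_word i w :
  V (GKinv i) *m F_word w = (phi i w)^-1 *: (F_word w *m V (GKinv i)).
Proof.
elim: w => [|j w IH] /=; first by rewrite /char_word big_nil invr1 scale1r mulmx1 mul1mx.
rewrite mulmxA KinvF -scalemxAl -mulmxA IH -scalemxAr scalerA char_word_cons mulmxA.
by rewrite invfM.
Qed.

Lemma KE_word i w : V (GK i) *m E_word w = (phi i w)^-1 *: (E_word w *m V (GK i)).
Proof.
elim: w => [|j w IH] /=; first by rewrite /char_word big_nil invr1 scale1r mulmx1 mul1mx.
rewrite mulmxA KE -scalemxAl -mulmxA IH -scalemxAr scalerA char_word_cons mulmxA.
by rewrite invfM.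
Qed.

Lemma KinvE_word i w :
  V (GKinv i) *m E_word w = phi i w *: (E_word w *m V (GKinv i)).
Proof.
elim: w => [|j w IH] /=; first by rewrite /char_word big_nil scale1r mulmx1 mul1mx.
by rewrite mulmxA KinvE -scalemxAl -mulmxA IH -scalemxAr scalerA char_word_cons mulmxA.
Qed.

Hypothesis (q1 : q != 1).

Lemma qi_neq1 i : t i != 1.
Proof.
rewrite qiE -[X in _ != X](rmorph1 (real_complex R)) (inj_eq (fmorph_inj _)).
by rewrite pexpr_eq1 ?(ltW q0) // simple_slen_gt0.
Qed.

Lemma kap_neq0 i : kap i != 0.
Proof. by rewrite invr_eq0 qi_sub_inv // qi_neq1. Qed.

Lemma H_KKinv i : V (GH i) = kap i *: (V (GK i) - V (GKinv i)).
Proof.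
rewrite (gr_H rV) (gr_K rV) (gr_Kinv rV) /weight_op -linearB -linearZ.
congr diag_mx; apply/rowP => j.
by rewrite !mxE /qint (negPf (qi_neq1 i)) mulrC.
Qed.

(** Moving [E_i] through a word deletes a letter [i] and leaves [K_i] or its
    inverse behind; collecting these on the right, respectively on the left,
    produces the braiding scalars of the two skew derivations. *)
Lemma comm_E_F_word i w : V (GE i) *m F_word w - F_word w *m V (GE i) =
  kap i *: (rdel braid i F_word w *m V (GK i) - V (GKinv i) *m ldel braid i F_word w).
Proof.
elim: w => [|j w IH]; first by rewrite /= mulmx1 mul1mx mul0mx mulmx0 !subrr scaler0.
have rE : rdel braid i F_word (j :: w) = (i == j)%:R *: (phi i w *: F_word w)
    + V (GF j) *m rdel braid i F_word w.
  by rewrite /= -[in RHS](linear_rdel _ (mulmx (V (GF j)))).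
have lE : ldel braid i F_word (j :: w) = (i == j)%:R *: F_word w
    + braid i j *: (V (GF j) *m ldel braid i F_word w).
  by rewrite /= -[in RHS](linear_ldel _ (mulmx (V (GF j)))).
rewrite rE lE /=.
have -> : V (GE i) *m (V (GF j) *m F_word w) = V (GF j) *m (V (GE i) *m F_word w) +
    (i == j)%:R *: (V (GH i) *m F_word w).
  have -> : (i == j)%:R *: (V (GH i) *m F_word w) = (if i == j then V (GH i) else 0) *m F_word w.
    by case: eqP; rewrite ?scale1r // scale0r mul0mx.
  by rewrite -(gr_EF rV) mulmxBl !mulmxA addrC subrK.
rewrite -mulmxA addrAC -mulmxBr IH H_KKinv.
rewrite !(mulmxDl, mulmxDr) -!scalemxAl -!scalemxAr.
rewrite !mulmxBl KF_word.
rewrite !mulmxBr -!mulmxA ![V (GKinv i) *m (V (GF j) *m _)]mulmxA KinvF.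
rewrite -!scalemxAl !scalerA divff ?braid_neq0 // scale1r !mulmxA.
by apply/matrixP => x y; rewrite !mxE; ring.
Qed.

End Fixed.

Hypothesis (q1 : q != 1).

Section Fixed2.
Context (m : nat) (V : gen r -> 'M[C]_m) (l0 : 'rV[int]_r).
Context (b : 'I_m -> 'rV[int]_r) (rV : graded_rep D q V l0 b).

Lemma comm_E_word_F i w : E_word V w *m V (GF i) - V (GF i) *m E_word V w =
  kap i *: (V (GK i) *m ldel braid i (E_word V) w - rdel braid i (E_word V) w *m V (GKinv i)).
Proof.
have := comm_E_F_word (graded_twist rV) q1 i w => /(congr1 -%R).
by rewrite opprB -scalerN opprB.
Qed.

(** An element of the radical is sent to an operator that commutes with all the
    [E_i], because its deletions lie in the radical of smaller degree, and that
    lowers weights; such an operator is zero. *)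
Lemma null_F_word k : null braid k (F_word V).
Proof.
elim: k => [|k IH] x xG.
  apply: big1 => a _.
  have /rowP/(_ a) := xG; rewrite !mxE (bigD1 a) //= big1 => [|a' a'a].
    rewrite mxE; have := size_nth_word a => /size0nil ->.
    by rewrite addr0 /= mulr1 => ->; rewrite scale0r.
  case/eqP: a'a; apply: (@nth_word_inj _ 0).
  by have := size_nth_word a => /size0nil ->; have := size_nth_word a' => /size0nil.
set X := \sum_a _.
have rX i : \sum_a x 0 a *: rdel braid i (F_word V) (nth_word a) = 0.
  under eq_bigr do rewrite rdel_mxE scaler_sumr.
  rewrite exchange_big /=.
  have := IH (x *m rdel_mx braid k i).
  rewrite -mulmxA rdel_adj; last exact: braid_sym.
  rewrite mulmxA xG mul0mx => /(_ erefl) e; rewrite -[RHS]e.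
  apply: eq_bigr => u _; rewrite mxE scaler_suml; apply: eq_bigr => a _.
  by rewrite scalerA.
have lX i : \sum_a x 0 a *: ldel braid i (F_word V) (nth_word a) = 0.
  under eq_bigr do rewrite ldel_mxE scaler_sumr.
  rewrite exchange_big /=.
  have := IH (x *m ldel_mx braid k i).
  rewrite -mulmxA ldel_adj; last exact: braid_sym.
  rewrite mulmxA xG mul0mx => /(_ erefl) e; rewrite -[RHS]e.
  apply: eq_bigr => u _; rewrite mxE scaler_suml; apply: eq_bigr => a _.
  by rewrite scalerA.
apply: (comm_all_E_eq0 q0 simpleD rV) => [i|a c].
  apply/eqP; rewrite -subr_eq0; apply/eqP.
  rewrite /X mulmx_sumr mulmx_suml -sumrB.
  transitivity (kap i *: ((\sum_a x 0 a *: rdel braid i (F_word V) (nth_word a)) *m V (GK i)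
    - V (GKinv i) *m (\sum_a x 0 a *: ldel braid i (F_word V) (nth_word a)))).
    rewrite mulmx_suml mulmx_sumr -sumrB scaler_sumr; apply: eq_bigr => a _.
    rewrite -!scalemxAl -!scalemxAr -!scalerBr (comm_E_F_word rV q1) scalerA mulrC.
    by rewrite -scalerA.
  by rewrite rX lX mul0mx mulmx0 subrr scaler0.
move=> Xac; have [w sw wac] : exists2 w, size w = k.+1 & F_word V w a c != 0.
  have : exists u : 'I_(nwords 'I_r k.+1), F_word V (nth_word u) a c != 0.
    apply/existsP; apply: contraNT Xac => /existsPn z; rewrite summxE big1 // => u _.
    by rewrite mxE; have /negPn/eqP-> := z u; rewrite mulr0.
  by move=> [u hu]; exists (nth_word u) => //; apply: size_nth_word.
have e : b a - b c = - word_weight w.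
  by rewrite (homog_F_word rV wac) addrAC subrr add0r.
have w0 : word_weight w != 0.
  apply: contra_eqN (sum_word_weight w) => /eqP->; rewrite sw.
  by rewrite big1 // => i _; rewrite mxE.
have [i hi] := exists_root_to_weight_gt0 simpleD w0 (word_weight_ge0 w).
by exists i; rewrite e root_to_weightN mxE oppr_lt0.
Qed.

End Fixed2.
End QuantumCasimir.

(** * The terms of the quantum Casimir operator *)

Section TensorLinearity.
Context (K : fieldType) (m : nat) (I : finType) (c : I -> I -> K) (k : nat).
Implicit Types (A B : seq I -> 'M[K]_m) (X Z : 'M[K]_m).
Local Notation tens := (@tensor K m I c k).

Lemma eq_tensor A A' B B' Z : (forall w, size w = k -> A w = A' w) ->
  (forall w, size w = k -> B w = B' w) -> tens A Z B = tens A' Z B'.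
Proof.
move=> AA' BB'; apply: eq_bigr => a _; apply: eq_bigr => a' _.
by rewrite AA' ?BB' ?size_nth_word.
Qed.

Lemma tensorMl X A Z B : X *m tens A Z B = tens (fun w => X *m A w) Z B.
Proof.
rewrite mulmx_sumr; apply: eq_bigr => a _; rewrite mulmx_sumr; apply: eq_bigr => a' _.
by rewrite -scalemxAr !mulmxA.
Qed.

Lemma tensorMr X A Z B : tens A Z B *m X = tens A Z (fun w => B w *m X).
Proof.
rewrite mulmx_suml; apply: eq_bigr => a _; rewrite mulmx_suml; apply: eq_bigr => a' _.
by rewrite -scalemxAl !mulmxA.
Qed.

Lemma tensorMml X A Z B : tens (fun w => A w *m X) Z B = tens A (X *m Z) B.
Proof.
by apply: eq_bigr => a _; apply: eq_bigr => a' _; rewrite !mulmxA.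
Qed.

Lemma tensorMmr X A Z B : tens A Z (fun w => X *m B w) = tens A (Z *m X) B.
Proof.
by apply: eq_bigr => a _; apply: eq_bigr => a' _; rewrite !mulmxA.
Qed.

Lemma tensorZl z A Z B : tens (fun w => z *: A w) Z B = z *: tens A Z B.
Proof.
rewrite scaler_sumr; apply: eq_bigr => a _; rewrite scaler_sumr; apply: eq_bigr => a' _.
by rewrite -!scalemxAl !scalerA mulrC.
Qed.

Lemma tensorZr z A Z B : tens A Z (fun w => z *: B w) = z *: tens A Z B.
Proof.
rewrite scaler_sumr; apply: eq_bigr => a _; rewrite scaler_sumr; apply: eq_bigr => a' _.
by rewrite -!scalemxAr !scalerA mulrC.
Qed.

Lemma tensorZm z A Z B : tens A (z *: Z) B = z *: tens A Z B.
Proof.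
rewrite scaler_sumr; apply: eq_bigr => a _; rewrite scaler_sumr; apply: eq_bigr => a' _.
by rewrite -scalemxAr -!scalemxAl !scalerA mulrC.
Qed.

Lemma tensorBl A A' Z B : tens (fun w => A w - A' w) Z B = tens A Z B - tens A' Z B.
Proof.
rewrite -sumrB; apply: eq_bigr => a _; rewrite -sumrB; apply: eq_bigr => a' _.
by rewrite !mulmxBl scalerBr.
Qed.

Lemma tensorDl A A' Z B : tens (fun w => A w + A' w) Z B = tens A Z B + tens A' Z B.
Proof.
rewrite -big_split; apply: eq_bigr => a _; rewrite -big_split; apply: eq_bigr => a' _.
by rewrite !mulmxDl scalerDr.
Qed.

Lemma tensorBr A Z B B' : tens A Z (fun w => B w - B' w) = tens A Z B - tens A Z B'.
Proof.
rewrite -sumrB; apply: eq_bigr => a _; rewrite -sumrB; apply: eq_bigr => a' _.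
by rewrite !mulmxBr scalerBr.
Qed.

Lemma tensorDr A Z B B' : tens A Z (fun w => B w + B' w) = tens A Z B + tens A Z B'.
Proof.
rewrite -big_split; apply: eq_bigr => a _; rewrite -big_split; apply: eq_bigr => a' _.
by rewrite !mulmxDr scalerDr.
Qed.

Lemma tensor0r A Z B : (forall w, size w = k -> B w = 0) -> tens A Z B = 0.
Proof.
move=> B0; rewrite /tensor big1 // => a _; rewrite big1 // => a' _.
by rewrite B0 ?size_nth_word // mulmx0 scaler0.
Qed.

End TensorLinearity.

Lemma tensor_empty (K : fieldType) m (I : finType) (c : I -> I -> K)
    (A B : seq I -> 'M[K]_m) Z : (forall i j, c i j = c j i) ->
  tensor c 0 A Z B = A [::] *m Z *m B [::].
Proof.
move=> c_sym; have [a0 a0E] := @nth_word_ex I 0 [::] erefl.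
have all0 (a : 'I_(nwords I 0)) : a = a0.
  apply: (@nth_word_inj _ 0); rewrite a0E.
  by have := size_nth_word a => /size0nil.
have sumE (L : nmodType) (f : 'I_(nwords I 0) -> L) : \sum_a f a = f a0.
  by rewrite (bigD1 a0) //= big1 ?addr0 // => a; rewrite (all0 a) eqxx.
rewrite /tensor sumE sumE a0E.
have := dual_gramP c_sym 0 => /matrixP/(_ a0 a0).
rewrite gramT // => e.
have g1 : gram c 0 a0 a0 = 1 by rewrite mxE a0E.
move: e g1; move: (dual_gram c 0) (gram c 0) => d G e g1.
by move: e; rewrite !(mxE, sumE) g1 mul1r mulr1 => ->; rewrite scale1r.
Qed.

Section QuantumCasimir.
Context (R : realType) (r : nat) (D : cartan_datum r) (q : R).
Local Notation C := R[i].
Local Notation al := (@simple_root r).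
Local Notation t := (qi D q).
Hypotheses (q0 : 0 < q) (q1 : q != 1) (simpleD : is_simple D).
Context (m : nat) (V : gen r -> 'M[C]_m) (l0 : 'rV[int]_r).
Context (b : 'I_m -> 'rV[int]_r) (rV : graded_rep D q V l0 b).

Let cii : forall i, cmat D i i = 2 := simple_diag simpleD.

Local Notation kap := (kap D q).
Local Notation braid := (braid D q).
Local Notation braid_sym := (braid_sym q simpleD).
Local Notation F_word := (F_word V).
Local Notation E_word := (E_word V).
Local Notation phi i := (char_word (braid i)).
Local Notation tens := (tensor braid).

(** Factors for the letters of the lowering leg, chosen so that the commutators
    of [E_i] and [F_i] with successive terms of the Casimir operator cancel. *)
Definition casimir_char (g : 'rV[int]_r) i : C :=
  (kap i)^-1 * t i ^ (coroot D l0 g i + 2).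

Lemma casimir_char_neq0 g i : casimir_char g i != 0.
Proof.
apply: mulf_neq0; first by rewrite invr_eq0; apply: kap_neq0.
by rewrite expfz_neq0 // qi_neq0.
Qed.

Lemma casimir_charD g i w : char_word (casimir_char (g + al i)) w =
  (phi i w)^-1 * char_word (casimir_char g) w.
Proof.
rewrite -char_word_inv -char_wordM /char_word; apply: eq_bigr => j _.
rewrite /casimir_char corootD root_to_weight_simple braid_sym braidE.
rewrite invr_expz opprK mulrCA -expfzDr ?qi_neq0 //.
by congr (_ * _ ^ _); lia.
Qed.

Lemma null_E_word k : null braid k E_word.
Proof. exact: (null_F_word q0 simpleD q1 (graded_twist rV)). Qed.

Lemma null_F_word' k : null braid k F_word.
Proof. exact: (null_F_word q0 simpleD q1 rV). Qed.

Definition dressed_F g w := char_word (casimir_char g) w *: F_word w.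

Lemma null_dressed g k : null braid k (dressed_F g).
Proof.
change (null braid k (fun w => char_word (casimir_char g) w *: F_word w)).
apply: null_char; first exact: casimir_char_neq0.
exact: null_F_word'.
Qed.

(** Applied to the vectors of weight [g], the contribution of the words of
    length [k] to the Casimir operator. *)
Definition casimir_term g k := tens k (dressed_F g) 1%:M E_word.

Lemma phi_neq0 i w : phi i w != 0.
Proof. by apply: char_word_neq0 => j; apply: braid_neq0. Qed.

Lemma null_phiV i k (B : seq 'I_r -> 'M[C]_m) : null braid k B -> null braid k (fun w => (phi i w)^-1 *: B w).
Proof.
move=> nB x xG.
have := null_char (y := fun j => (braid i j)^-1) _ nB.
move=> h; rewrite -[RHS](h _ x xG) => [|j]; last by rewrite invr_eq0 braid_neq0.
by apply: eq_bigr => a _; rewrite char_word_inv.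
Qed.

Lemma tensor_phi i k (A B : seq 'I_r -> 'M[C]_m) Z : null braid k A -> null braid k B ->
  tens k (fun w => phi i w *: A w) Z B = tens k A Z (fun w => phi i w *: B w).
Proof. by apply: (tensor_char braid_sym) => j; apply: braid_neq0. Qed.

Lemma tensor_phiV i k (A B : seq 'I_r -> 'M[C]_m) Z : null braid k A -> null braid k B ->
  tens k (fun w => (phi i w)^-1 *: A w) Z B = tens k A Z (fun w => (phi i w)^-1 *: B w).
Proof.
move=> nA nB.
have -> : tens k A Z (fun w => (phi i w)^-1 *: B w) =
    tens k (fun w => phi i w *: ((phi i w)^-1 *: A w)) Z (fun w => (phi i w)^-1 *: B w).
  by apply: eq_tensor => // w _; rewrite scalerA divff ?phi_neq0 // scale1r.
rewrite tensor_phi; [|exact: null_phiV..].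
by apply: eq_tensor => // w _; rewrite scalerA divff ?phi_neq0 // scale1r.
Qed.

Lemma E_dressed g i w : V (GE i) *m dressed_F g w = dressed_F g w *m V (GE i) +
  (kap i * casimir_char g i) *: (rdel braid i (dressed_F g) w *m V (GK i)
     - V (GKinv i) *m ldel braid i (dressed_F g) w).
Proof.
have := comm_E_F_word q0 simpleD rV q1 i w => /eqP.
rewrite subr_eq => /eqP EF.
set y := casimir_char g.
have rE : y i *: rdel braid i (dressed_F g) w = char_word y w *: rdel braid i F_word w.
  exact: rdel_char.
have lE : y i *: ldel braid i (dressed_F g) w = char_word y w *: ldel braid i F_word w.
  exact: ldel_char.
rewrite {1 2}/dressed_F -scalemxAr EF scalerDr -scalemxAl addrC; congr (_ + _).
rewrite -[RHS]scalerA [in RHS]scalerBr [y i *: (_ *m V (GK i))]scalemxAl rE.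
rewrite [y i *: (V (GKinv i) *m _)]scalemxAr lE.
by rewrite -scalemxAl -scalemxAr -scalerBr !scalerA mulrC.
Qed.

(** The contributions that cancel between successive [k] in [E_casimir_term]. *)
Definition P_term g i k := tens k (dressed_F g) (V (GE i)) E_word.

Lemma casimir_term_shift g i k :
  tens k (dressed_F g) 1%:M (fun w => (phi i w)^-1 *: E_word w) =
  casimir_term (g + al i) k.
Proof.
rewrite -(tensor_phiV i _ (@null_dressed g k) (@null_E_word k)).
apply: eq_tensor => w _; last by [].
by rewrite /dressed_F casimir_charD scalerA.
Qed.

Lemma kap_casimir_char g i : kap i * casimir_char g i = t i ^ (coroot D l0 g i + 2).
Proof.
rewrite /casimir_char mulrA divff ?mul1r //; exact: kap_neq0.
Qed.

(** Moving [E_i] through the lowering leg produces [P_term] of degree [k + 1] and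
    deletions of a letter. By adjointness a deletion becomes a multiplication
    by [E_i] in the raising leg: on the left for left deletions, which gives
    [P_term] of degree [k], on the right for right deletions, which gives the
    last summand. *)
Lemma E_casimir_term g i k (u : 'cV[C]_m) : weight_vec b g u ->
  V (GE i) *m casimir_term g k.+1 *m u =
  P_term g i k.+1 *m u - P_term g i k *m u
    + t i ^ (2 * coroot D l0 g i + 4) *:
      (casimir_term (g + al i) k *m (V (GE i) *m u)).
Proof.
move=> hu; have t0 := qi_neq0 D q0 i.
have hK : V (GK i) *m (V (GE i) *m u) = t i ^ (coroot D l0 g i + 2) *: (V (GE i) *m u).
  rewrite (gr_K rV) (weight_op_vec (g := g + al i)).
    by rewrite corootD root_to_weight_simple cii.
  by apply: homog_vec hu; apply: gr_E rV i.
have hKinv : V (GKinv i) *m u = t i ^ (- coroot D l0 g i) *: u.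
  by rewrite (gr_Kinv rV) (weight_op_vec _ hu).
have nA k' := @null_dressed g k'.
have nE k' := @null_E_word k'.
have e2 := casimir_term_shift g i k.
have T2 : tens k.+1 (fun w => rdel braid i (dressed_F g) w *m V (GK i)) 1%:M E_word *m u =
    t i ^ (coroot D l0 g i + 2) *: (casimir_term (g + al i) k *m (V (GE i) *m u)).
  rewrite tensorMml (tensor_rdel braid_sym i _ (nA k) (nE k.+1)).
  have -> : tens k (dressed_F g) (V (GK i) *m 1%:M) (fun w => E_word (rcons w i)) =
      casimir_term (g + al i) k *m V (GK i) *m V (GE i).
    rewrite -e2 !tensorMr mulmx1 -[V (GK i) in LHS]mul1mx -tensorMmr.
    apply: eq_tensor => w _; first by [].
    by rewrite E_word_rcons mulmxA (KE_word q0 rV) -!scalemxAl.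
  move: (casimir_term _ _) => X; rewrite -mulmxA -mulmxA hK.
  by rewrite -scalemxAr.
have e3 : V (GKinv i) *m P_term g i k = braid i i *: (P_term g i k *m V (GKinv i)).
  have -> : P_term g i k *m V (GKinv i) =
      tens k (fun w => (phi i w)^-1 *: dressed_F g w) (V (GE i))
        (fun w => phi i w *: (E_word w *m V (GKinv i))).
    have -> : tens k (fun w => (phi i w)^-1 *: dressed_F g w) (V (GE i))
        (fun w => phi i w *: (E_word w *m V (GKinv i))) =
      tens k (fun w => (phi i w)^-1 *: dressed_F g w) (V (GE i))
        (fun w => phi i w *: E_word w) *m V (GKinv i).
      rewrite tensorMr; apply: eq_tensor => w _; first by [].
      by rewrite scalemxAl.
    congr (_ *m _).
    apply: etrans _ (tensor_phi i _ (null_phiV i (nA k)) (nE k)).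
    apply: eq_tensor => w _; last by [].
    by rewrite scalerA divff ?phi_neq0 // scale1r.
  rewrite /P_term tensorMl.
  have -> : tens k (fun w => V (GKinv i) *m dressed_F g w) (V (GE i)) E_word =
      tens k (fun w => ((phi i w)^-1 *: dressed_F g w) *m V (GKinv i)) (V (GE i)) E_word.
    apply: eq_tensor => w _; last by [].
    by rewrite /dressed_F -!scalemxAr (KinvF_word q0 rV) -!scalemxAl !scalerA mulrC.
  rewrite tensorMml (KinvE q0 rV) tensorZm; congr (_ *: _).
  rewrite -tensorMmr; apply: eq_tensor => w _; first by [].
  by rewrite (KinvE_word q0 rV).
have T3 : tens k.+1 (fun w => V (GKinv i) *m ldel braid i (dressed_F g) w) 1%:M E_word *m u =
    t i ^ (- coroot D l0 g i - 2) *: (P_term g i k *m u).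
  rewrite -tensorMl (tensor_ldel braid_sym i _ (nA k) (nE k.+1)).
  have -> : tens k (dressed_F g) 1%:M (fun w => E_word (i :: w)) = P_term g i k.
    by apply: etrans (tensorMmr _ _ _ _ _ _) _; rewrite mul1mx.
  rewrite e3; move: (P_term _ _ _) => X.
  rewrite -scalemxAl -mulmxA hKinv -scalemxAr scalerA -expfzDr // cii.
  by congr (_ ^ _ *: _); lia.
rewrite {1}/casimir_term tensorMl.
have -> : tens k.+1 (fun w => V (GE i) *m dressed_F g w) 1%:M E_word =
    tens k.+1 (fun w => dressed_F g w *m V (GE i) + (kap i * casimir_char g i) *:
      (rdel braid i (dressed_F g) w *m V (GK i)
        - V (GKinv i) *m ldel braid i (dressed_F g) w)) 1%:M E_word.
  by apply: eq_tensor => // w _; apply: E_dressed.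
rewrite tensorDl tensorZl tensorBl tensorMml mulmx1 -/(P_term g i k.+1).
move: T2 T3; set X1 := tens _ (fun w => _ *m V (GK i)) _ _; set X2 := tens _ _ _ _.
move: (casimir_term _ _) (P_term g i k) (P_term g i k.+1) X1 X2 => Y1 Y2 Y3 X1 X2 T2 T3.
rewrite mulmxDl -scalemxAl mulmxBl T2 T3 -[RHS]addrA; congr (_ + _).
rewrite kap_casimir_char scalerBr !scalerA -!(expfzDr _ _ t0).
have -> : coroot D l0 g i + 2 + (- coroot D l0 g i - 2) = 0 by lia.
have -> : coroot D l0 g i + 2 + (coroot D l0 g i + 2) = 2 * coroot D l0 g i + 4 by lia.
by rewrite expr0z scale1r [LHS]addrC.
Qed.


(** The contributions that cancel between successive [k] in [F_casimir_term]. *)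
Definition Q_term g i k := tens k (dressed_F g) (V (GF i)) E_word.

Lemma F_casimir_term g i k (u : 'cV[C]_m) : weight_vec b (g + al i) u ->
  casimir_term g k.+1 *m (V (GF i) *m u) =
  Q_term g i k.+1 *m u - Q_term g i k *m u
    + t i ^ (2 * coroot D l0 g i + 4) *: (V (GF i) *m (casimir_term (g + al i) k *m u)).
Proof.
move=> hu; have t0 := qi_neq0 D q0 i.
have cE : coroot D l0 (g + al i) i = coroot D l0 g i + 2.
  by rewrite corootD root_to_weight_simple cii.
have hK : V (GK i) *m u = t i ^ (coroot D l0 g i + 2) *: u.
  by rewrite (gr_K rV) (weight_op_vec _ hu) cE.
have hKinv : V (GKinv i) *m u = t i ^ (- (coroot D l0 g i + 2)) *: u.
  by rewrite (gr_Kinv rV) (weight_op_vec _ hu) cE.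
have nA k' := @null_dressed g k'.
have nE k' := @null_E_word k'.
have e2 := casimir_term_shift g i k.
have T2 : tens k.+1 (dressed_F g) 1%:M (fun w => V (GK i) *m ldel braid i E_word w) *m u =
    (casimir_char g i * t i ^ (coroot D l0 g i + 2)) *:
      (V (GF i) *m (casimir_term (g + al i) k *m u)).
  rewrite tensorMmr mul1mx (tensor_ldelr braid_sym i _ (nA k.+1) (nE k)).
  have -> : tens k (fun w => dressed_F g (i :: w)) (V (GK i)) E_word =
      casimir_char g i *: (V (GF i) *m (casimir_term (g + al i) k *m V (GK i))).
    rewrite -e2 tensorMr tensorMl -tensorZl -[V (GK i) in LHS]mul1mx -tensorMmr.
    apply: eq_tensor => w _; last by rewrite (KE_word q0 rV) scalemxAl.
    by rewrite /dressed_F char_word_cons -scalemxAr scalerA.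
  move: (casimir_term _ _) => X.
  by rewrite -scalemxAl -!mulmxA hK -!scalemxAr scalerA.
have T3 : tens k.+1 (dressed_F g) 1%:M (fun w => rdel braid i E_word w *m V (GKinv i)) *m u =
    (casimir_char g i * t i ^ (- (coroot D l0 g i + 2))) *: (Q_term g i k *m u).
  rewrite -tensorMr (tensor_rdelr braid_sym i _ (nA k.+1) (nE k)).
  have -> : tens k (fun w => dressed_F g (rcons w i)) 1%:M E_word =
      casimir_char g i *: Q_term g i k.
    rewrite /Q_term -[V (GF i)]mulmx1 -tensorMml -tensorZl; apply: eq_tensor => w _; last by [].
    rewrite /dressed_F char_word_rcons F_word_rcons -scalemxAl scalerA mulrC.
    by [].
  move: (Q_term _ _ _) => X.
  by rewrite -!scalemxAl -mulmxA hKinv -scalemxAr scalerA.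
rewrite {1}/casimir_term mulmxA tensorMr.
have -> : tens k.+1 (dressed_F g) 1%:M (fun w => E_word w *m V (GF i)) =
    tens k.+1 (dressed_F g) 1%:M (fun w => V (GF i) *m E_word w +
      kap i *: (V (GK i) *m ldel braid i E_word w - rdel braid i E_word w *m V (GKinv i))).
  apply: eq_tensor => w _; first by [].
  have := comm_E_word_F q0 simpleD q1 rV i w => /eqP.
  by rewrite subr_eq addrC => /eqP.
rewrite tensorDr tensorZr tensorBr tensorMmr mul1mx -/(Q_term g i k.+1).
move: T2 T3; set X1 := tens _ _ _ (fun w => V (GK i) *m _); set X2 := tens _ _ _ _.
move: (casimir_term _ _) (Q_term g i k) (Q_term g i k.+1) X1 X2 => Y1 Y2 Y3 X1 X2 T2 T3.
rewrite mulmxDl -scalemxAl mulmxBl T2 T3 -[RHS]addrA; congr (_ + _).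
have kE z : kap i * (casimir_char g i * z) = t i ^ (coroot D l0 g i + 2) * z.
  by rewrite -kap_casimir_char mulrA.
rewrite scalerBr !scalerA !kE -!(expfzDr _ _ t0).
have -> : coroot D l0 g i + 2 + - (coroot D l0 g i + 2) = 0 by lia.
have -> : coroot D l0 g i + 2 + (coroot D l0 g i + 2) = 2 * coroot D l0 g i + 4 by lia.
by rewrite expr0z scale1r [LHS]addrC.
Qed.

End QuantumCasimir.

(** * The quantum Casimir operator *)

Section Casimir.
Context (R : realType) (r : nat) (D : cartan_datum r) (q : R).
Local Notation C := R[i].
Local Notation al := (@simple_root r).

(** What complete reducibility needs of a Casimir operator. The condition on
    highest weight vectors is relative to a submodule, since it is applied to
    vectors that are of highest weight in a quotient. *)
Record casimir_operator m (V : gen r -> 'M[C]_m) (l0 : 'rV[int]_r)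
    (b : 'I_m -> 'rV[int]_r) (Om : 'M[C]_m) (ev : 'rV[int]_r -> C) : Prop :=
  CasimirOperator {
  cas_E : forall i, V (GE i) *m Om = Om *m V (GE i);
  cas_F : forall i, V (GF i) *m Om = Om *m V (GF i);
  cas_highest : forall S g u, submodule V S -> weight_vec b g u ->
    (forall i, S (V (GE i) *m u)) -> S (Om *m u - ev g *: u);
  cas_sep : forall g h : 'rV[int]_r, (forall i, 0 <= h 0 i) -> h != 0 ->
    (forall i, 0 <= coroot D l0 g i) -> (forall i, 0 <= coroot D l0 (g + h) i) ->
    ev g != ev (g + h) }.

Lemma mulmx_weight_ext m (b : 'I_m -> 'rV[int]_r) (X Y : 'M[C]_m) :
  (forall g (u : 'cV[C]_m), weight_vec b g u -> X *m u = Y *m u) -> X = Y.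
Proof.
move=> XY; apply/matrixP => a c.
have : X *m delta_mx c (0 : 'I_1) = Y *m delta_mx c 0.
  apply: (XY (b c)) => j; rewrite mxE andbT.
  by have [->//|_] := eqVneq j c; rewrite eqxx.
move=> /matrixP/(_ a 0); rewrite !mxE (bigD1 c) //= big1 => [|j /negPf jc].
  rewrite (bigD1 c) //= big1 => [|j /negPf jc]; last by rewrite mxE jc mulr0.
  by rewrite !mxE !eqxx !mulr1 !addr0.
by rewrite mxE jc mulr0.
Qed.

End Casimir.

Section QuantumCasimir.
Context (R : realType) (r : nat) (D : cartan_datum r) (q : R).
Local Notation C := R[i].
Local Notation al := (@simple_root r).
Local Notation t := (qi D q).
Hypotheses (q0 : 0 < q) (q1 : q != 1) (simpleD : is_simple D).
Context (m : nat) (V : gen r -> 'M[C]_m) (l0 : 'rV[int]_r).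
Context (b : 'I_m -> 'rV[int]_r) (rV : graded_rep D q V l0 b).

Local Notation term := (casimir_term D q V l0).

Definition casimir_sum n g : 'M[C]_m := \sum_(k < n) term g k.

Definition casimir_mx n : 'M[C]_m := \sum_a
  qC q ^ casimir_weight D l0 (b a) *: (casimir_sum n (b a) *m delta_mx a a).

Lemma casimir_mx_vec n g u : weight_vec b g u ->
  casimir_mx n *m u = qC q ^ casimir_weight D l0 g *: (casimir_sum n g *m u).
Proof.
move=> hu; rewrite /casimir_mx mulmx_suml.
have {2}-> : u = \sum_a u a 0 *: delta_mx a 0.
  apply/colP => a; rewrite summxE (bigD1 a) //= big1 => [|j /negPf ja].
    by rewrite !mxE !eqxx mulr1 addr0.
  by rewrite !mxE eq_sym ja mulr0.
rewrite mulmx_sumr scaler_sumr; apply: eq_bigr => a _.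
rewrite -scalemxAl -mulmxA.
have -> : delta_mx a a *m u = u a 0 *: delta_mx a 0 :> 'cV_m.
  apply/colP => j; rewrite !mxE (bigD1 a) //= big1 => [|k /negPf ka].
    by rewrite !mxE !eqxx andbT addr0 mulrC.
  by rewrite !mxE ka andbF mul0r.
have [->|/hu->] := eqVneq (u a 0) 0; last by [].
move: (casimir_sum n _) (casimir_sum n _) => X Y.
by rewrite scale0r !mulmx0 !scaler0.
Qed.

Lemma casimir_term0 g : term g 0 = 1%:M.
Proof.
rewrite /casimir_term tensor_empty; last exact: braid_sym.
by rewrite /dressed_F /= /char_word big_nil scale1r !mulmx1.
Qed.

Lemma telescope_shift n (f : nat -> 'cV[C]_m) :
  \sum_(k < n) (f k.+1 - f k) = f n - f 0.
Proof.
elim: n => [|n IH]; first by rewrite big_ord0 subrr.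
by rewrite big_ord_recr /= IH addrC addrA subrK.
Qed.

Lemma casimir_sumSl n g : casimir_sum n.+1 g = 1%:M + \sum_(k < n) term g k.+1.
Proof. by rewrite -(casimir_term0 g); apply: big_ord_recl. Qed.

Lemma casimir_sumSr n g : casimir_sum n.+1 g = casimir_sum n g + term g n.
Proof. exact: big_ord_recr. Qed.

Section Bounded.
Context (n : nat) (long : forall w, (n <= size w)%N -> E_word V w = 0).

Lemma term_long g k : (n <= k)%N -> term g k = 0.
Proof.
by move=> nk; apply: tensor0r => w sw; apply: long; rewrite sw.
Qed.

Lemma E_casimir_sum g i u : weight_vec b g u ->
  V (GE i) *m (casimir_sum n.+2 g *m u) =
  t i ^ (2 * coroot D l0 g i + 4) *: (casimir_sum n.+2 (g + al i) *m (V (GE i) *m u)).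
Proof.
move=> hu; rewrite casimir_sumSl [in RHS]casimir_sumSr (term_long _ (leqnSn n)) addr0 mulmxDl mul1mx mulmxDr.
rewrite mulmx_suml mulmx_sumr.
rewrite (eq_bigr (fun k : 'I_n.+1 => (P_term D q V l0 g i k.+1 *m u - P_term D q V l0 g i k *m u)
    + t i ^ (2 * coroot D l0 g i + 4) *: (term (g + al i) k *m (V (GE i) *m u)))); last first.
  by move=> k _; rewrite mulmxA (E_casimir_term q0 q1 simpleD rV i k hu).
rewrite big_split (telescope_shift n.+1 (fun k => P_term D q V l0 g i k *m u)) /=.
have -> : P_term D q V l0 g i n.+1 = 0.
  by apply: tensor0r => w sw; apply: long; rewrite sw.
have -> : P_term D q V l0 g i 0 = V (GE i).
  rewrite /P_term tensor_empty; last exact: braid_sym.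
  by rewrite /dressed_F /= /char_word big_nil scale1r mulmx1 mul1mx.
by rewrite mul0mx sub0r addNKr -scaler_sumr -mulmx_suml.
Qed.

Lemma F_casimir_sum g i u : weight_vec b (g + al i) u ->
  casimir_sum n.+2 g *m (V (GF i) *m u) =
  t i ^ (2 * coroot D l0 g i + 4) *: (V (GF i) *m (casimir_sum n.+2 (g + al i) *m u)).
Proof.
move=> hu; rewrite casimir_sumSl [in RHS]casimir_sumSr (term_long _ (leqnSn n)) addr0 mulmxDl mul1mx.
rewrite [casimir_sum _ _ *m u]mulmx_suml mulmx_suml mulmx_sumr.
rewrite (eq_bigr (fun k : 'I_n.+1 => (Q_term D q V l0 g i k.+1 *m u - Q_term D q V l0 g i k *m u)
    + t i ^ (2 * coroot D l0 g i + 4) *: (V (GF i) *m (term (g + al i) k *m u)))); last first.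
  by move=> k _; apply: (F_casimir_term q0 q1 simpleD rV k hu).
rewrite big_split (telescope_shift n.+1 (fun k => Q_term D q V l0 g i k *m u)) /=.
have -> : Q_term D q V l0 g i n.+1 = 0.
  by apply: tensor0r => w sw; apply: long; rewrite sw.
have -> : Q_term D q V l0 g i 0 = V (GF i).
  rewrite /Q_term tensor_empty; last exact: braid_sym.
  by rewrite /dressed_F /= /char_word big_nil scale1r mulmx1 mul1mx.
by rewrite mul0mx sub0r addNKr -scaler_sumr.
Qed.

Lemma qC_casimir_weight g i : qC q ^ casimir_weight D l0 (g + al i) =
  qC q ^ casimir_weight D l0 g * t i ^ (2 * coroot D l0 g i + 4).
Proof.
rewrite casimir_weightD // qi_expz -expfzDr ?qC_neq0 //.
by congr (_ ^ (_ + _)); ring.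
Qed.

(** The identities [E_casimir_term] and [F_casimir_term] telescope when they are
    summed over [k], up to a power of [q] that depends on the weight and that is
    absorbed by the factor [q ^ (lambda, lambda + 2 rho)], up to normalisation. *)
Lemma quantum_casimir : casimir_operator D V l0 b (casimir_mx n.+2)
  (fun g => qC q ^ casimir_weight D l0 g).
Proof.
split=> [i|i|S g u hS hu SE|g h hp h0 dg dgh].
- apply: (@mulmx_weight_ext _ _ _ b) => g u hu; rewrite -!mulmxA.
  have hEu : weight_vec b (g + al i) (V (GE i) *m u) by apply: homog_vec hu; apply: gr_E rV i.
  rewrite (casimir_mx_vec _ hu) (casimir_mx_vec _ hEu) -scalemxAr (E_casimir_sum i hu).
  by rewrite scalerA qC_casimir_weight.
- apply: (@mulmx_weight_ext _ _ _ b) => g u hu; rewrite -!mulmxA.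
  have hFu : weight_vec b (g - al i) (V (GF i) *m u) by apply: homog_vec hu; apply: gr_F rV i.
  have hu' : weight_vec b (g - al i + al i) u by rewrite subrK.
  rewrite (casimir_mx_vec _ hu') (casimir_mx_vec _ hFu) -scalemxAr.
  rewrite [in RHS](F_casimir_sum hu').
  by rewrite scalerA -qC_casimir_weight.
- rewrite (casimir_mx_vec _ hu) -scalerBr; apply: (subZ hS).
  rewrite casimir_sumSl mulmxDl mul1mx addrAC subrr add0r.
  rewrite mulmx_suml; apply: (sub_sum hS) => k _ /=.
  rewrite /casimir_term mulmx_suml; apply: (sub_sum hS) => a _.
  rewrite mulmx_suml; apply: (sub_sum hS) => a' _.
  rewrite -scalemxAl -!mulmxA mul1mx; apply: (subZ hS).
  have act_words (L : 'I_r -> gen r) w v : S v ->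
      S (foldr (fun i X => V (L i) *m X) 1%:M w *m v).
    move=> Sv; elim: w => [|i w IH] /=; first by rewrite mul1mx.
    by rewrite -mulmxA; apply: (sub_act hS).
  rewrite /dressed_F -scalemxAl; apply/(subZ hS)/(act_words (@GF r)).
  have := size_nth_word a'; case/lastP: (nth_word a') => [//|w i] _.
  by rewrite E_word_rcons -mulmxA; apply/(act_words (@GE r))/SE.
- have := casimir_weightB simpleD hp h0 dg dgh.
  apply: contraTneq => /eqP; rewrite /qC -!fmorphXz (inj_eq (fmorph_inj _)).
  by rewrite (inj_eq (ieexprIz q0 q1)) => /eqP->; rewrite ltxx.
Qed.

End Bounded.
End QuantumCasimir.

Lemma quantum_casimir_exists (R : realType) (r : nat) (D : cartan_datum r) (q : R)
    m (V : gen r -> 'M[R[i]]_m) (l0 : 'rV[int]_r) (b : 'I_m -> 'rV[int]_r) :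
  0 < q -> q != 1 -> is_simple D -> graded_rep D q V l0 b ->
  exists Om ev, casimir_operator D V l0 b Om ev.
Proof.
move=> q0 q1 simpleD rV; have [n long] := E_word_long rV.
exists (casimir_mx D q V l0 b n.+2), (fun g => qC q ^ casimir_weight D l0 g).
exact: quantum_casimir.
Qed.

(** * Brackets and the trace form in the classical case *)

Section Brackets.
Context (K : fieldType) (m : nat).
Implicit Types X Y Z : 'M[K]_m.

Definition bracket X Y : 'M[K]_m := X *m Y - Y *m X.

Lemma bracket_jacobi X Y Z :
  bracket X (bracket Y Z) = bracket (bracket X Y) Z + bracket Y (bracket X Z).
Proof.
rewrite /bracket !mulmxBl !mulmxBr !mulmxA.
by apply/matrixP => a c; rewrite !mxE; ring.
Qed.

Lemma trace_bracket X Y Z : \tr (bracket X Y *m Z) = - \tr (Y *m bracket X Z).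
Proof.
have trB (A B : 'M[K]_m) : \tr (A - B) = \tr A - \tr B by exact: raddfB.
rewrite /bracket mulmxBl mulmxBr !trB opprB !mulmxA; congr (_ - _).
by rewrite [RHS]mxtrace_mulC mulmxA.
Qed.

Lemma bracketZl k X Y : bracket (k *: X) Y = k *: bracket X Y.
Proof. by rewrite /bracket -scalemxAl -scalemxAr scalerBr. Qed.

Lemma bracketZr k X Y : bracket X (k *: Y) = k *: bracket X Y.
Proof. by rewrite /bracket -scalemxAl -scalemxAr scalerBr. Qed.

Lemma bracketDr X Y Z : bracket X (Y + Z) = bracket X Y + bracket X Z.
Proof. by rewrite /bracket mulmxDl mulmxDr opprD addrACA. Qed.

Lemma bracket_sumr (J : finType) X (f : J -> 'M[K]_m) :
  bracket X (\sum_a f a) = \sum_a bracket X (f a).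
Proof. by rewrite /bracket mulmx_sumr mulmx_suml sumrB. Qed.

Section Words.
Context (I : finType).
Implicit Types (L : I -> 'M[K]_m) (w : seq I).

(** Right-normed brackets; the value on the empty word is arbitrary. *)
Fixpoint bracket_word (L : I -> 'M[K]_m) (w : seq I) : 'M[K]_m :=
  if w is i :: w' then
    if w' is [::] then L i else bracket (L i) (bracket_word L w')
  else 0.

Lemma bracket_word_cons L i w : w != [::] ->
  bracket_word L (i :: w) = bracket (L i) (bracket_word L w).
Proof. by case: w. Qed.

Definition spanned L k Y := exists x : 'rV[K]_(nwords I k),
  Y = \sum_a x 0 a *: bracket_word L (nth_word a).

Lemma spanned_word L w k : size w = k -> spanned L k (bracket_word L w).
Proof.
move=> /nth_word_ex[a <-]; exists (delta_mx 0 a).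
rewrite (bigD1 a) //= big1 => [|c /negPf ca]; first by rewrite mxE !eqxx scale1r addr0.
by rewrite mxE ca andbF scale0r.
Qed.

Lemma spannedZD L k c Y Z : spanned L k Y -> spanned L k Z -> spanned L k (c *: Y + Z).
Proof.
move=> [y ->] [z ->]; exists (c *: y + z).
rewrite scaler_sumr -big_split; apply: eq_bigr => a _.
by rewrite !mxE scalerDl scalerA.
Qed.

Lemma spanned0 L k : spanned L k 0.
Proof. by exists 0; rewrite big1 // => a _; rewrite mxE scale0r. Qed.

Lemma spannedZ L k c Y : spanned L k Y -> spanned L k (c *: Y).
Proof. by move=> sY; rewrite -[c *: Y]addr0; apply/spannedZD/spanned0. Qed.

Lemma spannedD L k Y Z : spanned L k Y -> spanned L k Z -> spanned L k (Y + Z).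
Proof. by move=> sY sZ; rewrite -[Y]scale1r; apply: spannedZD. Qed.

Lemma spanned_sum L k (J : finType) (f : J -> 'M[K]_m) :
  (forall a, spanned L k (f a)) -> spanned L k (\sum_a f a).
Proof.
by move=> h; apply: (big_ind (spanned L k)) => // [|Y Z]; [apply: spanned0|apply: spannedD].
Qed.

Lemma spanned_bracket L i k Y : spanned L k.+1 Y -> spanned L k.+2 (bracket (L i) Y).
Proof.
move=> [y ->]; rewrite bracket_sumr; apply: spanned_sum => a.
rewrite bracketZr; apply: spannedZ; have sw := size_nth_word a.
rewrite -bracket_word_cons; first by apply: spanned_word; rewrite /= sw.
by case: (nth_word a) sw.
Qed.

End Words.
End Brackets.

Section ClassicalCasimir.
Context (R : realType) (r : nat) (D : cartan_datum r).
Local Notation C := R[i].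
Local Notation al := (@simple_root r).
Local Notation q := (1 : R).
Hypothesis (simpleD : is_simple D).

Let cii : forall i, cmat D i i = 2 := simple_diag simpleD.
Let q0 : 0 < q := ltr01.

Lemma qi_classical i : qi D q i = 1.
Proof. by rewrite qiE expr1n rmorph1. Qed.

Section Fixed.
Context (m : nat) (V : gen r -> 'M[C]_m) (l0 : 'rV[int]_r).
Context (b : 'I_m -> 'rV[int]_r) (rV : graded_rep D q V l0 b).
Local Notation E i := (V (GE i)).
Local Notation F i := (V (GF i)).
Local Notation H i := (V (GH i)).
Local Notation bF := (bracket_word (fun i => V (GF i))).
Local Notation bE := (bracket_word (fun i => V (GE i))).

Lemma H_classical i : H i = weight_op b (fun g => (coroot D l0 g i)%:~R).
Proof.
rewrite (gr_H rV); congr diag_mx; apply/rowP => j.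
by rewrite !mxE /qint qi_classical eqxx.
Qed.

Lemma bracket_H i g X : homog b g X ->
  bracket (H i) X = (root_to_weight D g 0 i)%:~R *: X.
Proof.
move=> hX; rewrite /bracket H_classical (weight_opM _ hX) /weight_op !mul_mx_diag.
set p := root_to_weight D g 0 i; apply/matrixP => a c; rewrite !mxE corootD -/p.
by rewrite rmorphD /=; ring.
Qed.

Lemma bracket_EF i j : bracket (E i) (F j) = if i == j then H i else 0.
Proof. exact: gr_EF rV i j. Qed.

Lemma homog_bracket g h (X Y : 'M[C]_m) : homog b g X -> homog b h Y -> homog b (g + h) (bracket X Y).
Proof.
by move=> hX hY; apply: homogB; [apply: homogM | rewrite addrC; apply: homogM].
Qed.

Lemma homog_bracket_F w : w != [::] -> homog b (- word_weight w) (bF w).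
Proof.
elim: w => [//|i [|j w] IH] _.
  by rewrite word_weight_cons /word_weight big_nil addr0; apply: gr_F rV i.
rewrite bracket_word_cons // word_weight_cons opprD.
by apply: homog_bracket (IH _) => //; apply: gr_F rV i.
Qed.

Lemma bracket_E_F_word i w : (1 < size w)%N ->
  spanned (fun i => F i) (size w).-1 (bracket (E i) (bF w)).
Proof.
elim: w => [//|j w IH] sw; have w0 : w != [::] by case: w sw {IH}.
rewrite bracket_word_cons // bracket_jacobi bracket_EF /=.
apply: spannedD.
  case: eqP => [->|_]; last first.
    by rewrite -[0](scale0r 0) bracketZl scale0r; apply: spanned0.
  by rewrite (bracket_H _ (homog_bracket_F w0)); apply/spannedZ/spanned_word.
case: w IH {sw} w0 => [|k [|l w]] IH w0; first by case/eqP: w0.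
  rewrite [bF _]/= bracket_EF; case: eqP => [<-|_]; last first.
    by rewrite -[0](scale0r 0) bracketZr scale0r; apply: spanned0.
  have -> : bracket (F j) (H i) = (- (root_to_weight D (- al j) 0 i)%:~R) *: F j.
    by rewrite scaleNr -(bracket_H _ (gr_F rV j)) /bracket opprB.
  by apply: spannedZ; apply: (@spanned_word _ _ _ _ [:: j]).
exact: spanned_bracket (IH _).
Qed.

Definition trace_pairing i : C := \tr (F i *m E i).

Lemma trace_H i j : \tr (H i *m H j) = (cmat D i j)%:~R * trace_pairing j.
Proof.
have e := bracket_EF j j; rewrite eqxx in e.
rewrite -e -[LHS]opprK -trace_bracket.
have -> : bracket (E j) (H i) = - bracket (H i) (E j) by rewrite /bracket opprB.
rewrite (bracket_H _ (gr_E rV j)) root_to_weight_simple -scaleNr -scalemxAl.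
by rewrite linearZ /= mulNr opprK mxtrace_mulC.
Qed.

Lemma trace_pairing_eq0 i : trace_pairing i = 0 -> H i = 0 /\ E i = 0 /\ F i = 0.
Proof.
move=> t0; have := trace_H i i; rewrite t0 mulr0 => tH.
have c0 a : coroot D l0 (b a) i = 0.
  have : \sum_a (coroot D l0 (b a) i) ^+ 2 = 0.
    apply: (@intr_inj C); rewrite [RHS]rmorph0 -tH H_classical mulmx_diag mxtrace_diag.
    by rewrite rmorph_sum; apply: eq_bigr => c _; rewrite !mxE rmorphXn expr2.
  move=> /eqP; rewrite psumr_eq0 => [/allP/(_ a)|c _]; last by rewrite sqr_ge0.
  by rewrite mem_index_enum => /(_ isT); rewrite sqrf_eq0 => /eqP.
have H0 : H i = 0.
  by rewrite H_classical; apply/matrixP => a c; rewrite !mxE c0 mul0rn.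
split=> //; split.
  have := bracket_H i (gr_E rV i).
  rewrite H0 /bracket mul0mx mulmx0 subrr root_to_weight_simple cii => /esym/eqP.
  by rewrite scaler_eq0 intr_eq0 => /eqP.
have := bracket_H i (gr_F rV i).
rewrite H0 /bracket mul0mx mulmx0 subrr root_to_weightN mxE root_to_weight_simple cii.
by move=> /esym/eqP; rewrite scaler_eq0 intr_eq0 => /eqP.
Qed.

Lemma trace_F_E i j : i != j -> \tr (F i *m E j) = 0.
Proof.
move=> ij; rewrite /mxtrace big1 // => a _; rewrite mxE big1 // => c _.
have [->|n1] := eqVneq (F i a c) 0; first by rewrite mul0r.
have [->|n2] := eqVneq (E j c a) 0; first by rewrite mulr0.
have := gr_F rV i _ _ n1; rewrite (gr_E rV j _ _ n2) -addrA => /eqP.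
rewrite -[X in X == _]addr0 (inj_eq (addrI _)) eq_sym subr_eq0 => /eqP/rowP/(_ i).
by rewrite !mxE !eqxx (negPf ij).
Qed.

(** Both sides are determined by the trace of [H_i H_j] when [i] and [j] are
    adjacent in the Dynkin diagram, which is connected. *)
Lemma sym_trace_pairing i j :
  (slen D i)%:R * trace_pairing i = (slen D j)%:R * trace_pairing j.
Proof.
pose J := [set k | (slen D k)%:R * trace_pairing k == (slen D i)%:R * trace_pairing i]%SET.
have [JT|JT] := eqVneq J finset.setT.
  have : j \in J by rewrite JT finset.in_setT.
  by rewrite finset.in_set => /eqP.
have iJ : i \in J by rewrite finset.in_set.
have J0 : J != finset.set0 by apply/finset.set0Pn; exists i.
have [k [l [kJ lJ kl]]] := simple_indecomposable simpleD J0 JT.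
case/negP: lJ; move: kJ; rewrite !finset.in_set => /eqP <-.
have skl := simple_sym simpleD k l.
have lk : cmat D l k != 0.
  apply: contraNneq kl => lk0; move: skl; rewrite lk0 mulr0 => /eqP.
  by rewrite mulf_eq0 eqz_nat -[slen D k == _]negbK -lt0n simple_slen_gt0.
have e : (cmat D k l)%:~R * trace_pairing l = (cmat D l k)%:~R * trace_pairing k.
  by rewrite -!trace_H mxtrace_mulC.
have {}skl : (slen D k)%:R * (cmat D k l)%:~R = (slen D l)%:R * (cmat D l k)%:~R :> C.
  by rewrite !pmulrn -!intrM skl.
apply/eqP; apply: (mulfI (x := (cmat D l k)%:~R)); first by rewrite intr_eq0.
rewrite mulrCA [RHS]mulrCA -e mulrA -skl; ring.
Qed.

Lemma spanned_F_homog k X a c : spanned (fun i => F i) k.+1 X -> X a c != 0 ->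
  exists2 w, size w = k.+1 & b a - b c = - word_weight w.
Proof.
move=> [x ->] Xac.
have : exists u : 'I_(nwords 'I_r k.+1), bF (nth_word u) a c != 0.
  apply/existsP; apply: contraNT Xac => /existsPn z; rewrite summxE big1 // => u _.
  by rewrite mxE; have /negPn/eqP-> := z u; rewrite mulr0.
move=> [u hu]; exists (nth_word u); first exact: size_nth_word.
have w0 : nth_word u != [::] by have := size_nth_word u; case: (nth_word u).
by rewrite (homog_bracket_F w0 hu) addrAC subrr add0r.
Qed.

(** The trace form pairs brackets of the [F_i] with brackets of the [E_i]
    nondegenerately: by invariance its radical is stable under bracketing with
    the [E_i], which shortens brackets, so by induction an element of the
    radical commutes with the [E_i]. *)
Lemma trace_nondeg k X : spanned (fun i => F i) k.+1 X ->
  (forall w, size w = k.+1 -> \tr (X *m bE w) = 0) -> X = 0.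
Proof.
have neg k' X' : spanned (fun i => F i) k'.+1 X' -> forall a c, X' a c != 0 ->
    exists i, root_to_weight D (b a - b c) 0 i < 0.
  move=> sX a c Xac; have [w sw e] := spanned_F_homog sX Xac.
  have w0 : word_weight w != 0.
    apply: contra_eqN (sum_word_weight w) => /eqP->; rewrite sw.
    by rewrite big1 // => i _; rewrite mxE.
  have [i hi] := exists_root_to_weight_gt0 simpleD w0 (word_weight_ge0 w).
  by exists i; rewrite e root_to_weightN mxE oppr_lt0.
elim: k X => [|k IH] X sX trX;
  apply: (comm_all_E_eq0 q0 simpleD rV _ (neg _ _ sX)) => i.
- apply/eqP; rewrite -subr_eq0 -/(bracket _ _); apply/eqP.
  have {sX} [x xE] : exists x : 'I_r -> C, X = \sum_j x j *: F j.
    have [y ->] := sX; exists (fun j => \sum_a (nth_word a == [:: j])%:R * y 0 a).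
    transitivity (\sum_a \sum_j ((nth_word a == [:: j])%:R * y 0 a) *: F j).
      apply: eq_bigr => a _; have := size_nth_word a; case: (nth_word a) => [|j []] //= _.
      rewrite (bigD1 j) //= eqxx mul1r big1 ?addr0 // => l /negPf lj.
      by rewrite eqseq_cons eq_sym lj mul0r scale0r.
    by rewrite exchange_big; apply: eq_bigr => j _; rewrite scaler_suml.
  have : \tr (X *m E i) = x i * trace_pairing i.
    rewrite xE mulmx_suml raddf_sum (bigD1 i) //= big1 => [|j ji].
      by rewrite -scalemxAl linearZ addr0.
    by rewrite -scalemxAl linearZ /= trace_F_E // mulr0.
  rewrite (trX [:: i]) // => /esym/eqP; rewrite mulf_eq0 => xt.
  rewrite xE bracket_sumr (bigD1 i) //= big1 => [|j ji].
    rewrite bracketZr bracket_EF eqxx addr0.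
    by case/orP: xt => /eqP => [->|/trace_pairing_eq0[-> _]]; rewrite ?scale0r ?scaler0.
  by rewrite bracketZr bracket_EF eq_sym (negPf ji) scaler0.
- apply/eqP; rewrite -subr_eq0 -/(bracket _ _); apply/eqP/IH.
    have [x ->] := sX; rewrite bracket_sumr; apply: spanned_sum => a.
    rewrite bracketZr; apply: spannedZ; have := @bracket_E_F_word i (nth_word a).
    by rewrite size_nth_word; apply.
  move=> w sw; rewrite trace_bracket -bracket_word_cons; last by case: (w) sw.
  by rewrite trX ?oppr0 //= sw.
Qed.

End Fixed.
End ClassicalCasimir.

(** * The classical Casimir operator *)

Section ClassicalCasimir.
Context (R : realType) (r : nat) (D : cartan_datum r).
Local Notation C := R[i].
Local Notation al := (@simple_root r).
Local Notation q := (1 : R).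
Hypothesis (simpleD : is_simple D).

Let cii : forall i, cmat D i i = 2 := simple_diag simpleD.

Lemma spanned_mx (m : nat) (I : finType) (L : I -> 'M[C]_m) k N (f : 'I_N -> 'M[C]_m) :
  (forall a, spanned L k (f a)) ->
  exists rho : 'M[C]_(N, nwords I k),
    forall a, f a = \sum_u rho a u *: bracket_word L (nth_word u).
Proof.
move=> sp; have [g gE] := fin_all_exists sp.
exists (\matrix_(a, u) g a 0 u) => a; rewrite {1}gE.
by apply: eq_bigr => u _; rewrite mxE.
Qed.

Section Fixed.
Context (m : nat) (V : gen r -> 'M[C]_m) (l0 : 'rV[int]_r).
Context (b : 'I_m -> 'rV[int]_r) (rV : graded_rep D q V l0 b).
Local Notation E i := (V (GE i)).
Local Notation F i := (V (GF i)).
Local Notation H i := (V (GH i)).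
Local Notation bF := (bracket_word (fun i => V (GF i))).
Local Notation bE := (bracket_word (fun i => V (GE i))).
Local Notation nw := (nwords 'I_r).
Local Notation tau := (trace_pairing V).

Lemma bracketM (X Y Z : 'M[C]_m) :
  bracket X (Y *m Z) = bracket X Y *m Z + Y *m bracket X Z.
Proof. by rewrite /bracket mulmxBl mulmxBr !mulmxA addrA subrK. Qed.

Definition trace_gram k : 'M[C]_(nw k) :=
  \matrix_(a, c) \tr (bF (nth_word a) *m bE (nth_word c)).

(** A pseudo-inverse, since brackets of words of a given length need not be
    linearly independent. *)
Definition trace_dual k : 'M[C]_(nw k) := pinvmx (trace_gram k)^T.

Lemma trace_dualP k :
  (trace_gram k)^T *m trace_dual k *m (trace_gram k)^T = (trace_gram k)^T.
Proof. by rewrite mulmxKpV. Qed.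

Definition bracket_tensor k (A B : seq 'I_r -> 'M[C]_m) : 'M[C]_m :=
  \sum_a \sum_c trace_dual k a c *: (A (nth_word a) *m B (nth_word c)).

Lemma bracket_bracket_tensor k X A B : bracket X (bracket_tensor k A B) =
  bracket_tensor k (fun w => bracket X (A w)) B + bracket_tensor k A (fun w => bracket X (B w)).
Proof.
rewrite bracket_sumr -big_split; apply: eq_bigr => a _.
rewrite bracket_sumr -big_split; apply: eq_bigr => c _.
by rewrite bracketZr bracketM scalerDr.
Qed.

Lemma trace_null_F k (c : 'rV[C]_(nw k.+1)) : c *m trace_gram k.+1 = 0 ->
  \sum_u c 0 u *: bF (nth_word u) = 0.
Proof.
move=> cG; apply: (trace_nondeg simpleD rV (k := k)); first by exists c.
move=> w /nth_word_ex[a <-]; have /rowP/(_ a) := cG; rewrite !mxE => e.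
rewrite -[RHS]e mulmx_suml raddf_sum; apply: eq_bigr => u _.
by rewrite /= mxE -scalemxAl linearZ.
Qed.

Lemma trace_null_E k (c : 'cV[C]_(nw k.+1)) : trace_gram k.+1 *m c = 0 ->
  \sum_u c u 0 *: bE (nth_word u) = 0.
Proof.
move=> cG; apply: (trace_nondeg simpleD (graded_twist rV) (k := k)).
  by exists c^T; apply: eq_bigr => u _; rewrite mxE.
move=> w /nth_word_ex[a <-]; have /colP/(_ a) := cG; rewrite !mxE => e.
rewrite -[RHS]e mulmx_suml raddf_sum; apply: eq_bigr => u _.
by rewrite /= mxE -scalemxAl linearZ /= mxtrace_mulC mulrC.
Qed.

(** Invariance of the trace form, read on its canonical element. *)
Lemma E_transfer i k :
  bracket_tensor k.+2 (fun w => bracket (E i) (bF w)) bE =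
  - bracket_tensor k.+1 bF (fun w => bracket (E i) (bE w)).
Proof.
have sp (a : 'I_(nw k.+2)) : spanned (fun i => F i) k.+1 (bracket (E i) (bF (nth_word a))).
  by have := bracket_E_F_word rV i (w := nth_word a);
     rewrite size_nth_word; apply.
have [rho rhoE] := spanned_mx sp.
have piE (x : 'I_(nw k.+1)) : \sum_v (- cons_mx C k.+1 i) x v *: bE (nth_word v) =
    - bracket (E i) (bE (nth_word x)).
  rewrite -bracket_word_cons; last by have := size_nth_word x; case: (nth_word x).
  rewrite -cons_mxE -sumrN; apply: eq_bigr => v _.
  by rewrite mxE scaleNr.
have adj : rho *m trace_gram k.+1 = trace_gram k.+2 *m (- cons_mx C k.+1 i)^T.
  apply/matrixP => a c; rewrite !mxE.
  transitivity (\tr (bracket (E i) (bF (nth_word a)) *m bE (nth_word c))).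
    rewrite rhoE mulmx_suml raddf_sum; apply: eq_bigr => u _.
    by rewrite /= mxE -scalemxAl linearZ.
  rewrite trace_bracket -raddfN -mulmxN -piE mulmx_sumr raddf_sum.
  by apply: eq_bigr => v _; rewrite /= [trace_gram _ _ _]mxE [_^T _ _]mxE -scalemxAr linearZ mulrC.
have := transfer (trace_dualP k.+2) (trace_dualP k.+1) adj
  (@trace_null_F k) (@trace_null_E k.+1) 1%:M.
rewrite /bracket_tensor => e.
transitivity (\sum_w \sum_w' trace_dual k.+2 w w' *: ((\sum_u rho w u *: bF (nth_word u)) *m 1%:M *m bE (nth_word w'))).
  by apply: eq_bigr => w _; apply: eq_bigr => w' _; rewrite -rhoE mulmx1.
rewrite e -sumrN; apply: eq_bigr => u _; rewrite -sumrN; apply: eq_bigr => x _.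
by rewrite piE mulmx1 mulmxN scalerN.
Qed.

Lemma F_transfer i k :
  bracket_tensor k.+2 bF (fun w => bracket (F i) (bE w)) =
  - bracket_tensor k.+1 (fun w => bracket (F i) (bF w)) bE.
Proof.
have sp (a : 'I_(nw k.+2)) : spanned (fun i => E i) k.+1 (bracket (F i) (bE (nth_word a))).
  by have := bracket_E_F_word (graded_twist rV) i (w := nth_word a);
     rewrite size_nth_word; apply.
have [rho rhoE] := spanned_mx sp.
have piE (x : 'I_(nw k.+1)) : \sum_v (- cons_mx C k.+1 i) x v *: bF (nth_word v) =
    - bracket (F i) (bF (nth_word x)).
  rewrite -bracket_word_cons; last by have := size_nth_word x; case: (nth_word x).
  rewrite -cons_mxE -sumrN; apply: eq_bigr => v _.
  by rewrite mxE scaleNr.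
have adj : (- cons_mx C k.+1 i) *m trace_gram k.+2 = trace_gram k.+1 *m rho^T.
  apply/matrixP => a c; rewrite !mxE.
  transitivity (\tr (- bracket (F i) (bF (nth_word a)) *m bE (nth_word c))).
    rewrite -piE mulmx_suml raddf_sum; apply: eq_bigr => u _.
    by rewrite /= [trace_gram _ _ _]mxE -scalemxAl linearZ.
  rewrite mulNmx raddfN /= trace_bracket opprK rhoE mulmx_sumr raddf_sum.
  by apply: eq_bigr => v _; rewrite /= [trace_gram _ _ _]mxE [_^T _ _]mxE -scalemxAr linearZ mulrC.
have := transfer (trace_dualP k.+1) (trace_dualP k.+2) adj
  (@trace_null_F k.+1) (@trace_null_E k) 1%:M.
rewrite /bracket_tensor => e.
transitivity (\sum_w \sum_w' trace_dual k.+2 w w' *: (bF (nth_word w) *m 1%:M *m (\sum_u rho w' u *: bE (nth_word u)))).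
  by apply: eq_bigr => w _; apply: eq_bigr => w' _; rewrite -rhoE mulmx1.
rewrite -e -sumrN; apply: eq_bigr => u _; rewrite -sumrN; apply: eq_bigr => x _.
by rewrite piE mulmx1 mulNmx scalerN.
Qed.

Lemma trace_gram1 (a c : 'I_(nw 1)) i : nth_word a = [:: i] ->
  trace_gram 1 a c = (c == a)%:R * tau i.
Proof.
move=> ai; rewrite mxE ai; have := size_nth_word c.
rewrite -(inj_eq (@nth_word_inj _ 1)) ai.
case: (nth_word c) => [|j []] //= _; rewrite eqseq_cons andbT.
have [->|ji] := eqVneq j i; first by rewrite mul1r.
by rewrite mul0r (trace_F_E rV) // eq_sym.
Qed.

Lemma trace_gram1' (a c : 'I_(nw 1)) i : nth_word a = [:: i] ->
  trace_gram 1 c a = (c == a)%:R * tau i.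
Proof.
move=> ai; rewrite mxE ai; have := size_nth_word c.
rewrite -(inj_eq (@nth_word_inj _ 1)) ai.
case: (nth_word c) => [|j []] //= _; rewrite eqseq_cons andbT.
have [->|ji] := eqVneq j i; first by rewrite mul1r.
by rewrite mul0r (trace_F_E rV).
Qed.

(** The one term of the telescoping sum that has no counterpart; the Cartan part
    of the Casimir operator compensates it. *)
Lemma E_bottom i : tau i *: bracket_tensor 1 (fun w => bracket (E i) (bF w)) bE = H i *m E i.
Proof.
have [a ai] := @nth_word_ex 'I_r 1 [:: i] erefl.
have -> : bracket_tensor 1 (fun w => bracket (E i) (bF w)) bE =
    H i *m \sum_c trace_dual 1 a c *: bE (nth_word c).
  rewrite /bracket_tensor (bigD1 a) //= [X in _ + X]big1 => [|a' a'a].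
    rewrite addr0 mulmx_sumr; apply: eq_bigr => c _.
    by rewrite ai /= (bracket_EF rV) eqxx scalemxAr.
  apply: big1 => c _; move: a'a; rewrite -(inj_eq (@nth_word_inj _ 1)) ai.
  have := size_nth_word a'; case: (nth_word a') => [|j []] //= _.
  rewrite eqseq_cons andbT => ji.
  by rewrite (bracket_EF rV) eq_sym (negPf ji) mul0mx scaler0.
rewrite scalemxAr; congr (_ *m _).
have := trace_null_E (c := \col_c (tau i * trace_dual 1 a c - (c == a)%:R)) => h.
have {h}/h : trace_gram 1 *m \col_c (tau i * trace_dual 1 a c - (c == a)%:R) = 0.
  apply/colP => z; rewrite [RHS]mxE.
  have /matrixP/(_ a z) := trace_dualP 1; rewrite [RHS]mxE => e.
  transitivity (\sum_c (tau i * (trace_dual 1 a c * trace_gram 1 z c))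
      - \sum_c (c == a)%:R * trace_gram 1 z c).
    by rewrite mxE -sumrB; apply: eq_bigr => c _; rewrite [X in _ * X]mxE; ring.
  apply/eqP; rewrite subr_eq0; apply/eqP.
  transitivity (trace_gram 1 z a).
    rewrite -[RHS]e mxE; apply: eq_bigr => c _; rewrite [_^T c z]mxE mulrA.
    congr (_ * _); rewrite [RHS]mxE (bigD1 a) //= big1 => [|a' /negPf a'a].
      by rewrite [_^T a a]mxE (trace_gram1 _ ai) eqxx mul1r addr0.
    by rewrite [_^T a a']mxE (trace_gram1' _ ai) a'a !mul0r.
  rewrite (bigD1 a) //= eqxx mul1r big1 ?addr0 // => c /negPf->.
  by rewrite mul0r.
move=> e; apply/eqP; rewrite -subr_eq0 -[X in _ == X]e; apply/eqP.
transitivity (\sum_c ((tau i * trace_dual 1 a c) *: bE (nth_word c)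
   - (c == a)%:R *: bE (nth_word c))).
  rewrite sumrB scaler_sumr; congr (_ - _); first by apply: eq_bigr => c _; rewrite scalerA.
  rewrite (bigD1 a) //= eqxx scale1r ai big1 ?addr0 // => c /negPf->.
  by rewrite scale0r.
by apply: eq_bigr => c _; rewrite [X in _ = X *: _]mxE scalerBl.
Qed.

Lemma F_bottom i : tau i *: bracket_tensor 1 bF (fun w => bracket (F i) (bE w)) = - (F i *m H i).
Proof.
have [a ai] := @nth_word_ex 'I_r 1 [:: i] erefl.
have FE j : bracket (F i) (E j) = if i == j then - H i else 0.
  have -> : bracket (F i) (E j) = - bracket (E j) (F i) by rewrite /bracket opprB.
  by rewrite (bracket_EF rV) eq_sym; case: eqP => [->|_]; rewrite ?oppr0.
have -> : bracket_tensor 1 bF (fun w => bracket (F i) (bE w)) =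
    (\sum_c trace_dual 1 c a *: bF (nth_word c)) *m (- H i).
  rewrite /bracket_tensor exchange_big (bigD1 a) //= [X in _ + X]big1 => [|a' a'a].
    rewrite addr0 mulmx_suml; apply: eq_bigr => c _.
    by rewrite ai /= FE eqxx scalemxAl.
  apply: big1 => c _; move: a'a; rewrite -(inj_eq (@nth_word_inj _ 1)) ai.
  have := size_nth_word a'; case: (nth_word a') => [|j []] //= _.
  rewrite eqseq_cons andbT => ji.
  by rewrite FE eq_sym (negPf ji) mulmx0 scaler0.
rewrite scalemxAl -mulmxN; congr (_ *m _).
have := trace_null_F (c := \row_c (tau i * trace_dual 1 c a - (c == a)%:R)) => h.
have {h}/h : \row_c (tau i * trace_dual 1 c a - (c == a)%:R) *m trace_gram 1 = 0.
  apply/rowP => z; rewrite [RHS]mxE.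
  have /matrixP/(_ z a) := trace_dualP 1; rewrite [RHS]mxE => e.
  transitivity (\sum_c (tau i * (trace_dual 1 c a * trace_gram 1 c z))
      - \sum_c (c == a)%:R * trace_gram 1 c z).
    by rewrite mxE -sumrB; apply: eq_bigr => c _; rewrite [X in X * _]mxE; ring.
  apply/eqP; rewrite subr_eq0; apply/eqP.
  transitivity (trace_gram 1 a z).
    rewrite -[RHS]e [RHS]mxE [RHS](bigD1 a) //= [X in _ + X]big1 => [|a' /negPf a'a].
      rewrite [_^T a a]mxE (trace_gram1 _ ai) eqxx mul1r addr0 [X in _ = X * _]mxE mulr_suml.
      by apply: eq_bigr => c _; rewrite [_^T z c]mxE; ring.
    by rewrite [_^T a' a]mxE (trace_gram1 _ ai) a'a mul0r mulr0.
  rewrite (bigD1 a) //= eqxx mul1r big1 ?addr0 // => c /negPf->.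
  by rewrite mul0r.
move=> e; apply/eqP; rewrite -subr_eq0 -[X in _ == X]e; apply/eqP.
transitivity (\sum_c ((tau i * trace_dual 1 c a) *: bF (nth_word c)
   - (c == a)%:R *: bF (nth_word c))).
  rewrite sumrB scaler_sumr; congr (_ - _); first by apply: eq_bigr => c _; rewrite scalerA.
  rewrite (bigD1 a) //= eqxx scale1r ai big1 ?addr0 // => c /negPf->.
  by rewrite scale0r.
by apply: eq_bigr => c _; rewrite [X in _ = X *: _]mxE scalerBl.
Qed.

End Fixed.
End ClassicalCasimir.

Section ClassicalCasimir.
Context (R : realType) (r : nat) (D : cartan_datum r).
Local Notation C := R[i].
Local Notation al := (@simple_root r).
Local Notation q := (1 : R).
Hypothesis (simpleD : is_simple D).

Let cii : forall i, cmat D i i = 2 := simple_diag simpleD.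

Section Fixed.
Context (m : nat) (V : gen r -> 'M[C]_m) (l0 : 'rV[int]_r).
Context (b : 'I_m -> 'rV[int]_r) (rV : graded_rep D q V l0 b).
Local Notation E i := (V (GE i)).
Local Notation F i := (V (GF i)).
Local Notation H i := (V (GH i)).
Local Notation bF := (bracket_word (fun i => V (GF i))).
Local Notation bE := (bracket_word (fun i => V (GE i))).
Local Notation tau := (trace_pairing V).
Local Notation tens := (bracket_tensor V).

Lemma bracket_E_long : exists n, forall w, (n < size w)%N -> bE w = 0.
Proof.
pose B := (\sum_a \sum_c absz (\sum_i (b a - b c) ord0 i)%R)%N.
exists B => w Bw; apply/matrixP => a c; rewrite [RHS]mxE; apply/eqP.
have w0 : w != [::] by case: w Bw.
have hw : homog b (word_weight w) (bE w).
  move=> a' c' n0; have := homog_bracket_F (graded_twist rV) w0 n0.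
  by rewrite -opprD => /oppr_inj.
apply: contraTT Bw => /hw e; rewrite -leqNgt.
have : \sum_i (b a - b c) ord0 i = (size w)%:Z.
  by rewrite e addrAC subrr add0r sum_word_weight.
move=> e'; rewrite /B (bigD1 a) //= (bigD1 c) //= e' absz_nat -addnA.
exact: leq_addr.
Qed.

Lemma bracket_sum_E n i : (forall w, (n < size w)%N -> bE w = 0) ->
  bracket (E i) (\sum_(k < n.+1) tens k.+1 bF bE) =
  tens 1 (fun w => bracket (E i) (bF w)) bE.
Proof.
move=> long; rewrite bracket_sumr.
under eq_bigr do rewrite bracket_bracket_tensor.
rewrite big_split /= [X in X + _]big_ord_recl [X in _ + X]big_ord_recr /=.
have -> : tens n.+1 bF (fun w => bracket (E i) (bE w)) = 0.
  apply: big1 => a _; apply: big1 => c _.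
  rewrite -bracket_word_cons; last by have := size_nth_word c; case: (nth_word c).
  by rewrite long ?mulmx0 ?scaler0 //= size_nth_word.
rewrite addr0 -addrA -big_split /= big1 ?addr0 // => k _.
by rewrite /bump /= add1n (E_transfer simpleD rV) addNr.
Qed.

Lemma bracket_sum_F n i : (forall w, (n < size w)%N -> bE w = 0) ->
  bracket (F i) (\sum_(k < n.+1) tens k.+1 bF bE) =
  tens 1 bF (fun w => bracket (F i) (bE w)).
Proof.
move=> long; rewrite bracket_sumr.
under eq_bigr do rewrite bracket_bracket_tensor.
rewrite big_split /= [X in X + _]big_ord_recr [X in _ + X]big_ord_recl /=.
have -> : tens n.+1 (fun w => bracket (F i) (bF w)) bE = 0.
  apply: big1 => a _; apply: big1 => c _.
  by rewrite long ?mulmx0 ?scaler0 //= size_nth_word.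
rewrite addr0 addrCA -big_split /= big1 ?addr0 // => k _.
by rewrite /bump /= add1n (F_transfer simpleD rV) addrN.
Qed.

(** The Casimir element [(lambda, lambda + 2 rho) + 2 sum F_beta E_beta], with
    the sum over dual bases of the nilpotent subalgebras for the invariant form,
    which is the trace form divided by [T]. *)
Definition classical_casimir_mx n (T : C) : 'M[C]_m :=
  weight_op b (fun g => (casimir_weight D l0 g)%:~R)
    + (2 * T) *: \sum_(k < n.+1) tens k.+1 bF bE.

Section Bounded.
Context (n : nat) (long : forall w, (n < size w)%N -> bE w = 0).
Context (T : C) (TE : forall i, T = (slen D i)%:R * tau i).

Lemma classical_casimir : casimir_operator D V l0 b (classical_casimir_mx n T)
  (fun g => (casimir_weight D l0 g)%:~R).
Proof.
split=> [i|i|S g u hS hu SE|g h hp h0 dg dgh].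
- apply/eqP; rewrite -subr_eq0 -/(bracket _ _) bracketDr bracketZr bracket_sum_E //.
  rewrite -scalerA (TE i) -[(_ * tau i) *: _]scalerA (E_bottom simpleD rV) scalerA.
  rewrite /bracket addrAC -addrA [weight_op _ _ *m _](weight_opM _ (gr_E rV i)).
  rewrite (H_classical rV) (weight_opM _ (gr_E rV i)) /weight_op !mul_mx_diag.
  apply/eqP/matrixP => a c; rewrite !mxE (casimir_weightD _ simpleD).
  rewrite corootD root_to_weight_simple cii !(rmorphD, rmorphM) /=.
  by rewrite -pmulrn; ring.
- apply/eqP; rewrite -subr_eq0 -/(bracket _ _) bracketDr bracketZr bracket_sum_F //.
  rewrite -scalerA (TE i) -[(_ * tau i) *: _]scalerA (F_bottom simpleD rV) scalerA.
  rewrite /bracket addrAC -addrA [weight_op _ _ *m _](weight_opM _ (gr_F rV i)).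
  rewrite (H_classical rV) /weight_op !mul_mx_diag.
  apply/eqP/matrixP => a c; rewrite !mxE.
  have -> : casimir_weight D l0 (b c) =
    casimir_weight D l0 (b c - al i) + 2 * (slen D i)%:Z * coroot D l0 (b c) i.
    rewrite -{1}[b c](subrK (al i)) (casimir_weightD _ simpleD) corootD.
    by rewrite root_to_weightN mxE root_to_weight_simple cii; ring.
  by rewrite !(rmorphD, rmorphM) /= -pmulrn; ring.
- rewrite /classical_casimir_mx mulmxDl (weight_op_vec _ hu) addrC addKr.
  rewrite -scalemxAl; apply: (subZ hS).
  rewrite mulmx_suml; apply: (sub_sum hS) => k _ /=.
  rewrite mulmx_suml; apply: (sub_sum hS) => a _.
  rewrite mulmx_suml; apply: (sub_sum hS) => c _.
  rewrite -scalemxAl; apply: (subZ hS).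
  have act_words w v : S v -> S (bF w *m v).
    elim: w v => [|i [|j w] IH] v Sv; first by rewrite mul0mx; apply: (sub0 hS).
      exact: (sub_act hS).
    rewrite bracket_word_cons // /bracket mulmxBl -!mulmxA.
    apply: (subB hS); first exact/(sub_act hS)/IH.
    exact/IH/(sub_act hS).
  have act_wordsE w v : S v -> S (bE w *m v).
    elim: w v => [|i [|j w] IH] v Sv; first by rewrite mul0mx; apply: (sub0 hS).
      exact: (sub_act hS).
    rewrite bracket_word_cons // /bracket mulmxBl -!mulmxA.
    apply: (subB hS); first exact/(sub_act hS)/IH.
    exact/IH/(sub_act hS).
  rewrite -mulmxA; apply: act_words.
  have : nth_word c != [::] by have := size_nth_word c; case: (nth_word c).
  elim: (nth_word c) => [//|i [|j w] IH] _; first exact: SE.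
  rewrite bracket_word_cons // /bracket mulmxBl -!mulmxA.
  apply: (subB hS); last exact/act_wordsE/SE.
  by apply/(sub_act hS)/IH.
- have := casimir_weightB simpleD hp h0 dg dgh.
  by apply: contraTneq => /intr_inj->; rewrite ltxx.
Qed.

End Bounded.
End Fixed.

Lemma classical_casimir_exists m (V : gen r -> 'M[C]_m) l0 b :
  graded_rep D q V l0 b -> exists Om ev, casimir_operator D V l0 b Om ev.
Proof.
move=> rV; have [n long] := bracket_E_long rV.
pose i0 := Ordinal (simple_rank simpleD).
exists (classical_casimir_mx V l0 b n ((slen D i0)%:R * trace_pairing V i0)).
exists (fun g => (casimir_weight D l0 g)%:~R).
by apply: classical_casimir => // i; apply: (sym_trace_pairing simpleD rV).
Qed.

End ClassicalCasimir.

Lemma casimir_exists (R : realType) (r : nat) (D : cartan_datum r) (q : R)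
    m (V : gen r -> 'M[R[i]]_m) (l0 : 'rV[int]_r) (b : 'I_m -> 'rV[int]_r) :
  0 < q -> is_simple D -> graded_rep D q V l0 b ->
  exists Om ev, casimir_operator D V l0 b Om ev.
Proof.
move=> q0 simpleD; have [->|q1] := eqVneq q 1; first exact: classical_casimir_exists.
exact: quantum_casimir_exists.
Qed.

(** * Complete reducibility *)

Section Separation.
Context (R : realType).

Lemma qint_inj (t : R) : 0 < t -> injective (qint t).
Proof.
move=> t0 a c; have tn : t != 0 by rewrite gt_eqF.
rewrite /qint; have [_|t1] := eqVneq t 1; first by move/intr_inj.
move/(divIf (sub_inv_neq0 t0 t1)) => e.
have : (t ^ a - t ^ c) * (1 + t ^ (- a - c)) = 0.
  have e1 : t ^ a * t ^ (- a - c) = t ^ (- c) by rewrite -expfzDr //; congr (_ ^ _); ring.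
  have e2 : t ^ c * t ^ (- a - c) = t ^ (- a) by rewrite -expfzDr //; congr (_ ^ _); ring.
  rewrite mulrBl !mulrDr !mulr1 e1 e2 opprD addrACA.
  by apply/eqP; rewrite addrACA -subr_eq0 in e *; lra.
move/eqP; rewrite mulf_eq0 subr_eq0 => /orP[/eqP/(ieexprIz t0 t1)//|].
by rewrite gt_eqF // ltr_wpDl // exprz_gt0.
Qed.

End Separation.

Section Decomposition.
Context (R : realType) (r : nat) (D : cartan_datum r) (q : R).
Local Notation C := R[i].
Local Notation al := (@simple_root r).
Hypotheses (q0 : 0 < q) (simpleD : is_simple D).

Let cii : forall i, cmat D i i = 2 := simple_diag simpleD.

Lemma root_to_weight_inj (g h : 'rV[int]_r) :
  (forall i, root_to_weight D g 0 i = root_to_weight D h 0 i) -> g = h.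
Proof.
move=> gh; apply/eqP; rewrite -subr_eq0; apply/negPn/negP => n0.
have := simple_posdef simpleD n0; rewrite big1 ?ltxx // => i _.
have : root_to_weight D (g - h) 0 i = 0.
  by rewrite root_to_weightD root_to_weightN mxE [X in _ + X]mxE gh subrr.
rewrite mxE => /(congr1 (fun z => (slen D i)%:Z * (g - h) 0 i * z)).
rewrite mulr0 mulr_sumr => e; rewrite -[RHS]e; apply: eq_bigr => j _; ring.
Qed.

Lemma qi_int_inj i : injective (qint (qi D q i)).
Proof.
move=> a c; rewrite qiE !qint_complex => /fmorph_inj; apply: qint_inj.
by rewrite exprn_gt0.
Qed.

Section Fixed.
Context (m : nat) (V : gen r -> 'M[C]_m) (l0 : 'rV[int]_r).
Context (b : 'I_m -> 'rV[int]_r) (rV : graded_rep D q V l0 b).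
Local Notation vec := 'cV[C]_m.
Local Notation co := (coroot D l0).

Lemma coroot_inj (g h : 'rV[int]_r) : (forall i, co g i = co h i) -> g = h.
Proof.
move=> gh; apply: root_to_weight_inj => i; have := gh i.
by rewrite /coroot !mxE => /addrI.
Qed.

(** The idempotent onto a weight space is a polynomial in the operators [H_i],
    so submodules are sums of weight spaces. *)
Lemma sub_weight S g v : submodule V S -> S v ->
  S (weight_op b (fun d => (d == g)%:R) *m v).
Proof.
move=> hS Sv.
(* [f] is a product of differences of eigenvalues of the [H_i], one factor for
   each basis vector of a weight other than [g]. *)
have [f [f0 fz] Sf] : exists2 f : 'rV[int]_r -> C,
    f g != 0 /\ (forall a, b a != g -> f (b a) = 0) &
    forall v, S v -> S (weight_op b f *m v).
  suff [f f0 [fz Sf]] : exists2 f : 'rV[int]_r -> C, f g != 0 &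
    (forall a, a \in enum 'I_m -> b a != g -> f (b a) = 0) /\
    forall v, S v -> S (weight_op b f *m v).
    by exists f => //; split=> // a; apply: fz; rewrite mem_enum.
  elim: (enum 'I_m) => [|a s [f f0 [fz Sf]]].
    exists (fun _ => 1); [exact: oner_neq0|split=> // u Su].
    have -> : weight_op b (fun _ => 1) = 1%:M :> 'M[C]_m.
      by apply/matrixP => x y; rewrite !mxE.
    by rewrite mul1mx.
  have [bg|bg] := eqVneq (b a) g.
    exists f => //; split=> // a'; rewrite in_cons => /orP[/eqP->|/fz//].
    by rewrite bg eqxx.
  have [i hi] : exists i, co (b a) i != co g i.
    apply/existsP; apply: contraNT bg => /existsPn e; apply/eqP/coroot_inj => i.
    by apply/eqP/negPn/(e i).
  exists (fun d => (qint (qi D q i) (co d i) - qint (qi D q i) (co (b a) i)) * f d).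
    by rewrite mulf_neq0 // subr_eq0 (inj_eq (@qi_int_inj i)) eq_sym.
  split=> [a'|u Su].
    rewrite in_cons => /orP[/eqP-> _|/fz h /h ->]; last by rewrite mulr0.
    by rewrite subrr mul0r.
  have -> : weight_op b (fun d => (qint (qi D q i) (co d i) -
       qint (qi D q i) (co (b a) i)) * f d) *m u = V (GH i) *m (weight_op b f *m u)
      - qint (qi D q i) (co (b a) i) *: (weight_op b f *m u).
    rewrite (gr_H rV) /weight_op !mul_diag_mx; apply/colP => x; rewrite !mxE; ring.
  by apply: (subB hS); [apply/(sub_act hS)/Sf | apply/(subZ hS)/Sf].
have -> : weight_op b (fun d => (d == g)%:R) *m v = (f g)^-1 *: (weight_op b f *m v).
  rewrite /weight_op !mul_diag_mx; apply/colP => x; rewrite !mxE.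
  have [->|/fz->] := eqVneq (b x) g; first by rewrite mul1r mulKf.
  by rewrite !mul0r mulr0.
exact/(subZ hS)/Sf.
Qed.

Lemma weight_vec_proj g (v : vec) :
  weight_vec b g (weight_op b (fun d => (d == g)%:R) *m v).
Proof.
move=> a; rewrite mul_diag_mx !mxE; have [//|_] := eqVneq (b a) g.
by rewrite mul0r eqxx.
Qed.

Lemma sum_weight_proj (v : vec) :
  v = \sum_(g <- undup (codom b)) weight_op b (fun d => (d == g)%:R) *m v.
Proof.
apply/colP => a; rewrite summxE.
rewrite (bigD1_seq (b a)) ?undup_uniq ?mem_undup ?codom_f //= big1 => [|g ga].
  by rewrite mul_diag_mx !mxE eqxx mul1r addr0.
by rewrite mul_diag_mx !mxE eq_sym (negPf ga) mul0r.
Qed.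

Definition height (g : 'rV[int]_r) : int := \sum_i g 0 i.

Lemma height_al g i : height (g + al i) = height g + 1.
Proof.
have <- : \sum_j al i 0 j = 1.
  rewrite (bigD1 i) //= big1 => [|j /negPf ji]; first by rewrite mxE !eqxx addr0.
  by rewrite mxE ji andbF.
by rewrite /height -big_split; apply: eq_bigr => j _; rewrite mxE.
Qed.

(** Raising operators increase the height of weights, which is bounded. *)
Lemma exists_relative_highest S S0 v : submodule V S -> submodule V S0 ->
  S v -> ~ S0 v ->
  exists g u, [/\ weight_vec b g u, S u, ~ S0 u & forall i, S0 (V (GE i) *m u)].
Proof.
move=> hS hS0 Sv nS0v.
have [g nS0g] : exists g, ~ S0 (weight_op b (fun d => (d == g)%:R) *m v).
  apply: contrapT => /forallNP h; apply: nS0v; rewrite [v]sum_weight_proj.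
  by apply: (sub_sum hS0) => g _; apply: contrapT => /h.
have := sub_weight g hS Sv; have := @weight_vec_proj g v.
move: (_ *m v) nS0g => u nS0u; clear v Sv nS0v.
pose B := (\sum_a absz (height (b a)))%N.
have bound h (w : vec) : weight_vec b h w -> ~ S0 w -> height h <= B%:Z.
  move=> hw nw; have [a wa] : exists a, w a 0 != 0.
    apply: contrapT => /forallNP z; apply: nw; have -> : w = 0.
      by apply/colP => a; rewrite [RHS]mxE; apply/eqP/negPn/negP/z.
    exact: sub0 hS0.
  by rewrite -(hw a wa) /B (bigD1 a) //=; lia.
have [n hn] : exists n : nat, B%:Z - height g < n%:Z.
  exists (absz (B%:Z - height g)).+1; lia.
elim: n g u nS0u hn => [|n IH] g u nS0u hn hu Su.
  by have := bound _ _ hu nS0u; lia.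
have [E0|/existsNP[i nE]] := pselect (forall i, S0 (V (GE i) *m u)).
  by exists g, u.
apply: (IH (g + al i) (V (GE i) *m u)) => //; last exact: (sub_act hS).
  by rewrite height_al; lia.
by apply: homog_vec hu; apply: (gr_E rV).
Qed.

Definition highest g (u : vec) := weight_vec b g u /\ forall i, V (GE i) *m u = 0.

Lemma sub_eq0 : submodule V (fun v => v = 0).
Proof.
split=> // [c u v -> ->|g u ->]; last by rewrite mulmx0.
by rewrite scaler0 addr0.
Qed.

Lemma highest_dominant g u : highest g u -> u != 0 -> forall i, 0 <= co g i.
Proof.
move=> [hu E0] u0 i; rewrite leNgt; apply/negP => neg; move/eqP: u0; apply.
exact: (highest_neg q0 rV cii sub_eq0 hu (E0 i) neg).
Qed.

Inductive highest_span (W : vec -> 'rV[int]_r -> Prop) : vec -> Prop :=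
| hspan_base g u : highest g u -> W u g -> highest_span W u
| hspan0 : highest_span W 0
| hspan_F i v : highest_span W v -> highest_span W (V (GF i) *m v)
| hspan_lin c u v : highest_span W u -> highest_span W v -> highest_span W (c *: u + v).

Lemma hspan_weight_op W f v : highest_span W v -> highest_span W (weight_op b f *m v).
Proof.
move=> hv; elim: hv f => [g u hu Wg|||] => [f||i u _ IH f|c u w _ IHu _ IHw f].
- rewrite (weight_op_vec _ (proj1 hu)) -[_ *: _]addr0.
  by apply: hspan_lin; [apply: hspan_base hu Wg|apply: hspan0].
- by move=> f; rewrite mulmx0; apply: hspan0.
- by rewrite mulmxA (weight_opM _ (gr_F rV i)) -mulmxA; apply/hspan_F/IH.
- by rewrite mulmxDr -scalemxAr; apply: hspan_lin.
Qed.

Lemma submodule_hspan W : submodule V (highest_span W).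
Proof.
split; [exact: hspan0|exact: hspan_lin|move=> [] i v hv].
- elim: hv => {v} [g u [_ E0] _||j v hv IH|c u v _ IHu _ IHv].
  + by rewrite E0; apply: hspan0.
  + by rewrite mulmx0; apply: hspan0.
  + have -> : V (GE i) *m (V (GF j) *m v) = 1 *: (V (GF j) *m (V (GE i) *m v)) +
        (V (GE i) *m V (GF j) - V (GF j) *m V (GE i)) *m v.
      by rewrite scale1r mulmxBl !mulmxA addrC subrK.
    apply: hspan_lin; first exact: hspan_F.
    rewrite (gr_EF rV); case: eqP => _; last by rewrite mul0mx; apply: hspan0.
    by rewrite (gr_H rV); apply: hspan_weight_op.
  + by rewrite mulmxDr -scalemxAr; apply: hspan_lin.
- exact: hspan_F.
- by rewrite (gr_K rV); apply: hspan_weight_op.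
- by rewrite (gr_Kinv rV); apply: hspan_weight_op.
- by rewrite (gr_H rV); apply: hspan_weight_op.
Qed.

Lemma hspan_support W v a : highest_span W v -> v a 0 != 0 ->
  exists u g (h : 'rV[int]_r), [/\ highest g u, W u g, u != 0, forall i, 0 <= h 0 i & g = b a + h].
Proof.
move=> hv; elim: hv a => {v} [g u hu Wg a ua|a||].
- exists u, g, 0; split=> //; last 2 first.
  + by move=> i; rewrite mxE.
  + by rewrite addr0 (proj1 hu a ua).
  by apply: contraNneq ua => ->; rewrite mxE.
- by rewrite mxE eqxx.
- move=> i v _ IH a; rewrite mxE => n0.
  have [c] : exists c, V (GF i) a c * v c 0 != 0.
    apply/existsP; apply: contraNT n0; rewrite negb_exists => /forallP z.
    by rewrite big1 // => c _; apply/eqP; rewrite -[_ == _]negbK.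
  rewrite mulf_eq0 negb_or => /andP[/(gr_F rV) bac /IH[u [g [h [hu Wg u0 hp gE]]]]].
  exists u, g, (h + al i); split=> //; last by rewrite gE bac addrACA addNr addr0.
  by move=> j; rewrite mxE addr_ge0 // mxE.
- move=> c u v _ IHu _ IHv a; rewrite mxE.
  have [u0|/IHu//] := eqVneq (u a 0) 0.
  by rewrite mxE u0 mulr0 add0r => /IHv.
Qed.

Context (Om : 'M[C]_m) (ev : 'rV[int]_r -> C) (cas : casimir_operator D V l0 b Om ev).

Lemma casimir_weight_vec g v : weight_vec b g v -> weight_vec b g (Om *m v).
Proof.
have OmH i : V (GH i) *m Om = Om *m V (GH i).
  have := gr_EF rV i i; rewrite eqxx => <-.
  rewrite mulmxBl mulmxBr -!mulmxA (cas_E cas) (cas_F cas) !mulmxA.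
  by rewrite (cas_E cas) (cas_F cas).
have hOm : homog b 0 Om.
  move=> a c n0; rewrite addr0; apply: coroot_inj => i; apply: (@qi_int_inj i).
  have /matrixP/(_ a c) := OmH i; rewrite (gr_H rV) /weight_op mul_diag_mx mul_mx_diag !mxE.
  by rewrite mulrC => /(mulfI n0).
by move=> hv; rewrite -[g]addr0; apply: homog_vec hv.
Qed.

Lemma casimir_highest g u : highest g u -> Om *m u = ev g *: u.
Proof.
move=> [hu E0]; apply/eqP; rewrite -subr_eq0; apply/eqP.
exact: (cas_highest cas sub_eq0 hu E0).
Qed.

Lemma casimir_hspan g v : highest_span (fun _ h => ev h = ev g) v -> Om *m v = ev g *: v.
Proof.
elim=> [h u hu <-||i u _ IH|c u w _ IHu _ IHw].
- exact: casimir_highest.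
- by rewrite mulmx0 scaler0.
- by rewrite mulmxA -(cas_F cas) -mulmxA IH scalemxAr.
- by rewrite mulmxDr -scalemxAr IHu IHw scalerDr !scalerA mulrC.
Qed.

Definition span_of u0 g0 := highest_span (fun u g => u = u0 /\ g = g0).

Lemma hspan_sub (W W' : vec -> 'rV[int]_r -> Prop) v : (forall u g, W u g -> W' u g) ->
  highest_span W v -> highest_span W' v.
Proof.
move=> WW'; elim=> [h u hu Wh||i u _ IH|c u w _ IHu _ IHw].
- by apply: hspan_base hu _; apply: WW'.
- exact: hspan0.
- exact: hspan_F.
- exact: hspan_lin.
Qed.

(** Lowering operators strictly decrease weights. *)
Lemma span_of_top u g v : highest g u -> span_of u g v ->
  exists c, weight_op b (fun d => (d == g)%:R) *m v = c *: u.
Proof.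
move=> hu; elim=> [h w hw [-> _]||i w hw _|c w1 w2 _ [c1 e1] _ [c2 e2]].
- by exists 1; rewrite (weight_op_vec _ (proj1 hu)) eqxx.
- by exists 0; rewrite mulmx0 scale0r.
- exists 0; rewrite mulmxA (weight_opM _ (gr_F rV i)) -mulmxA.
  suff -> : weight_op b (fun d => (d - al i == g)%:R) *m w = 0.
    by rewrite mulmx0 scale0r.
  rewrite /weight_op mul_diag_mx; apply/colP => a; rewrite !mxE.
  have [->|wa] := eqVneq (w a 0) 0; first by rewrite mulr0.
  have [u' [g' [h [_ [_ ->] _ hp ->]]]] := hspan_support hw wa.
  case: eqP => [/(congr1 (fun z : 'rV[int]_r => z 0 i))|_]; last by rewrite mul0r.
  by move=> e; exfalso; move: e (hp i); rewrite !mxE !eqxx /=; lia.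
- by exists (c * c1 + c2); rewrite mulmxDr -scalemxAr e1 e2 scalerA scalerDl.
Qed.

(** The submodule generated by a highest weight vector is simple, because the
    Casimir operator separates comparable dominant weights. *)
Lemma span_of_simple u g S v : highest g u -> u != 0 -> submodule V S ->
  S v -> span_of u g v -> v != 0 -> S u.
Proof.
move=> hu u0 hS Sv sv v0.
have hS' : submodule V (fun v => S v /\ span_of u g v).
  split; first by split; [apply: sub0 hS|apply: hspan0].
    by move=> c x y [Sx sx] [Sy sy]; split; [apply: (subZD hS)|apply: hspan_lin].
  by move=> x y [Sy sy]; split; [apply: (sub_act hS)|apply: (sub_act (submodule_hspan _))].
have [h [w [hw [Sw sw] w0 Ew]]] :=
  exists_relative_highest hS' sub_eq0 (conj Sv sv) (fun e => negP v0 (introT eqP e)).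
have {}w0 : w != 0 by apply/eqP.
have hhw : highest h w by split.
have [a wa] : exists a, w a 0 != 0.
  apply/existsP; apply: contraNT w0 => /existsPn z; apply/eqP/colP => a.
  by rewrite [RHS]mxE; apply/eqP/negPn/(z a).
have [u' [g' [k [_ [_ g'E] _ kp e]]]] := hspan_support sw wa; rewrite g'E in e.
rewrite (hw a wa) in e.
have [k0|k0] := eqVneq k 0.
  have hg : h = g by rewrite e k0 addr0.
  have [c] := span_of_top hu sw; rewrite -hg (weight_op_vec _ hw) eqxx scale1r => wE.
  have c0 : c != 0 by apply: contraNneq w0 => c0; rewrite wE c0 scale0r.
  have -> : u = c^-1 *: w by rewrite wE scalerA mulVf // scale1r.
  exact: (subZ hS).
have : Om *m w = ev g *: w.
  by apply: casimir_hspan; apply: hspan_sub sw => _ _ [_ ->].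
rewrite (casimir_highest hhw) => /eqP; rewrite -subr_eq0 -scalerBl scaler_eq0 (negPf w0) orbF.
rewrite subr_eq0 e => /eqP ee; have := highest_dominant hu u0; rewrite e => dg.
by have := cas_sep cas kp k0 (highest_dominant hhw w0) dg; rewrite ee eqxx.
Qed.

(** Complete reducibility. Suppose that [u] is a weight vector, of weight [g],
    outside the span [S] of all simple highest weight modules and of highest
    weight modulo [S]. Let [P] be the polynomial in the Casimir operator whose
    roots are its other eigenvalues. Then [P] multiplies [u] by a nonzero
    scalar modulo [S], and maps [S] into the part of [S] on which the Casimir
    eigenvalue is that of [g]. This part has no weight [g + alpha_i], since the
    eigenvalue separates [g] from larger dominant weights. Hence [P u] is a
    highest weight vector, and lies in [S]; so does [u]. *)
Lemma hspan_all v : highest_span (fun _ _ => True) v.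
Proof.
set S := highest_span _; have hS : submodule V S by apply: submodule_hspan.
apply: contrapT => nSv.
have hT : submodule V (fun _ => True) by split.
have [g [u [hu _ nSu SE]]] := exists_relative_highest hT hS I nSv.
pose ws := [seq w <- undup (codom b) | ev w != ev g].
pose Q s := fun x : vec => foldr (fun w y => Om *m y - ev w *: y) x s.
pose P := Q ws.
have dg i : 0 <= co g i.
  rewrite leNgt; apply/negP => neg; apply: nSu.
  exact: (highest_neg q0 rV cii hS hu (SE i) neg).
have Plin c x y : P (c *: x + y) = c *: P x + P y.
  rewrite /P /Q; elim: (ws) => //= w s ->.
  rewrite mulmxDr -scalemxAr scalerDr opprD addrACA !scalerBr !scalerA.
  by rewrite [c * _]mulrC.
have Pcomm X : X *m Om = Om *m X -> forall x, P (X *m x) = X *m P x.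
  move=> XOm x; rewrite /P /Q; elim: (ws) => //= w s ->.
  by rewrite mulmxBr !mulmxA XOm scalemxAr.
have P0 : P 0 = 0.
  by rewrite /P /Q; elim: (ws) => //= w s ->; rewrite mulmx0 scaler0 subrr.
have Pev x c : Om *m x = c *: x -> P x = (\prod_(w <- ws) (c - ev w)) *: x.
  move=> xc; rewrite /P /Q; elim: (ws) => [|w s IH]; first by rewrite big_nil scale1r.
  rewrite big_cons /= IH -scalemxAr xc !scalerA -scalerBl; congr (_ *: _); ring.
have hP h x : weight_vec b h x -> weight_vec b h (P x).
  move=> hx; rewrite /P /Q; elim: (ws) => [|w s IH] //=; apply: weight_vecD.
    exact: casimir_weight_vec.
  by rewrite -scaleNr; apply: weight_vecZ.
have PS x : S x -> highest_span (fun _ h => ev h = ev g) (P x).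
  elim=> [h w hw _||i w _ IH|c w1 w2 _ IH1 _ IH2].
  - rewrite (Pev _ _ (casimir_highest hw)).
    have [->|w0] := eqVneq w 0; first by rewrite scaler0; apply: hspan0.
    have [ehg|ehg] := eqVneq (ev h) (ev g).
      by apply: (subZ (submodule_hspan _)); apply: hspan_base hw ehg.
    have hws : h \in ws.
      rewrite mem_filter ehg mem_undup.
      have [a wa] : exists a, w a 0 != 0.
        apply/existsP; apply: contraNT w0 => /existsPn z; apply/eqP/colP => a.
        by rewrite [RHS]mxE; apply/eqP/negPn/(z a).
      by rewrite -(proj1 hw a wa) codom_f.
    rewrite (big_rem h hws) /= subrr mul0r scale0r; exact: hspan0.
  - by rewrite P0; apply: hspan0.
  - by rewrite Pcomm ?(cas_F cas) //; apply: hspan_F.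
  - by rewrite Plin; apply: hspan_lin.
have nSP : ~ S (P u).
  have : S (P u - (\prod_(w <- ws) (ev g - ev w)) *: u).
    rewrite /P /Q; elim: (ws) => [|w s IH].
      by rewrite big_nil scale1r subrr; apply: (sub0 hS).
    have SOm x : S x -> S (Om *m x).
      elim=> [h y hy _||i y _ IHy|c y1 y2 _ IH1 _ IH2].
      + rewrite (casimir_highest hy); apply: (subZ hS); exact: hspan_base hy I.
      + by rewrite mulmx0; apply: (sub0 hS).
      + by rewrite mulmxA -(cas_F cas) -mulmxA; apply: hspan_F.
      + by rewrite mulmxDr -scalemxAr; apply: hspan_lin.
    rewrite big_cons /=; set y := foldr _ _ _ in IH *; set p := \prod_(_ <- s) _ in IH *.
    have -> : Om *m y - ev w *: y - ((ev g - ev w) * p) *: u =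
        (Om *m (y - p *: u) - ev w *: (y - p *: u)) + p *: (Om *m u - ev g *: u).
      rewrite mulmxBr -!scalemxAr !scalerBr !scalerA.
      by apply/colP => x; rewrite !mxE; ring.
    apply: (subD hS); last exact/(subZ hS)/(cas_highest cas hS hu SE).
    by apply: (subB hS); [apply: SOm|apply: (subZ hS)].
  move=> SP SPu; apply: nSu; have := subB hS SPu SP.
  rewrite opprB addrCA subrr addr0.
  set c := \prod_(_ <- _) _ => /(subZ hS c^-1); rewrite scalerA mulVf ?scale1r //.
  rewrite /c prodf_seq_neq0; apply/allP => w; rewrite mem_filter => /andP[ew _].
  by rewrite implyTb subr_eq0 eq_sym.
apply: nSP; apply: (@hspan_base _ g) => //; split.
  exact: hP.
move=> i; apply/eqP/negPn/negP => n0.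
have [a na] : exists a, (V (GE i) *m P u) a 0 != 0.
  apply/existsP; apply: contraNT n0 => /existsPn z; apply/eqP/colP => a.
  by rewrite [RHS]mxE; apply/eqP/negPn/(z a).
have hPu : weight_vec b (g + al i) (V (GE i) *m P u).
  by apply: homog_vec (hP _ _ hu); apply: (gr_E rV).
have bag := hPu a na.
rewrite -Pcomm ?(cas_E cas) // in na.
have [w [h [k [hw ehg w0 kp hE]]]] := hspan_support (PS _ (SE i)) na.
have kip j : 0 <= (al i + k) 0 j by rewrite mxE addr_ge0 // mxE.
have ki0 : al i + k != 0.
  apply/negP => /eqP/(congr1 (fun z : 'rV[int]_r => z 0 i)).
  by move=> e; move: e (kp i); rewrite !mxE !eqxx /=; lia.
have := highest_dominant hw w0; rewrite hE bag -addrA => dh.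
have := cas_sep cas kip ki0 dg dh.
by rewrite addrA -bag -hE ehg eqxx.
Qed.

End Fixed.
End Decomposition.

(** * Matrix coefficients of graded representations *)

(** This turns a submodule, given as a predicate, into a matrix representation. *)
Lemma subspace_basis (F : fieldType) m (S : 'cV[F]_m -> Prop) :
  S 0 -> (forall c u v, S u -> S v -> S (c *: u + v)) ->
  exists d (A : 'M[F]_(m, d)) (A' : 'M[F]_(d, m)), A' *m A = 1%:M /\
    forall v, S v <-> exists c, v = A *m c.
Proof.
move=> S0 SZD.
have SD u v : S u -> S v -> S (u + v).
  by move=> Su Sv; rewrite -[u]scale1r; apply: SZD.
(* A maximal linearly independent family of rows. *)
pose P d := `[< exists2 A : 'M[F]_(d, m), row_free A & forall c, S (c *m A)^T >].
have P0 : exists d, P d.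
  exists 0%N; apply/asboolP; exists 0; first by rewrite /row_free mxrank0.
  by move=> c; rewrite mulmx0 trmx0.
have Pm d : P d -> (d <= m)%N.
  by move=> /asboolP[A /eqP rA _]; rewrite -rA rank_leq_col.
have [d /asboolP[A Af SA] dmax] := ex_maxnP P0 Pm.
exists d, A^T, (pinvmx A)^T; rewrite -trmx_mul mulmxVp // trmx1; split=> // v.
split=> [Sv|[c ->]]; last by have := SA c^T; rewrite trmx_mul trmxK.
have [/submxP[c vc]|vA] := boolP (v^T <= A)%MS.
  by exists c^T; rewrite -trmx_mul -vc trmxK.
pose A1 := row_base (col_mx A v^T).
have : P (\rank (col_mx A v^T)).
  apply/asboolP; exists A1; first exact: row_base_free.
  move=> c; have /submxP[X A1X] : (A1 <= col_mx A v^T)%MS by rewrite eq_row_base.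
  rewrite A1X mulmxA -[c *m X]hsubmxK mul_row_col linearD /=.
  apply: SD; first exact: SA.
  rewrite trmx_mul trmxK [_^T]mx11_scalar mul_mx_scalar.
  by rewrite -[_ *: v]addr0; apply: SZD.
move=> /dmax dr; case/negP: vA.
have sA : (A <= col_mx A v^T)%MS by rewrite -addsmxE addsmxSl.
have : (col_mx A v^T <= A)%MS.
  by rewrite -(geq_leqif (mxrank_leqif_sup sA)) (eqP Af).
by rewrite -addsmxE addsmx_sub => /andP[].
Qed.

Section UqRepresentations.
Context (R : realType) (r : nat) (D : cartan_datum r) (q : R).
Local Notation C := R[i].
Local Notation al := (@simple_root r).

Lemma act_cat n (V : gen r -> 'M[C]_n) w w' : act V (w ++ w') = act V w * act V w'.
Proof. by rewrite /act big_cat. Qed.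

Lemma matrix_coef_lin n (V : gen r -> 'M[C]_n) f c u v w :
  matrix_coef V f (c *: u + v) w = c * matrix_coef V f u w + matrix_coef V f v w.
Proof. by rewrite /matrix_coef mulmxDr -scalemxAr !mxE. Qed.

Section Transfer.
Context (m d : nat) (V : gen r -> 'M[C]_m) (V' : gen r -> 'M[C]_d).
Context (A : 'M[C]_(m, d)) (A' : 'M[C]_(d, m)) (A'A : A' *m A = 1%:M).
Hypothesis AV : forall g, A *m V' g = V g *m A.

Definition intertwined (X' : 'M[C]_d) (X : 'M[C]_m) := A *m X' = X *m A.

Lemma intertwined_eq X' Y' X Y : intertwined X' X -> intertwined Y' Y -> X = Y -> X' = Y'.
Proof.
move=> hX hY XY; rewrite -[X']mul1mx -[Y']mul1mx -A'A -!mulmxA.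
by rewrite [A *m X']hX [A *m Y']hY XY.
Qed.

Lemma intertwinedM X' Y' X Y :
  intertwined X' X -> intertwined Y' Y -> intertwined (X' * Y') (X * Y).
Proof.
by move=> hX hY; rewrite /intertwined -!mulmxE mulmxA hX -mulmxA hY mulmxA.
Qed.

Lemma intertwinedZ c X' X : intertwined X' X -> intertwined (c *: X') (c *: X).
Proof. by move=> hX; rewrite /intertwined -scalemxAr hX scalemxAl. Qed.

Lemma intertwinedD X' Y' X Y :
  intertwined X' X -> intertwined Y' Y -> intertwined (X' + Y') (X + Y).
Proof. by move=> hX hY; rewrite /intertwined mulmxDr mulmxDl hX hY. Qed.

Lemma intertwinedN X' X : intertwined X' X -> intertwined (- X') (- X).
Proof. by move=> hX; rewrite /intertwined mulmxN mulNmx hX. Qed.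

Lemma intertwined0 : intertwined 0 0.
Proof. by rewrite /intertwined mulmx0 mul0mx. Qed.

Lemma intertwined1 : intertwined 1 1.
Proof. by rewrite /intertwined mulmx1 mul1mx. Qed.

Lemma intertwinedX X' X k : intertwined X' X -> intertwined (X' ^+ k) (X ^+ k).
Proof.
move=> hX; elim: k => [|k IH]; first exact: intertwined1.
by rewrite !exprS; apply: intertwinedM.
Qed.

Lemma intertwined_act w : intertwined (act V' w) (act V w).
Proof.
elim: w => [|g w IH]; first by rewrite /act !big_nil; apply: intertwined1.
by rewrite /act !big_cons; apply: intertwinedM => //; apply: AV.
Qed.

Lemma intertwined_serre X i j : intertwined (qserre D q V' X i j) (qserre D q V X i j).
Proof.
rewrite /qserre; set k := `|_|%N.
apply: (big_ind2 intertwined) => [||s _]; [exact: intertwined0|by move=> x1 x2 y1 y2 h1 h2; apply: (intertwinedD h1 h2)|].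
apply/intertwinedZ/intertwinedM; last exact/intertwinedX/AV.
by apply: intertwinedM; [apply/intertwinedX/AV|apply: AV].
Qed.

Lemma intertwined_rep : is_Uq_rep D q V -> is_Uq_rep D q V'.
Proof.
have hV g : intertwined (V' g) (V g) by apply: AV.
have hVV g g' : intertwined (V' g * V' g') (V g * V g') by apply: intertwinedM.
have hB X' Y' X Y : intertwined X' X -> intertwined Y' Y -> intertwined (X' - Y') (X - Y).
  by move=> hX hY; apply: intertwinedD => //; apply: intertwinedN.
case=> e1 e2 e3 e4 e5 e6 e7 e8 e9 e10 e11 e12 e13.
split.
- by move=> i; apply: intertwined_eq (e1 i); [exact: hVV|exact: intertwined1].
- by move=> i; apply: intertwined_eq (e2 i); [exact: hVV|exact: intertwined1].
- by move=> i j; apply: intertwined_eq (e3 i j).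
- by move=> i j; apply: intertwined_eq (e4 i j); [exact: hVV|exact: intertwinedZ].
- by move=> i j; apply: intertwined_eq (e5 i j); [exact: hVV|exact: intertwinedZ].
- move=> i j; apply: intertwined_eq (e6 i j); first exact: hB.
  by case: eqP => _; [apply: hV|apply: intertwined0].
- by move=> i; apply: intertwined_eq (e7 i); [apply: intertwinedZ|apply: hB].
- by move=> i j ij; apply: intertwined_eq (e8 i j ij); [apply: intertwined_serre|apply: intertwined0].
- by move=> i j ij; apply: intertwined_eq (e9 i j ij); [apply: intertwined_serre|apply: intertwined0].
- by move=> q1 i; apply: intertwined_eq (e10 q1 i); [apply: hV|apply: intertwined1].
- by move=> q1 i j; apply: intertwined_eq (e11 q1 i j).
- by move=> q1 i j; apply: intertwined_eq (e12 q1 i j); [apply: hB|apply: intertwinedZ].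
- by move=> q1 i j; apply: intertwined_eq (e13 q1 i j); [apply: hB|apply/intertwinedN/intertwinedZ].
Qed.

End Transfer.

Hypotheses (q0 : 0 < q) (simpleD : is_simple D).

Lemma rw_form_simple i l : qC q ^ rw_form D (al i) l = qi D q i ^ (l 0 i).
Proof.
rewrite qi_expz; congr (_ ^ _).
rewrite /rw_form (bigD1 i) //= big1 => [|j /negPf ji]; first by rewrite mxE !eqxx mulr1 addr0.
by rewrite mxE ji andbF mulr0 mul0r.
Qed.

Section Fixed.
Context (m : nat) (V : gen r -> 'M[C]_m) (l0 : 'rV[int]_r).
Context (b : 'I_m -> 'rV[int]_r) (rV : graded_rep D q V l0 b).

Lemma graded_is_Uq_rep : is_Uq_rep D q V.
Proof.
have cii := simple_diag simpleD; have cij := simple_offdiag simpleD.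
have KE := KE q0 rV; have KF := KF q0 rV.
split.
- move=> i; rewrite -mulmxE (gr_K rV) (gr_Kinv rV) /weight_op mulmx_diag.
  apply/matrixP => x y; rewrite !mxE -expfzDr ?qi_neq0 // subrr expr0z.
  by [].
- move=> i; rewrite -mulmxE (gr_K rV) (gr_Kinv rV) /weight_op mulmx_diag.
  apply/matrixP => x y; rewrite !mxE -expfzDr ?qi_neq0 // addNr expr0z.
  by [].
- by move=> i j; rewrite -mulmxE !(gr_K rV) /weight_op diag_mxC.
- move=> i j; rewrite -mulmxE KE /braid invr_expz opprK qi_expz.
  by [].
- move=> i j; rewrite -mulmxE KF /braid qi_expz; congr (_ ^ _ *: _).
  by rewrite mulrN.
- by move=> i j; rewrite -!mulmxE (gr_EF rV).
- move=> i; rewrite (gr_H rV) (gr_K rV) (gr_Kinv rV) /weight_op -linearB -linearZ.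
  congr diag_mx; apply/rowP => j; rewrite !mxE /qint.
  have [->|t1] := eqVneq (qi D q i) 1; first by rewrite invr1 subrr mul0r !exp1rz subrr.
  by rewrite mulrC divfK // qi_sub_inv.
- by move=> i j ij; apply: (serreE q0 rV cii cij).
- by move=> i j ij; apply: (serreF q0 rV cii cij).
- move=> q1 i; rewrite (gr_K rV) q1; apply/matrixP => x y.
  by rewrite !mxE qi_classical exp1rz.
- by move=> q1 i j; rewrite -!mulmxE !(gr_H rV) /weight_op diag_mxC.
- move=> q1 i j; move: rV; rewrite q1 => rV1.
  have := bracket_H rV1 i (gr_E rV1 j); rewrite root_to_weight_simple.
  by rewrite /bracket !mulmxE.
- move=> q1 i j; move: rV; rewrite q1 => rV1.
  have := bracket_H rV1 i (gr_F rV1 j).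
  rewrite root_to_weightN mxE root_to_weight_simple rmorphN scaleNr.
  by rewrite /bracket !mulmxE.
Qed.

(** The module generated by the highest weight vector is simple, so the
    coefficient belongs to a model of an irreducible representation. *)
Lemma highest_matrix_coef g u f : highest V b g u -> u != 0 ->
  is_matrix_coef D q (matrix_coef V f u).
Proof.
move=> hu u0; have [Om [ev cas]] := casimir_exists q0 simpleD rV.
pose S := span_of V b u g.
have hS : submodule V S := submodule_hspan rV _.
have Su : S u by apply: hspan_base hu _.
have [d [A [A' [A'A SA]]]] := subspace_basis (sub0 hS) (subZD hS).
have AA' v : S v -> A *m (A' *m v) = v.
  by move=> /SA[c ->]; rewrite [A' *m _]mulmxA A'A mul1mx.
pose V' h := A' *m V h *m A.
have AV h : A *m V' h = V h *m A.
  apply/matrixP => x y.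
  have Sc : S (V h *m (A *m delta_mx y 0)).
    by apply: (sub_act hS); apply/SA; exists (delta_mx y 0).
  have e : A *m V' h *m delta_mx y (0 : 'I_1) = V h *m A *m delta_mx y 0.
    by rewrite /V' -!mulmxA (AA' _ Sc).
  by move: e; rewrite -!colE => /colP/(_ x); rewrite [LHS]mxE [RHS]mxE.
exists d, V', (l0 + root_to_weight D g), (f *m A), (A' *m u).
have A'u0 : A' *m u != 0.
  by apply: contraNneq u0 => e; rewrite -(AA' _ Su) e mulmx0.
split.
- exact: (highest_dominant q0 simpleD rV hu u0).
- split; first exact: intertwined_rep A'A AV graded_is_Uq_rep.
    split.
      by rewrite lt0n; apply: contraNneq A'u0 => d0; apply/eqP/colP => -[x hx]; exfalso; move: hx; rewrite d0.
    move=> U stable; have [->|U0] := eqVneq U 0%VS; [by left|right].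
    pose S1 v := exists2 c, c \in U & v = A *m c.
    have hS1 : submodule V S1.
      split; first by exists 0; rewrite ?mem0v ?mulmx0.
        move=> c _ _ [x xU ->] [y yU ->]; exists (c *: x + y); last by rewrite mulmxDr scalemxAr.
        by rewrite memvD ?memvZ.
      by move=> h _ [x xU ->]; exists (V' h *m x); rewrite ?stable // [LHS]mulmxA -AV -mulmxA.
    have [x xU x0] : exists2 x, x \in U & x != 0.
      by exists (vpick U); rewrite ?memv_pick ?vpick0.
    have Ax0 : A *m x != 0.
      apply: contraNneq x0 => e; rewrite -[x]mul1mx -A'A -mulmxA e mulmx0 //.
    have S1u : S1 u.
      apply: (span_of_simple q0 simpleD rV cas hu u0 hS1 _ _ Ax0); first by exists x.
      by apply/SA; exists x.
    have SS1 v : S v -> S1 v.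
      elim=> [h y _ [-> _]||i y _ IH|c y z _ IHy _ IHz] //.
      + exact: (sub0 hS1).
      + exact: (sub_act hS1).
      + exact: (subZD hS1).
    apply/eqP; rewrite eqEsubv subvf; apply/subvP => c _.
    have [c' c'U e] : S1 (A *m c) by apply/SS1/SA; exists c.
    by rewrite -[c]mul1mx -A'A -mulmxA e mulmxA A'A mul1mx.
  exists (A' *m u); split; last first.
    by move=> i; rewrite /V' -!mulmxA (AA' _ Su) (proj2 hu) mulmx0.
  split=> // i; rewrite rw_form_simple; split=> [|q1].
    rewrite /V' -!mulmxA (AA' _ Su) (gr_K rV) (weight_op_vec _ (proj1 hu)).
    by rewrite -scalemxAr.
  rewrite /V' -!mulmxA (AA' _ Su) (gr_H rV) (weight_op_vec _ (proj1 hu)).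
  by rewrite -scalemxAr /qint q1 qi_classical eqxx.
- apply/funext => w; rewrite /matrix_coef -[in LHS](AA' _ Su) !mulmxA.
  by rewrite -[f *m act V w *m A]mulmxA -(intertwined_act AV) !mulmxA.
Qed.

End Fixed.

Local Notation OqG := (OqG D q).

Lemma OqG_matrix_coef a : is_matrix_coef D q a -> OqG a.
Proof.
by move=> ha; exists 1%N, (fun _ => 1), (fun _ => a); split=> // w; rewrite big_ord1 mul1r.
Qed.

Lemma OqG0 : OqG (fun _ => 0).
Proof.
exists 0%N, (fun _ => 0), (fun _ _ => 0); split=> [[]//|w].
by rewrite big_ord0.
Qed.

Lemma OqGZD c a a' : OqG a -> OqG a' -> OqG (fun w => c * a w + a' w).
Proof.
move=> [n [x [e [he ae]]]] [n' [x' [e' [he' ae']]]].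
exists (n + n')%N, (fun k => match fintype.split k with inl j => c * x j | inr j => x' j end).
exists (fun k => match fintype.split k with inl j => e j | inr j => e' j end).
split=> [k|w]; first by case: fintype.splitP.
rewrite ae ae' big_split_ord mulr_sumr; congr (_ + _); apply: eq_bigr => k _.
  by rewrite (fintype.unsplitK (inl k)) mulrA.
by rewrite (fintype.unsplitK (inr k)).
Qed.

Lemma OqG_right a X : OqG a -> OqG (fun w => a (w ++ X)).
Proof.
move=> [n [x [e [he ae]]]]; exists n, x, (fun k w => e k (w ++ X)); split=> // k.
have [d [V [l [f [v [dl hV ->]]]]]] := he k.
exists d, V, l, f, (act V X *m v); split=> //; apply/funext => w.
by rewrite /matrix_coef act_cat -mulmxE !mulmxA.
Qed.

Lemma OqG_translate a X : OqG a -> OqG (translate a X).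
Proof.
move=> [n [x [e [he ae]]]]; exists n, x, (fun k w => e k (X ++ w)); split=> [k|w]; last first.
  exact: ae.
have [d [V [l [f [v [dl hV ->]]]]]] := he k.
exists d, V, l, (f *m act V X), v; split=> //; apply/funext => w.
by rewrite /matrix_coef act_cat -mulmxE !mulmxA.
Qed.

(** Complete reducibility, in the form of matrix coefficients. *)
Lemma graded_OqG m (V : gen r -> 'M[C]_m) l0 b f v :
  graded_rep D q V l0 b -> OqG (matrix_coef V f v).
Proof.
move=> rV; have [Om [ev cas]] := casimir_exists q0 simpleD rV.
elim: (hspan_all q0 simpleD rV cas v) => [g u hu _||i u _ IH|c u w _ IHu _ IHw].
- have [->|u0] := eqVneq u 0; last exact/OqG_matrix_coef/(highest_matrix_coef rV _ hu).
  have -> : matrix_coef V f 0 = fun _ => 0; last exact: OqG0.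
  by apply/funext => w; rewrite /matrix_coef mulmx0 mxE.
- have -> : matrix_coef V f 0 = fun _ => 0; last exact: OqG0.
  by apply/funext => w; rewrite /matrix_coef mulmx0 mxE.
- have -> : matrix_coef V f (V (GF i) *m u) = fun w => matrix_coef V f u (w ++ [:: GF i]).
    apply/funext => w; rewrite /matrix_coef act_cat /act big_seq1 -mulmxE.
    by rewrite !mulmxA.
  exact: OqG_right.
- have -> : matrix_coef V f (c *: u + w) =
      fun X => c * matrix_coef V f u X + matrix_coef V f w X.
    by apply/funext => X; rewrite matrix_coef_lin.
  exact: OqGZD.
Qed.

End UqRepresentations.

(** * Tensor products and duals *)

Lemma conv_cons (R : realType) (r : nat) (a c : word r -> R[i]) g w :
  conv a c (g :: w) = \sum_(p <- coprod_gen g)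
    conv (fun X => a (p.1 ++ X)) (fun X => c (p.2 ++ X)) w.
Proof.
rewrite /conv /= big_flatten big_map; apply: eq_bigr => p _.
by rewrite big_map.
Qed.

Section TensorProduct.
Context (R : realType) (r : nat) (D : cartan_datum r) (q : R).
Local Notation C := R[i].
Local Notation al := (@simple_root r).

Section Coefficients.
Context (m n : nat) (V1 : gen r -> 'M[C]_m) (V2 : gen r -> 'M[C]_n).

Definition tens_rep (g : gen r) : 'M[C]_(m * n) :=
  \sum_(p <- coprod_gen g) act V1 p.1 *t act V2 p.2.

Lemma act_tens w : act tens_rep w = \sum_(p <- coprod w) act V1 p.1 *t act V2 p.2.
Proof.
elim: w => [|g w IH].
  rewrite /act !big_nil big_seq1 !big_nil; apply/matrixP => k l.
  case: (mxtens_indexP k) => i j; case: (mxtens_indexP l) => i' j'.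
  rewrite tensmxE !mxE (inj_eq (can_inj (@mxtens_indexK _ _))) -natrM mulnb.
  by rewrite xpair_eqE.
rewrite {1}/act big_cons -/(act tens_rep w) IH /= big_flatten big_map -mulmxE.
rewrite mulmx_suml; apply: eq_bigr => p _; rewrite mulmx_sumr big_map.
by apply: eq_bigr => t _; rewrite tensmx_mul !act_cat.
Qed.

(** The convolution of functionals is dual to the coproduct. *)
Lemma conv_matrix_coef (f1 : 'rV[C]_m) v1 (f2 : 'rV[C]_n) v2 :
  conv (matrix_coef V1 f1 v1) (matrix_coef V2 f2 v2) =
  matrix_coef tens_rep (f1 *t f2 : 'rV_(m * n)) (v1 *t v2 : 'cV_(m * n)).
Proof.
apply/funext => w; rewrite /conv /matrix_coef act_tens.
rewrite mulmx_sumr mulmx_suml summxE; apply: eq_bigr => p _.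
set X := act V1 _; set Y := act V2 _.
have e : f1 *t f2 *m (X *t Y) *m (v1 *t v2) = (f1 *m X *m v1) *t (f2 *m Y *m v2).
  by rewrite !tensmx_mul.
have -> : (f1 *m X *m v1) 0 0 * (f2 *m Y *m v2) 0 0 =
    (f1 *t f2 *m (X *t Y) *m (v1 *t v2)) (mxtens_index (0, 0)) (mxtens_index (0, 0)).
  by rewrite e tensmxE.
by congr (fun_of_matrix _ _ _); rewrite ord1.
Qed.

End Coefficients.

Hypotheses (q0 : 0 < q) (simpleD : is_simple D).
Let cii : forall i, cmat D i i = 2 := simple_diag simpleD.

Lemma homog_tens m n (b1 : 'I_m -> 'rV[int]_r) (b2 : 'I_n -> 'rV[int]_r) g h X Y :
  homog b1 g X -> homog b2 h Y ->
  homog (fun k => b1 (mxtens_unindex k).1 + b2 (mxtens_unindex k).2) (g + h) (X *t Y : 'M[C]_(m * n)).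
Proof.
move=> hX hY k l; rewrite mxE mulf_eq0 negb_or => /andP[/hX-> /hY->].
by rewrite addrACA.
Qed.

Lemma graded_tens m n (V1 : gen r -> 'M[C]_m) (V2 : gen r -> 'M[C]_n) l1 l2 b1 b2 :
  graded_rep D q V1 l1 b1 -> graded_rep D q V2 l2 b2 ->
  graded_rep D q (tens_rep V1 V2) (l1 + l2)
    (fun k => b1 (mxtens_unindex k).1 + b2 (mxtens_unindex k).2).
Proof.
move=> rV1 rV2.
have actg n' (V : gen r -> 'M[C]_n') g : act V [:: g] = V g by rewrite /act big_seq1.
have act0 n' (V : gen r -> 'M[C]_n') : act V [::] = 1%:M by rewrite /act big_nil.
have coD k i : coroot D (l1 + l2) (b1 (mxtens_unindex k).1 + b2 (mxtens_unindex k).2) i =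
  coroot D l1 (b1 (mxtens_unindex k).1) i + coroot D l2 (b2 (mxtens_unindex k).2) i.
  by rewrite /coroot root_to_weightD addrACA mxE.
have diag_eq (k l : 'I_(m * n)) : (k == l) =
    ((mxtens_unindex k).1 == (mxtens_unindex l).1) && ((mxtens_unindex k).2 == (mxtens_unindex l).2).
  by rewrite -(inj_eq (can_inj (@mxtens_unindexK _ _))) -xpair_eqE -!surjective_pairing.
split.
- move=> i; rewrite /tens_rep big_seq1 !actg (gr_K rV1) (gr_K rV2).
  apply/matrixP => k l; rewrite !mxE diag_eq coD expfzDr ?qi_neq0 //.
  by do 2 case: eqP => _; rewrite ?mulr1n ?mulr0n ?mul0r ?mulr0.
- move=> i; rewrite /tens_rep big_seq1 !actg (gr_Kinv rV1) (gr_Kinv rV2).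
  apply/matrixP => k l; rewrite !mxE diag_eq coD opprD expfzDr ?qi_neq0 //.
  by do 2 case: eqP => _; rewrite ?mulr1n ?mulr0n ?mul0r ?mulr0.
- move=> i; rewrite /tens_rep big_cons big_seq1 !actg (gr_H rV1) (gr_K rV2) (gr_Kinv rV1) (gr_H rV2).
  apply/matrixP => k l; rewrite !mxE diag_eq coD.
  case: eqP => _; case: eqP => _; rewrite ?mulr1n ?mulr0n ?mul0r ?mulr0 ?addr0 //.
  move: (coroot D l1 _ i) (coroot D l2 _ i) => y z.
  have := qint_skew z y (qi_neq0 D q0 i) (@qi_sub_inv _ _ _ _ q0 i).
  by move=> h; rewrite -h subrK addrC.
- move=> i; rewrite /tens_rep big_cons big_seq1 !actg act0.
  apply: homogD.
    rewrite -[al i]addr0; apply: homog_tens; first exact: gr_E rV1 i.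
    by rewrite (gr_K rV2); apply: homog_weight_op.
  rewrite -[al i]add0r; apply: homog_tens; last exact: gr_E rV2 i.
  exact: homog1.
- move=> i; rewrite /tens_rep big_cons big_seq1 !actg act0.
  apply: homogD.
    rewrite -[- al i]addr0; apply: homog_tens; first exact: gr_F rV1 i.
    exact: homog1.
  rewrite -[- al i]add0r; apply: homog_tens; last exact: gr_F rV2 i.
  by rewrite (gr_Kinv rV1); apply: homog_weight_op.
- move=> i j; rewrite /tens_rep !big_cons !big_nil !addr0 /= !actg !act0.
  rewrite !mulmxDl !mulmxDr !tensmx_mul !mulmx1 !mul1mx.
  have e1 : V1 (GE i) *m V1 (GF j) = V1 (GF j) *m V1 (GE i) + (if i == j then V1 (GH i) else 0).
    by rewrite -(gr_EF rV1) addrC subrK.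
  have e2 : V2 (GE i) *m V2 (GF j) = V2 (GF j) *m V2 (GE i) + (if i == j then V2 (GH i) else 0).
    by rewrite -(gr_EF rV2) addrC subrK.
  have c1 : (V1 (GKinv j) *m V1 (GE i)) *t (V2 (GF j) *m V2 (GK i)) =
      (V1 (GE i) *m V1 (GKinv j)) *t (V2 (GK i) *m V2 (GF j)).
    rewrite (KinvE q0 rV1) (KF q0 rV2) (braid_sym _ simpleD).
    by apply/matrixP => k l; rewrite !mxE; ring.
  rewrite e1 e2 c1.
  move: (V1 (GF j) *m _) (V2 (GF j) *m _) => x y.
  case: eqP => [<-|_]; rewrite ?addr0; apply/matrixP => k l; rewrite !mxE; ring.
Qed.

Lemma graded_dual m (V : gen r -> 'M[C]_m) l b :
  graded_rep D q V l b -> graded_rep D q (dual_rep V) (- l) (fun k => - b k).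
Proof.
move=> rV.
have actg n' (U : gen r -> 'M[C]_n') g : act U [:: g] = U g by rewrite /act big_seq1.
have actg2 g g' : act V [:: g; g'] = V g *m V g' by rewrite /act big_cons big_seq1.
split.
- move=> i; rewrite /dual_rep /= expr0 scale1r actg (gr_Kinv rV) tr_diag_mx.
  by congr diag_mx; apply/rowP => j; rewrite !mxE coroot_opp.
- move=> i; rewrite /dual_rep /= expr0 scale1r actg (gr_K rV) tr_diag_mx.
  by congr diag_mx; apply/rowP => j; rewrite !mxE coroot_opp opprK.
- move=> i; rewrite /dual_rep /= expr1 scaleN1r actg (gr_H rV) -linearN tr_diag_mx.
  by congr diag_mx; apply/rowP => j; rewrite !mxE coroot_opp qintN.
- move=> i a c; rewrite /dual_rep /= expr1 scaleN1r actg2 !mxE oppr_eq0.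
  have h : homog b (al i + 0) (V (GE i) *m V (GKinv i)).
    by apply: homogM; [apply: gr_E rV i|rewrite (gr_Kinv rV); apply: homog_weight_op].
  have := h c a; rewrite mxE => h' /h' ->.
  by rewrite addr0 opprD subrK.
- move=> i a c; rewrite /dual_rep /= expr1 scaleN1r actg2 !mxE oppr_eq0.
  have h : homog b (0 + - al i) (V (GK i) *m V (GF i)).
    by apply: homogM; [rewrite (gr_K rV); apply: homog_weight_op|apply: gr_F rV i].
  have := h c a; rewrite mxE => h' /h' ->.
  by rewrite add0r opprD opprK addrK.
- move=> i j; rewrite /dual_rep /= !expr1 !scaleN1r !actg2 actg.
  have tr2 (X Y : 'M[C]_m) : (- X)^T *m (- Y)^T = (Y *m X)^T.
    by rewrite -trmx_mul mulmxN mulNmx opprK.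
  have trB (X Y : 'M[C]_m) : X^T - Y^T = (X - Y)^T by rewrite linearB.
  rewrite !tr2 trB.
  have -> : V (GK j) *m V (GF j) *m (V (GE i) *m V (GKinv i)) -
      V (GE i) *m V (GKinv i) *m (V (GK j) *m V (GF j)) =
      V (GK j) *m (V (GF j) *m V (GE i) - V (GE i) *m V (GF j)) *m V (GKinv i).
    rewrite mulmxBr mulmxBl !mulmxA; congr (_ - _).
    rewrite -[V (GK j) *m V (GE i)]scale1r.
    have -> : V (GK j) *m V (GE i) = (braid D q j i)^-1 *: (V (GE i) *m V (GK j)).
      by rewrite (KE q0 rV).
    have -> : V (GE i) *m V (GKinv i) *m V (GK j) = V (GE i) *m V (GK j) *m V (GKinv i).
      by rewrite -!mulmxA !(gr_K rV) !(gr_Kinv rV) /weight_op diag_mxC.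
    rewrite -[in LHS]mulmxA (KinvF q0 rV) scale1r -!scalemxAl -scalemxAr !mulmxA.
    by rewrite (braid_sym _ simpleD).
  rewrite -[V (GF j) *m _ - _]opprB (gr_EF rV); case: eqP => [<-|_]; last first.
    by rewrite oppr0 mulmx0 mul0mx trmx0.
  rewrite mulmxN mulNmx (gr_H rV) (gr_K rV) (gr_Kinv rV) /weight_op !mulmx_diag.
  rewrite !linearN /= !tr_diag_mx; congr (- diag_mx _); apply/rowP => k; rewrite !mxE.
  by rewrite mulrAC -expfzDr ?qi_neq0 // subrr expr0z mul1r.
Qed.

End TensorProduct.

(** * Irreducible representations are graded *)

Lemma coef_int_inj (R : realType) (r : nat) (D : cartan_datum r) (q : R) i : 0 < q ->
  q != 1 -> is_simple D -> injective (exprz (qi D q i)).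
Proof.
move=> q0 q1 simpleD a c; rewrite !qiE -!fmorphXz => /fmorph_inj.
by apply: ieexprIz; rewrite ?exprn_gt0 // pexpr_eq1 ?(ltW q0) // simple_slen_gt0.
Qed.

Section Irreducible.
Context (R : realType) (r : nat) (D : cartan_datum r) (q : R).
Local Notation C := R[i].
Local Notation al := (@simple_root r).

Lemma irreducible_submodule m (V : gen r -> 'M[C]_m) S :
  irreducible_rep V -> submodule V S -> (exists2 v, S v & v != 0) -> forall v, S v.
Proof.
move=> [_ irr] hS [v Sv v0] w.
have [d [A [A' [A'A SA]]]] := subspace_basis (sub0 hS) (subZD hS).
pose U := limg (linfun (mulmx A : 'cV[C]_d -> 'cV[C]_m)).
have memU u : u \in U <-> S u.
  split=> [/memv_imgP[c _ ->]|/SA[c ->]]; first by rewrite lfunE; apply/SA; exists c.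
  by apply/memv_imgP; exists c; rewrite ?memvf ?lfunE.
have [g u /memU Su|U0|UT] := irr U; first exact/memU/(sub_act hS).
  by move/memU: Sv; rewrite U0 memv0 (negPf v0).
by apply/memU; rewrite UT memvf.
Qed.

Hypotheses (q0 : 0 < q) (simpleD : is_simple D).
Context (m : nat) (V : gen r -> 'M[C]_m) (l : 'rV[int]_r) (wt : 'I_m -> 'rV[int]_r) (N : 'I_m).
Hypotheses (irrV : is_irrep D q V l).
Hypothesis (wtV : forall j, is_weight_vector D q V (wt j) (delta_mx j 0)).
Hypothesis (topV : is_highest_vector D q V l (delta_mx N 0)).

Let mulmx_delta (X : 'M[C]_m) k j : (X *m delta_mx j (0 : 'I_1)) k 0 = X k j.
Proof. by rewrite -colE mxE. Qed.

Lemma irrep_K i : V (GK i) = diag_mx (\row_j qi D q i ^ (wt j 0 i)).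
Proof.
apply/matrixP => k j; rewrite -mulmx_delta ((wtV j).2 i).1 rw_form_simple // !mxE.
by have [->|_] := eqVneq k j; rewrite ?mulr1 ?mulr0.
Qed.

Lemma irrep_weight_ext (w w' : 'rV[int]_r) (c : C) : c != 0 ->
  (forall i, qi D q i ^ (w 0 i) * c = qi D q i ^ (w' 0 i) * c) ->
  (q = 1 -> forall i, (w 0 i)%:~R * c = (w' 0 i)%:~R * c) -> w = w'.
Proof.
move=> c0 e e1; apply/rowP => i; have [/e1/(_ i)|q1] := eqVneq q 1.
  by move/(mulIf c0)/intr_inj.
by have /(mulIf c0)/(coef_int_inj q0 q1 simpleD) := e i.
Qed.

Lemma irrep_H1 : q = 1 -> forall i, V (GH i) = diag_mx (\row_j (wt j 0 i)%:~R).
Proof.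
move=> q1 i; apply/matrixP => k j; rewrite -mulmx_delta (((wtV j).2 i).2 q1) !mxE.
by have [->|_] := eqVneq k j; rewrite ?mulr1 ?mulr0.
Qed.

Lemma irrep_E i k j : V (GE i) k j != 0 -> wt k = wt j + root_to_weight D (al i).
Proof.
have [rep _ _] := irrV => n0; apply: (irrep_weight_ext n0) => [y|q1 y].
  have /matrixP/(_ k j) := rep_KE rep y i.
  rewrite -!mulmxE irrep_K mul_diag_mx mul_mx_diag -qi_expz !mxE.
  rewrite (bigD1 i) //= big1 => [|s /negPf si]; last by rewrite mxE si andbF mulr0.
  rewrite mxE !eqxx mulr1 addr0 addrC expfzDr ?qi_neq0 // mulrCA mulrC => ->.
  by rewrite [RHS]mulrC mulrA.
have /matrixP/(_ k j) := rep_classical_HE rep q1 y i.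
rewrite -!mulmxE irrep_H1 // mul_diag_mx mul_mx_diag !mxE.
rewrite (bigD1 i) //= big1 => [|s /negPf si]; last by rewrite mxE si andbF mulr0.
by rewrite mxE !eqxx mulr1 addr0 rmorphD mulrDl => <-; ring.
Qed.

Lemma irrep_F i k j : V (GF i) k j != 0 -> wt k = wt j - root_to_weight D (al i).
Proof.
have [rep _ _] := irrV => n0; apply: (irrep_weight_ext n0) => [y|q1 y].
  have /matrixP/(_ k j) := rep_KF rep y i.
  rewrite -!mulmxE irrep_K mul_diag_mx mul_mx_diag -mulrN -qi_expz !mxE.
  rewrite (bigD1 i) //= big1 => [|s /negPf si]; last by rewrite mxE si andbF mulr0.
  rewrite mxE !eqxx mulr1 addr0 addrC expfzDr ?qi_neq0 // mulrCA mulrC => ->.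
  by rewrite [RHS]mulrC mulrA.
have /matrixP/(_ k j) := rep_classical_HF rep q1 y i.
rewrite -!mulmxE irrep_H1 // mul_diag_mx mul_mx_diag !mxE.
rewrite (bigD1 i) //= big1 => [|s /negPf si]; last by rewrite mxE si andbF mulr0.
by rewrite mxE !eqxx mulr1 addr0 rmorphB mulrBl => e; rewrite -[_ * V _ k j](subrK (V (GF i) k j * (wt j 0 y)%:~R)) e; ring.
Qed.

Lemma irrep_Kinv i : V (GKinv i) = diag_mx (\row_j qi D q i ^ (- wt j 0 i)).
Proof.
have [rep _ _] := irrV; have := rep_KKinv rep i.
set X := diag_mx _ => e; rewrite -[V (GKinv i)]mul1mx.
have -> : 1%:M = X *m V (GK i).
  rewrite irrep_K /X mulmx_diag; apply/matrixP => k j; rewrite !mxE -expfzDr ?qi_neq0 //.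
  by rewrite addNr expr0z.
by rewrite -mulmxA mulmxE e; apply: mulr1.
Qed.

Lemma irrep_H i : V (GH i) = diag_mx (\row_j qint (qi D q i) (wt j 0 i)).
Proof.
have [rep _ _] := irrV; have [q1|q1] := eqVneq q 1.
  rewrite irrep_H1 //; congr diag_mx; apply/rowP => j; rewrite !mxE q1 qi_classical /qint.
  by rewrite eqxx.
have t1 : qi D q i != 1.
  rewrite qiE -[X in _ != X](rmorph1 (real_complex R)) (inj_eq (fmorph_inj _)).
  by rewrite pexpr_eq1 ?(ltW q0) // simple_slen_gt0.
apply: (scalerI (qi_sub_inv q0 t1)); rewrite (rep_H rep) irrep_K irrep_Kinv.
rewrite -linearB -linearZ; congr diag_mx; apply/rowP => j; rewrite !mxE /qint (negPf t1).
by rewrite mulrC divfK // qi_sub_inv.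
Qed.

Lemma irrep_top : wt N = l.
Proof.
have c0 : (1 : C) != 0 := oner_neq0 _.
apply: (irrep_weight_ext c0) => [y|q1 y]; rewrite !mulr1.
  have := (topV.1.2 y).1; rewrite irrep_K rw_form_simple // => /colP/(_ N).
  by rewrite mul_diag_mx !mxE !eqxx !mulr1.
have := (topV.1.2 y).2 q1; rewrite irrep_H1 // => /colP/(_ N).
by rewrite mul_diag_mx !mxE !eqxx !mulr1.
Qed.

(** The vectors that are supported on such weights form a submodule, which
    contains the highest weight vector. *)
Lemma irrep_root_lattice j : exists h, wt j = l + root_to_weight D h.
Proof.
have [rep irr _] := irrV.
pose S (v : 'cV[C]_m) := forall j, v j 0 != 0 -> exists h, wt j = l + root_to_weight D h.
have hS : submodule V S.
  split=> [k|c u v Su Sv k|g u Su k]; first by rewrite mxE eqxx.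
    rewrite !mxE; have [u0|/Su//] := eqVneq (u k 0) 0.
    by rewrite u0 mulr0 add0r => /Sv.
  rewrite mxE => n0; have [s] : exists s, V g k s * u s 0 != 0.
    apply/existsP; apply: contraNT n0; rewrite negb_exists => /forallP z.
    by rewrite big1 // => s _; apply/eqP; rewrite -[_ == _]negbK.
  rewrite mulf_eq0 negb_or => /andP[Vg /Su[h hE]].
  have diag (f : 'rV[C]_m) : diag_mx f k s != 0 -> wt k = wt s.
    by rewrite mxE; have [->|_] := eqVneq k s; rewrite ?eqxx.
  case: g Vg {n0} => i.
  - by move=> /irrep_E->; exists (h + al i); rewrite hE root_to_weightD addrA.
  - by move=> /irrep_F->; exists (h - al i); rewrite hE root_to_weightD root_to_weightN addrA.
  - by rewrite irrep_K => /diag->; exists h.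
  - by rewrite irrep_Kinv => /diag->; exists h.
  - by rewrite irrep_H => /diag->; exists h.
have SN : S (delta_mx N 0).
  move=> k; rewrite mxE eqxx andbT pnatr_eq0 eqb0 negbK => /eqP->.
  exists 0; rewrite irrep_top -[LHS]addr0; congr (_ + _).
  by rewrite -[0 in RHS](subrr 0) root_to_weightD root_to_weightN subrr.
have := irreducible_submodule irr hS (ex_intro2 _ _ _ SN (topV.1.1)).
by move/(_ (delta_mx j 0) j); apply; rewrite mxE !eqxx oner_neq0.
Qed.

(** The weights lie below the highest one because the highest weight vector
    generates the module. *)
Lemma irrep_graded : exists b, [/\ graded_rep D q V l b, b N = 0,
  forall j i, b j 0 i <= 0 & forall j, wt j = l + root_to_weight D (b j)].
Proof.
have [rep irr _] := irrV.
have [b bE] := choice irrep_root_lattice.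
have rV : graded_rep D q V l b.
  split.
  - by move=> i; rewrite irrep_K; congr diag_mx; apply/rowP => j; rewrite !mxE bE /coroot.
  - by move=> i; rewrite irrep_Kinv; congr diag_mx; apply/rowP => j; rewrite !mxE bE /coroot.
  - by move=> i; rewrite irrep_H; congr diag_mx; apply/rowP => j; rewrite !mxE bE /coroot.
  - move=> i k j /irrep_E; rewrite !bE -addrA -root_to_weightD => /addrI/rowP e.
    exact: (root_to_weight_inj simpleD e).
  - move=> i k j /irrep_F; rewrite !bE -addrA -root_to_weightN -root_to_weightD => /addrI/rowP e.
    exact: (root_to_weight_inj simpleD e).
  - by move=> i j; have := rep_EF rep i j; rewrite -!mulmxE.
have bN : b N = 0.
  apply: (root_to_weight_inj simpleD) => i; congr fun_of_matrix.
  have -> : root_to_weight D 0 = 0.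
    by rewrite -(subrr 0) root_to_weightD root_to_weightN !subrr.
  by apply: (addrI l); rewrite -bE irrep_top addr0.
exists b; split=> // j i.
have hN : highest V b 0 (delta_mx N 0).
  split; last exact: topV.2.
  by move=> a; rewrite mxE eqxx andbT pnatr_eq0 eqb0 negbK => /eqP->.
have hS := submodule_hspan rV (fun u g => u = delta_mx N 0 /\ g = 0).
have SN : span_of V b (delta_mx N 0) 0 (delta_mx N 0) by apply: hspan_base hN _.
have all := irreducible_submodule irr hS (ex_intro2 _ _ _ SN (topV.1.1)).
have dj : (delta_mx j 0 : 'cV[C]_m) j 0 != 0 by rewrite mxE !eqxx oner_neq0.
have [u [g [h [_ [_ g0] _ hp e]]]] := hspan_support rV (all _) dj.
have := hp i; suff -> : h = - b j by rewrite mxE oppr_ge0.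
by apply/eqP; rewrite -addr_eq0 addrC -e g0.
Qed.

End Irreducible.

(** * Functions on the flag manifold *)

Section FlagFunctions.
Context (R : realType) (r : nat) (D : cartan_datum r) (q : R).
Local Notation C := R[i].
Local Notation al := (@simple_root r).
Hypotheses (q0 : 0 < q) (simpleD : is_simple D).

(** Otherwise [F_i u] would be a highest weight vector of weight [-2] for the
    [sl_2] of [alpha_i]. *)
Lemma highest_F_eq0 m (V : gen r -> 'M[C]_m) l0 b g u i :
  graded_rep D q V l0 b -> highest V b g u -> coroot D l0 g i = 0 -> V (GF i) *m u = 0.
Proof.
move=> rV [hu E0] c0; have cii := simple_diag simpleD.
have hFu : weight_vec b (g + - al i) (V (GF i) *m u).
  exact: (homog_vec (gr_F rV i) hu).
apply: (highest_neg (i := i) q0 rV cii (sub_eq0 V) hFu).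
  have -> : V (GE i) *m (V (GF i) *m u) = V (GF i) *m (V (GE i) *m u) +
      (V (GE i) *m V (GF i) - V (GF i) *m V (GE i)) *m u.
    by rewrite mulmxBl !mulmxA addrC subrK.
  by rewrite E0 (gr_EF rV) eqxx (gr_H rV) (weight_op_vec _ hu) c0 qint0 mulmx0 scale0r addr0.
by rewrite corootD c0 root_to_weightN mxE root_to_weight_simple cii.
Qed.

Section Fixed.
Context (m : nat) (V : gen r -> 'M[C]_m) (l : 'rV[int]_r) (b : 'I_m -> 'rV[int]_r).
Context (N : 'I_m) (rV : graded_rep D q V l b).
Hypotheses (bN : b N = 0) (b_le0 : forall j i, b j 0 i <= 0).
Hypothesis (topV : forall i, V (GE i) *m delta_mx N (0 : 'I_1) = 0).

Let rV' := graded_dual q0 simpleD rV.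
Local Notation v := (delta_mx N (0 : 'I_1) : 'cV[C]_m).

Let weight_top (c : 'I_m -> 'rV[int]_r) : weight_vec c (c N) v.
Proof. by move=> a; rewrite mxE eqxx andbT pnatr_eq0 eqb0 negbK => /eqP->. Qed.

Lemma dual_F_top i : dual_rep V (GF i) *m v = 0.
Proof.
apply/colP => k; rewrite -colE [LHS]mxE [RHS]mxE; apply/eqP/negPn/negP => n0.
have := gr_F rV' i k N n0.
rewrite bN oppr0 add0r => /oppr_inj bk; have := b_le0 k i.
by rewrite bk mxE !eqxx.
Qed.

Lemma dual_E_top i : l 0 i = 0 -> dual_rep V (GE i) *m v = 0.
Proof.
move=> li; apply: (highest_F_eq0 (graded_twist rV') (g := 0)).
  split=> [|j]; last exact: dual_F_top.
  by have := weight_top (fun k => - - b k); rewrite bN !oppr0.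
by rewrite /coroot opprK mxE li add0r mxE big1 // => k _; rewrite mxE mulr0.
Qed.

Definition levi_vec : 'cV[C]_(m * m) := v *t v.

(** The Levi subalgebra acts on the highest weight vector and on its dual vector
    by characters inverse to each other. *)
Lemma levi_vec_gen (S : {set 'I_r}) g : (forall i, i \in S -> l 0 i = 0) -> levi_gen S g ->
  tens_rep V (dual_rep V) g *m levi_vec = (grouplike_gen g)%:R *: levi_vec.
Proof.
move=> lS.
have actg n' (U : gen r -> 'M[C]_n') h : act U [:: h] = U h by rewrite /act big_seq1.
have act0 n' (U : gen r -> 'M[C]_n') : act U [::] = 1%:M by rewrite /act big_nil.
have tens0 (u : 'cV[C]_m) : u *t (0 : 'cV[C]_m) = 0 by apply/matrixP => k j; rewrite !mxE mulr0.
have tens0' (u : 'cV[C]_m) : (0 : 'cV[C]_m) *t u = 0 by apply/matrixP => k j; rewrite !mxE mul0r.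
have tensM (X Y : 'M[C]_m) : X *t Y *m levi_vec = (X *m v) *t (Y *m v) by exact: (tensmx_mul X Y v v).
have tensZ c d : (c *: v) *t (d *: v) = (c * d) *: levi_vec.
  by apply/matrixP => k j; rewrite !mxE mulrACA.
have wv := weight_top b; have wv' := weight_top (fun k => - b k).
have hv : highest V b 0 v by split=> //; move: wv; rewrite bN.
have cN i : coroot D l (b N) i = l 0 i.
  by rewrite bN /coroot mxE mxE big1 ?addr0 // => k _; rewrite mxE mulr0.
have cN' i : coroot D (- l) (- b N) i = - l 0 i by rewrite coroot_opp cN.
have one X Y c : (X *m v) *t (Y *m v) = c *: levi_vec -> X *t Y *m levi_vec = c *: levi_vec.
  by move=> <-; apply: tensM.
have two X Y X' Y' c : (X *m v) *t (Y *m v) + (X' *m v) *t (Y' *m v) = c *: levi_vec ->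
    (X *t Y + X' *t Y') *m levi_vec = c *: levi_vec.
  by move=> <-; rewrite mulmxDl; congr (_ + _); apply: tensM.
case: g => i lg.
- rewrite /tens_rep big_cons big_seq1 !actg act0; apply: two.
  rewrite (topV i) (dual_E_top (lS i lg)) (tens0 (1%:M *m v)) (tens0' (dual_rep V (GK i) *m v)).
  by rewrite addr0 scale0r.
- rewrite /tens_rep big_cons big_seq1 !actg act0; apply: two.
  have ci : coroot D l 0 i = 0 by rewrite -bN cN; apply: lS.
  rewrite (dual_F_top i) (highest_F_eq0 rV hv ci) (tens0 (V (GKinv i) *m v)) (tens0' (1%:M *m v)).
  by rewrite addr0 scale0r.
- rewrite /tens_rep big_seq1 !actg; apply: one.
  rewrite (gr_K rV) (gr_K rV') (weight_op_vec _ wv) (weight_op_vec _ wv').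
  by rewrite tensZ cN cN' -expfzDr ?qi_neq0 // subrr expr0z.
- rewrite /tens_rep big_seq1 !actg; apply: one.
  rewrite (gr_Kinv rV) (gr_Kinv rV') (weight_op_vec _ wv) (weight_op_vec _ wv').
  by rewrite tensZ cN cN' -expfzDr ?qi_neq0 // opprK addNr expr0z.
- rewrite /tens_rep big_cons big_seq1 !actg; apply: two.
  rewrite (gr_H rV) (gr_Kinv rV) (gr_K rV') (gr_H rV') !(weight_op_vec _ wv) !(weight_op_vec _ wv').
  by rewrite !tensZ -scalerDl cN cN' qintN mulrC -mulrDr addrN mulr0.
Qed.

Lemma levi_vec_word (S : {set 'I_r}) X : (forall i, i \in S -> l 0 i = 0) -> all (levi_gen S) X ->
  act (tens_rep V (dual_rep V)) X *m levi_vec = counit R X *: levi_vec.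
Proof.
move=> lS; elim: X => [|g X IH] /=; first by rewrite /act big_nil mul1mx scale1r.
move=> /andP[lg /IH e]; rewrite /act big_cons -mulmxE -mulmxA e -scalemxAr (levi_vec_gen lS lg).
by rewrite scalerA -natrM mulnb andbC.
Qed.

(** The functions that generate the flag manifold. *)
Definition zcoef i j : word r -> C := conv (matrix_coef V (delta_mx 0 i) v)
  (matrix_coef (dual_rep V) (delta_mx 0 j) v).

(** The function is the matrix coefficient of a Levi-invariant vector in the
    tensor product of [V] and its dual, and this tensor product is completely
    reducible. *)
Lemma zcoef_OqGL (S : {set 'I_r}) i j :
  (forall k, k \in S -> l 0 k = 0) -> OqGL D q S (zcoef i j).
Proof.
move=> lS; rewrite /zcoef conv_matrix_coef; split.
  exact: (graded_OqG q0 simpleD _ _ (graded_tens q0 simpleD rV rV')).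
move=> w X lX; rewrite /matrix_coef act_cat -mulmxE -!mulmxA -/levi_vec.
by rewrite (levi_vec_word lS lX) -!scalemxAr mxE.
Qed.

Lemma row_weight_op (c : 'I_m -> 'rV[int]_r) f k :
  delta_mx (0 : 'I_1) k *m weight_op c f = f (c k) *: (delta_mx 0 k : 'rV[C]_m).
Proof.
apply/rowP => a; rewrite mul_mx_diag !mxE eqxx /=.
by have [->|_] := eqVneq a k; rewrite ?mulr1 ?mul1r ?mulr0 ?mul0r.
Qed.

Lemma conv_scale (x y c : C) (a a' e e' : word r -> C) :
  (forall w, a w = x * a' w) -> (forall w, e w = y * e' w) -> x * y = c ->
  forall w, conv a e w = c * conv a' e' w.
Proof.
move=> ha he xy w; rewrite /conv mulr_sumr; apply: eq_bigr => p _.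
by rewrite ha he -xy mulrACA.
Qed.

Local Notation wt k := (l + root_to_weight D (b k)).

Lemma row_subE (g h : 'rV[int]_r) y : (g - h) 0 y = g 0 y - h 0 y.
Proof. by rewrite !mxE. Qed.

Lemma zcoef_K i j y w :
  zcoef i j (GK y :: w) = qi D q y ^ ((wt i - wt j) 0 y) * zcoef i j w.
Proof.
rewrite /zcoef conv_cons big_seq1 /=; apply: conv_scale => [u|u|].
- rewrite /matrix_coef /act big_cons -mulmxE mulmxA (gr_K rV) row_weight_op -!scalemxAl mxE.
  by [].
- rewrite /matrix_coef /act big_cons -mulmxE mulmxA (gr_K rV') row_weight_op -!scalemxAl mxE.
  by [].
- by rewrite -expfzDr ?qi_neq0 // coroot_opp row_subE.
Qed.

Lemma zcoef_H i j y w : q = 1 ->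
  zcoef i j (GH y :: w) = ((wt i - wt j) 0 y)%:~R * zcoef i j w.
Proof.
move=> q1; rewrite /zcoef conv_cons big_cons big_seq1 /=.
have t1 : qi D q y = 1 by rewrite q1 qi_classical.
have qn p : qint (qi D q y) p = p%:~R by rewrite /qint t1 eqxx.
rewrite row_subE rmorphB mulrBl -mulNr; congr (_ + _); apply: conv_scale => [u|u|].
- rewrite /matrix_coef /act big_cons -mulmxE mulmxA (gr_H rV) row_weight_op -!scalemxAl mxE.
  by [].
- rewrite /matrix_coef /act big_cons -mulmxE mulmxA (gr_K rV') row_weight_op -!scalemxAl mxE.
  by [].
- by rewrite qn t1 exp1rz mulr1.
- rewrite /matrix_coef /act big_cons -mulmxE mulmxA (gr_Kinv rV) row_weight_op -!scalemxAl mxE.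
  by [].
- rewrite /matrix_coef /act big_cons -mulmxE mulmxA (gr_H rV') row_weight_op -!scalemxAl mxE.
  by [].
- by rewrite qn t1 exp1rz mul1r coroot_opp rmorphN.
Qed.

End Fixed.
End FlagFunctions.

(** * Weights of the tangent basis *)

Section WeightForm.
Context (r : nat) (D : cartan_datum r) (simpleD : is_simple D).
Local Notation al := (@simple_root r).

(** By positive definiteness of the symmetrised Cartan matrix. *)
Lemma cartan_unit : map_mx intr (cmat D)^T \in @unitmx rat r.
Proof.
rewrite unitmxE unitfE det_map_mx intr_eq0; apply/det0P => -[u u0 uC].
have := simple_posdef simpleD u0; rewrite big1 ?ltxx // => i _.
have /rowP/(_ i) := uC; rewrite !mxE => e.
rewrite -[RHS](mulr0 ((slen D i)%:Z * u 0 i)) -[in RHS]e mulr_sumr; apply: eq_bigr => j _.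
by rewrite mxE; ring.
Qed.

Lemma weight_form_simple x i :
  weight_form D (fund_weight x) (root_to_weight D (al i)) = ((x == i) * slen D i)%:R.
Proof.
rewrite /weight_form /weight_gram.
have -> : (map_mx intr (root_to_weight D (al i)))^T =
    map_mx intr (cmat D) *m (delta_mx i 0 : 'cV[rat]_r).
  apply/colP => k; rewrite -colE !mxE -[X in (X)%:~R]/(\sum_j _).
  by rewrite -root_to_weight_simple mxE.
have symD : diag_mx (\row_k (slen D k)%:R) *m map_mx intr (cmat D) =
    map_mx intr (cmat D)^T *m diag_mx (\row_k (slen D k)%:R) :> 'M[rat]_r.
  apply/matrixP => k j; rewrite mul_diag_mx mul_mx_diag !mxE.
  by rewrite !pmulrn -!intrM simple_sym // mulrC.
rewrite -!mulmxA (mulmxA (diag_mx _)) symD -!mulmxA (mulmxA (invmx _)) mulVmx ?cartan_unit //.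
rewrite mul1mx -colE.
rewrite mxE (bigD1 x) //= big1 ?addr0 => [|k /negPf kx]; last by rewrite !mxE kx andbF mul0r.
rewrite !mxE !eqxx mul1r; have [->|_] := eqVneq x i; last by rewrite mul0n.
by rewrite mulr1n mul1n.
Qed.

(** Otherwise [(varpi_x, alpha_x)] would vanish. *)
Lemma J1_weight_neq x (w : 'rV[int]_r) :
  weight_form D (fund_weight x) (fund_weight x - root_to_weight D (al x) - w) == 0 ->
  w != fund_weight x.
Proof.
apply: contraTneq => ->; rewrite addrAC subrr add0r -scaleN1r.
have -> : weight_form D (fund_weight x) (-1 *: root_to_weight D (al x)) =
   - weight_form D (fund_weight x) (root_to_weight D (al x)).
  by rewrite /weight_form map_mxZ rmorphN1 scaleN1r linearN mulmxN mxE.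
rewrite oppr_eq0 weight_form_simple eqxx mul1n pnatr_eq0 -lt0n.
exact: simple_slen_gt0.
Qed.

End WeightForm.

Section FlagGenerators.
Context (R : realType) (r : nat) (D : cartan_datum r) (x : 'I_r) (q : R).
Context (T : calculus_data R r).
Hypotheses (q0 : 0 < q) (simpleD : is_simple D) (fundT : is_fund_rep D x q T).
Local Notation N := (@ord_max (cdim T)).

(** The torus generator that acts nontrivially for the given value of [q]. *)
Definition torus_gen (y : 'I_r) : gen r := if q == 1 then GH y else GK y.

Definition torus_char (y : 'I_r) (w : 'rV[int]_r) : R[i] :=
  if q == 1 then (w 0 y)%:~R else qi D q y ^ (w 0 y).

Lemma zfun_props :
  [/\ @cwt R r T N = fund_weight x, forall i j, OqFlag D x q (@zfun R r T i j) &
    forall i j y w, @zfun R r T i j (torus_gen y :: w) =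
      torus_char y (@cwt R r T i - cwt j) * zfun i j w].
Proof.
have [irr wtV topV] := fundT.
have [b [rV bN b_le0 wtE]] := irrep_graded q0 simpleD irr wtV topV.
split=> [|i j|i j y w].
- exact: (irrep_top q0 simpleD wtV topV).
- apply: (zcoef_OqGL q0 simpleD rV bN b_le0 topV.2) => k.
  by rewrite !inE mxE => /negPf->; rewrite andbF.
- rewrite /torus_gen /torus_char !wtE; case: eqP => q1; first exact: (zcoef_H q0 simpleD N rV i j y w q1).
  exact: (zcoef_K q0 simpleD N rV).
Qed.

Lemma torus_char_neq (w w' : 'rV[int]_r) : w != w' ->
  exists y, torus_char y (w - w') != (grouplike_gen (torus_gen y))%:R.
Proof.
move=> ww'; have [y wy] : exists y, w 0 y != w' 0 y.
  by apply/existsP; apply: contraNT ww' => /existsPn h; apply/eqP/rowP => y; apply/eqP/negPn/h.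
exists y; rewrite /torus_char /torus_gen row_subE; have [q1|q1] := eqVneq q 1.
  by rewrite intr_eq0 subr_eq0.
rewrite -[X in _ != X](expr0z (qi D q y)) (inj_eq (coef_int_inj q0 q1 simpleD)).
by rewrite subr_eq0.
Qed.

End FlagGenerators.

(** * Semisimplicity of spaces of coefficients *)

Section Complements.
Context (F : fieldType) (U : lmodType F) (G : Type) (rho : G -> U -> U).

Record stable (S : U -> Prop) : Prop := Stable {
  stable0 : S 0;
  stableZD : forall c u v, S u -> S v -> S (c *: u + v);
  stable_act : forall g u, S u -> S (rho g u) }.

Lemma stableD S u v : stable S -> S u -> S v -> S (u + v).
Proof. by move=> hS Su Sv; rewrite -[u]scale1r; apply: (stableZD hS). Qed.

Hypothesis rhoZD : forall g c u v, rho g (c *: u + v) = c *: rho g u + rho g v.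

Definition semisimple (A : U -> Prop) := stable A /\
  forall K, stable K -> (forall u, K u -> A u) ->
  exists L, [/\ stable L, forall u, L u -> A u, forall u, K u -> L u -> u = 0 &
    forall u, A u -> exists k l, [/\ K k, L l & u = k + l]].

Definition simple (S : U -> Prop) := stable S /\
  forall K u, stable K -> S u -> K u -> u != 0 -> forall v, S v -> K v.

Definition sum_of (S A : U -> Prop) u := exists s a, [/\ S s, A a & u = s + a].

Lemma stable_sum S A : stable S -> stable A -> stable (sum_of S A).
Proof.
move=> hS hA; split.
- by exists 0, 0; split; [apply: stable0 hS|apply: stable0 hA|rewrite addr0].
- move=> c _ _ [s [a [Ss Aa ->]]] [s' [a' [Ss' Aa' ->]]].
  exists (c *: s + s'), (c *: a + a'); split; [exact: (stableZD hS)|exact: (stableZD hA)|].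
  by rewrite scalerDr addrACA.
- move=> g _ [s [a [Ss Aa ->]]]; exists (rho g s), (rho g a).
  split; [exact: (stable_act hS)|exact: (stable_act hA)|].
  by have := rhoZD g 1 s a; rewrite !scale1r.
Qed.

Lemma semisimple0 : semisimple (fun u => u = 0).
Proof.
have rho0 g : rho g 0 = 0.
  by have := rhoZD g (-1) 0 0; rewrite scaler0 addr0 scaleN1r addNr.
have h0 : stable (fun u => u = 0).
  by split=> [//|c u v -> ->|g u ->]; rewrite ?scaler0 ?addr0.
split=> // K hK K0; exists (fun u => u = 0); split=> // u ->.
by exists 0, 0; split; rewrite ?addr0 //; apply: stable0 hK.
Qed.

(** A complement of [K] in [S + A] is a complement of [K] in [A], enlarged by
    [S] unless [S] is contained in [K + A]. *)
Lemma semisimple_sum S A : simple S -> semisimple A -> semisimple (sum_of S A).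
Proof.
move=> [hS simS] [hA ssA]; split; first exact: stable_sum.
move=> K hK KSA.
have hKA : stable (fun u => K u /\ A u).
  split; [by split; [apply: stable0 hK|apply: stable0 hA]| |].
    by move=> c u v [? ?] [? ?]; split; [apply: (stableZD hK)|apply: (stableZD hA)].
  by move=> g u [? ?]; split; [apply: (stable_act hK)|apply: (stable_act hA)].
have [L [hL LA KL0 AKL]] := ssA _ hKA (fun u => @proj2 _ _).
have hsKA := stable_sum hK hA.
have A_sub u : A u -> sum_of S A u.
  by move=> Au; exists 0, u; split=> //; [apply: stable0 hS|rewrite add0r].
have KA_KL u : sum_of K A u -> exists k l, [/\ K k, L l & u = k + l].
  move=> [k [a [Kk /AKL[k' [l [[Kk' _] Ll ->]]] ->]]].
  by exists (k + k'), l; split=> //; [apply: (stableD hK)|rewrite addrA].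
have [[s Ss [s0 KAs]]|none] := pselect (exists2 s, S s & s != 0 /\ sum_of K A s).
  have SKA := simS _ _ hsKA Ss KAs s0.
  exists L; split=> // [u /LA/A_sub//|u Ku Lu|_ [t [a [St Aa ->]]]].
    by apply: KL0 => //; split=> //; apply: LA.
  apply: KA_KL; apply: (stableD hsKA); first exact: SKA.
  by exists 0, a; split=> //; [apply: stable0 hK|rewrite add0r].
exists (sum_of S L); split; first exact: stable_sum.
- by move=> _ [s [l [Ss /LA Al ->]]]; exists s, l.
- move=> u Ku [s [l [Ss Ll e]]]; have s0 : s = 0.
    apply/eqP/negPn/negP => s0; apply: none; exists s => //; split=> //.
    exists u, (- l); split=> //; last by rewrite e addrK.
    rewrite -[- l]addr0 -scaleN1r.
    by apply: (stableZD hA); [apply: LA|apply: stable0 hA].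
  rewrite s0 add0r in e; apply: KL0; last by rewrite e.
  by split=> //; rewrite e; apply: LA.
- move=> _ [s [a [Ss /AKL[k [l [[Kk _] Ll ->]]] ->]]].
  by exists k, (s + l); split=> //; [exists s, l|rewrite addrCA].
Qed.

End Complements.

Section RowModules.
Context (R : realType) (r : nat).
Local Notation C := R[i].

(** The row module is the dual of the column module: the annihilator of a
    submodule of rows is a submodule of columns. *)
Lemma irreducible_rows n (V : gen r -> 'M[C]_n) (S : 'rV[C]_n -> Prop) :
  irreducible_rep V -> S 0 -> (forall c u v, S u -> S v -> S (c *: u + v)) ->
  (forall g u, S u -> S (u *m V g)) -> (exists2 u, S u & u != 0) -> forall u, S u.
Proof.
move=> irr S0 SZD SV [u0 Su0 u00] u.
pose ann (v : 'cV[C]_n) := forall u, S u -> u *m v = 0.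
have hann : submodule V ann.
  split=> [w _|c v w hv hw t St|g v hv t St]; first by rewrite mulmx0.
    by rewrite mulmxDr -scalemxAr hv // hw // scaler0 addr0.
  by rewrite mulmxA hv //; apply: SV.
have ann0 v : ann v -> v = 0.
  move=> hv; apply/eqP/negPn/negP => v0; move/eqP: u00; apply.
  have all := irreducible_submodule irr hann (ex_intro2 _ _ _ hv v0).
  by apply/rowP => j; rewrite -[LHS]mul1r [RHS]mxE; have := all (delta_mx j 0) _ Su0; rewrite -colE => /colP/(_ 0); rewrite !mxE mul1r.
pose ST (v : 'cV[C]_n) := S v^T.
have ST0 : ST 0 by rewrite /ST trmx0.
have STZD c v w : ST v -> ST w -> ST (c *: v + w) by rewrite /ST linearP; apply: SZD.
have [d [B [B' [B'B SB]]]] := subspace_basis ST0 STZD.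
have BB' : B *m B' = 1%:M.
  apply/eqP; rewrite -subr_eq0 -oppr_eq0 opprB -trmx_eq0; apply/eqP/matrixP => a j.
  have /ann0/colP/(_ a) : ann ((1%:M - B *m B')^T *m delta_mx j 0).
    move=> w Sw; have /SB[c wE] : ST w^T by rewrite /ST trmxK.
    rewrite mulmxA -[w]trmxK wE -trmx_mul mulmxA mulmxBl mul1mx -mulmxA B'B mulmx1.
    by rewrite subrr mul0mx trmx0 mul0mx.
  by rewrite -colE !mxE.
suff : ST u^T by rewrite /ST trmxK.
by apply/SB; exists (B' *m u^T); rewrite mulmxA BB' mul1mx.
Qed.

Context (W : lmodType C).

(** The action for which [w |-> (X |-> w_(-1)(X) w_(0))] is a morphism from a
    comodule to the functions of words. *)
Definition word_shift (X : word r) (f : word r -> W) : word r -> W := fun Y => f (X ++ Y).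

Lemma shiftZD X c f g : word_shift X (c *: f + g) = c *: word_shift X f + word_shift X g.
Proof. by apply/funext. Qed.

Context (D : cartan_datum r) (q : R).

Lemma simple_coefs n (V : gen r -> 'M[C]_n) (v : 'cV[C]_n) (w : W) : irreducible_rep V ->
  simple word_shift (fun f => exists u : 'rV[C]_n, f = fun X => matrix_coef V u v X *: w).
Proof.
move=> irr.
have coefZD c (a b : 'rV[C]_n) : (fun X => matrix_coef V (c *: a + b) v X *: w) =
    c *: (fun X => matrix_coef V a v X *: w) + (fun X => matrix_coef V b v X *: w).
  apply/funext => X.
  change (matrix_coef V (c *: a + b) v X *: w =
    c *: (matrix_coef V a v X *: w) + matrix_coef V b v X *: w).
  rewrite scalerA -scalerDl; congr (_ *: _).
  by rewrite /matrix_coef !mulmxDl -!scalemxAl !mxE.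
have coef0 : (fun X => matrix_coef V 0 v X *: w) = 0.
  by apply/funext => X; rewrite /matrix_coef !mul0mx mxE scale0r.
have coefS X a : word_shift X (fun Y => matrix_coef V a v Y *: w) =
    fun Y => matrix_coef V (a *m act V X) v Y *: w.
  apply/funext => Y; rewrite /word_shift /matrix_coef act_cat -mulmxE mulmxA.
  by [].
split.
  split=> [|c _ _ [a ->] [b ->]|X _ [a ->]].
  - by exists 0.
  - by exists (c *: a + b).
  - by exists (a *m act V X).
move=> K f hK [u0 ->] Ku0 n0 _ [u ->].
pose S a := K (fun X => matrix_coef V a v X *: w).
apply: (irreducible_rows irr (S := S)).
- by rewrite /S coef0; apply: stable0 hK.
- by move=> c a b Sa Sb; rewrite /S coefZD; apply: (stableZD hK).
- move=> g a Sa; have := stable_act hK [:: g] Sa.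
  by rewrite coefS /act big_seq1.
- by exists u0 => //; apply: contraNneq n0 => ->; rewrite coef0.
Qed.

(** Each matrix coefficient of an irreducible representation, multiplied by a
    fixed vector, lies in a simple module, the image of the row module. *)
Lemma OqG_semisimple m (a : 'I_m -> word r -> C) (w : 'I_m -> W) :
  (forall k, OqG D q (a k)) ->
  exists2 A, semisimple word_shift A & A (fun X => \sum_(k < m) a k X *: w k).
Proof.
move=> ha.
pose good (f : word r -> W) := exists2 A, semisimple word_shift A & A f.
pose Good f := forall g, good g -> good (f + g).
have Good0 : Good 0 by move=> g; rewrite add0r.
have GoodD f g : Good f -> Good g -> Good (f + g).
  by move=> hf hg h gh; rewrite -addrA; apply/hf/hg.
have Good1 e u : is_matrix_coef D q e -> Good (fun X => e X *: u).
  move=> [n [V [l [f [v [_ [_ irr _] ->]]]]]] g [A ssA Ag].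
  have simS := simple_coefs v u irr.
  eexists; first exact: (semisimple_sum shiftZD simS ssA).
  by exists (fun X => matrix_coef V f v X *: u), g; split=> //; exists f.
suff : Good (\sum_(k < m) fun X => a k X *: w k).
  have g0 : good 0 by exists (fun f => f = 0) => //; apply: (semisimple0 shiftZD).
  move=> /(_ 0 g0); rewrite addr0; set s1 := \sum_(k < m) _.
  suff -> : s1 = fun X => \sum_(k < m) a k X *: w k by [].
  by apply/funext => X; rewrite /s1 fct_sumE.
apply: (big_ind Good) => // k _; have [n [c [e [he ae]]]] := ha k.
have -> : (fun X => a k X *: w k) = \sum_(j < n) fun X => e j X *: (c j *: w k).
  apply/funext => X; rewrite fct_sumE ae scaler_suml; apply: eq_bigr => j _.
  by rewrite scalerA mulrC.
by apply: (big_ind Good) => // j _; apply: Good1.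
Qed.

End RowModules.

(** * Powers of the Kaehler form *)

(** The counit axiom, for functions of words. *)
Lemma sum_counit (R : realType) (r : nat) (W : lmodType R[i]) (f : word r -> W) X :
  \sum_(p <- coprod X) counit R p.1 *: f p.2 = f X.
Proof.
elim: X f => [|g X IH] f; first by rewrite big_seq1 scale1r.
rewrite /= big_flatten big_map.
transitivity (\sum_(p <- coprod_gen g) counit R p.1 *: f (p.2 ++ X)).
  apply: eq_bigr => p _; rewrite big_map -(IH (fun Y => f (p.2 ++ Y))) scaler_sumr.
  by apply: eq_bigr => t _; rewrite /counit all_cat -mulnb natrM scalerA.
by case: g => i; rewrite ?big_cons ?big_nil /counit /= ?scale0r ?scale1r ?addr0 ?add0r.
Qed.

Section Calculus.
Context (R : realType) (r : nat) (D : cartan_datum r) (x : 'I_r) (q : R).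
Context (T : calculus_data R r) (M : nat) (e : bool).
Local Notation C := R[i].
Local Notation W := (cforms T).
Local Notation inc := (@cinc R r T).
Local Notation co := (@ccoact R r T).
Local Notation B := (OqFlag D x q).
Local Notation d := (cd T).
Local Notation Om := (@Om R r T).
Local Notation Om2 := (@Om2 R r T).
Local Notation Bplus := (@Bplus R r D x q T).
Local Notation kap := (kappa D q T e).
Local Notation eps := (@counit R r).
Local Notation N := (@ord_max (cdim T)).

Hypotheses (q0 : 0 < q) (simpleD : is_simple D).
Hypotheses (HK : is_HK_complex D x q T M) (KA : is_kaehler D q T M e).
Hypotheses (hodgeM : is_hodge_map D q T M e) (posM : metric_posdef D x q T M).

Let calc : is_calculus D x q T := let: And4 h _ _ _ := HK in HK_calculus h.
Let cov : is_covariant D x q T := let: And4 h _ _ _ := HK in HK_covariant h.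
Let cplx : is_complex_structure D x q T := let: And4 _ _ _ h := HK in h.
Let fundT : is_fund_rep D x q T := let: And4 _ _ h _ := HK in h.

Let hk : is_HK_calculus D x q T M := let: And4 h _ _ _ := HK in h.

Lemma Om_ZD k c u v : Om k u -> Om k v -> Om k (c *: u + v).
Proof. by rewrite /Defs.Om /= linearP => -> ->. Qed.

Lemma Om0 k : Om k 0.
Proof. exact: linear0. Qed.

Lemma Om_sum k n (f : 'I_n -> W) : (forall i, Om k (f i)) -> Om k (\sum_i f i).
Proof. by move=> h; rewrite /Defs.Om /= linear_sum; apply: eq_bigr => i _; apply: h. Qed.

Lemma Om2_ZD a b c u v : Om2 a b u -> Om2 a b v -> Om2 a b (c *: u + v).
Proof. by rewrite /Defs.Om2 /= linearP => -> ->. Qed.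

Lemma Om_diff k l u : Om k u -> k != l -> cdeg T l u = 0.
Proof. by move=> <- kl; rewrite (deg_proj calc) eq_sym (negPf kl). Qed.

Lemma Om2_proj a b w : Om2 a b (cbideg T a b w).
Proof. by rewrite /Defs.Om2 /= (bideg_proj cplx) !eqxx. Qed.

Lemma Om2_diff a b a' b' u : Om2 a b u -> (a', b') != (a, b) -> cbideg T a' b' u = 0.
Proof. by move=> <-; rewrite (bideg_proj cplx) xpair_eqE => /negPf->. Qed.

Lemma Om2_Om a b u : Om2 a b u -> Om (a + b) u.
Proof.
move=> hu; rewrite /Defs.Om /= (bideg_deg cplx).
have ab : (a < (a + b).+1)%N by rewrite ltnS leq_addr.
rewrite (bigD1 (Ordinal ab)) //= big1 => [|i ia]; first by rewrite addKn hu addr0.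
by apply: (Om2_diff hu); rewrite xpair_eqE negb_and -(inj_eq val_inj) /= in ia *; rewrite ia.
Qed.

Lemma Om_bideg k w : Om k w -> w = \sum_(a < k.+1) cbideg T a (k - a) w.
Proof. by move=> hw; rewrite -(bideg_deg cplx) hw. Qed.

Lemma co_sum n (f : 'I_n -> W) X : co (\sum_i f i) X = \sum_i co (f i) X.
Proof.
have co0 : co 0 X = 0.
  have := co_linear cov (-1) 0 0 X; rewrite scaler0 addr0 => ->.
  by rewrite scaleN1r addNr.
apply: (big_morph (fun w => co w X)) => // u v.
by have := co_linear cov 1 u v X; rewrite !scale1r.
Qed.

Lemma co_scale c u X : co (c *: u) X = c *: co u X.
Proof.
have co0 : co 0 X = 0.
  have := co_linear cov (-1) 0 0 X; rewrite scaler0 addr0 => ->.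
  by rewrite scaleN1r addNr.
by have := co_linear cov c u 0 X; rewrite addr0 co0 addr0.
Qed.

Lemma co_deg k w X : Om k w -> Om k (co w X).
Proof.
move=> hw; rewrite {1}(Om_bideg hw) co_sum; apply: Om_sum => a.
have := Om2_Om (bideg_co cplx X (Om2_proj a (k - a) w)).
by rewrite subnKC // -ltnS.
Qed.

Definition coinvariant w := forall X, co w X = eps X *: w.

Lemma coinvariant_mul u w X : coinvariant u -> co (u * w) X = u * co w X.
Proof.
move=> hu; rewrite (co_mul cov).
rewrite -[RHS](sum_counit (fun Y => u * co w Y)); apply: eq_bigr => p _.
by rewrite hu -scalerAl.
Qed.

Lemma kap_Om : Om 2 kap.
Proof. exact: Om2_Om (kappa_bideg KA). Qed.

Lemma iter_lefschetz j w : iter j (lefschetz D q e) w = kap ^+ j * w.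
Proof.
by elim: j => [|j IH]; rewrite ?expr0 ?mul1r // iterS IH exprS -mulrA.
Qed.

Lemma kap_mul_Om j k w : Om k w -> Om (j.*2 + k) (kap ^+ j * w).
Proof.
move=> hw; elim: j => [|j IH]; first by rewrite expr0 mul1r.
by rewrite exprS -mulrA doubleS; apply: (deg_mul calc kap_Om IH).
Qed.

Lemma kap_central j w : kap ^+ j * w = w * kap ^+ j.
Proof. by apply/commr_sym/commrX/commr_sym/(kappa_central KA). Qed.

Lemma co_kap_mul j w X : co (kap ^+ j * w) X = kap ^+ j * co w X.
Proof.
elim: j => [|j IH]; first by rewrite !mul1r.
by rewrite !exprS -!mulrA coinvariant_mul ?IH //; apply: (kappa_coinv KA).
Qed.

Lemma d_kap_mul j w : d (kap ^+ j * w) = kap ^+ j * d w.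
Proof.
elim: j => [|j IH]; first by rewrite !mul1r.
rewrite !exprS -!mulrA (d_leibniz calc _ kap_Om) (kappa_closed KA) mul0r add0r.
by rewrite expr2 mulrNN mul1r mul1r IH.
Qed.

(** The counit is the matrix coefficient of the trivial representation. *)
Lemma eps_OqG : OqG D q eps.
Proof.
pose V (g : gen r) : 'M[C]_1 := (grouplike_gen g)%:R%:M.
have rV : graded_rep D q V 0 (fun _ => 0).
  have c0 i : coroot D 0 0 i = 0.
    by rewrite /coroot mxE mxE mxE big1 ?addr0 // => k _; rewrite mxE mulr0.
  split=> [i|i|i|i|i|i j]; rewrite /V /=.
  - by apply/matrixP => a b; rewrite !mxE c0 expr0z.
  - by apply/matrixP => a b; rewrite !mxE c0 oppr0 expr0z.
  - by apply/matrixP => a b; rewrite !mxE c0 qint0.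
  - by move=> a b; rewrite !mxE mul0rn eqxx.
  - by move=> a b; rewrite !mxE mul0rn eqxx.
  - have -> : (false%:R%:M : 'M[C]_1) = 0 by apply/matrixP => a b; rewrite !mxE mul0rn.
    by rewrite mul0mx subrr if_same.
have -> : eps = matrix_coef V 1%:M 1%:M; last exact: (graded_OqG q0 simpleD _ _ rV).
apply/funext => w; rewrite /matrix_coef mul1mx mulmx1.
elim: w => [|g w IH]; first by rewrite /act big_nil /counit /= !mxE.
rewrite /act big_cons -mulmxE mul_scalar_mx mxE -[X in _ = _ * X]IH.
by rewrite /counit /= -natrM mulnb.
Qed.

Lemma eps_flag : B eps.
Proof.
split; first exact: eps_OqG.
by move=> w X _; rewrite /counit all_cat -mulnb natrM mulrC.
Qed.

Lemma flag_ZD c a b : B a -> B b -> B (fun X => c * a X + b X).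
Proof.
move=> [Aa la] [Ab lb]; split; first exact: OqGZD.
by move=> w X lX; rewrite la // lb // mulrDr mulrCA.
Qed.

Lemma flag_translate b X : B b -> B (translate b X).
Proof.
move=> [Ab lb]; split; first exact: OqG_translate.
by move=> w Y lY; rewrite /translate catA lb.
Qed.

Lemma Om0_inc u : Om 0 u -> exists2 b, B b & u = inc b.
Proof. by rewrite -(inc_image calc) => -[b Bb <-]; exists b. Qed.

Lemma inc_Om0 b : B b -> Om 0 (inc b).
Proof. by move=> Bb; rewrite -(inc_image calc); exists b. Qed.

Lemma Om0_1 : Om 0 1.
Proof. by rewrite -(inc_one calc); apply/inc_Om0/eps_flag. Qed.

Lemma lefschetz_inj k u v : (k < M)%N -> Om k u -> Om k v ->
  kap ^+ (M - k) * u = kap ^+ (M - k) * v -> u = v.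
Proof.
move=> kM hu hv uv; have hw : Om (M.*2 - k) (kap ^+ (M - k) * u).
  have := kap_mul_Om (M - k) hu; suff -> : ((M - k).*2 + k = M.*2 - k)%N by [].
  lia.
have [z [_ zu]] := lefschetz_iso KA kM hw.
transitivity z; first by apply/esym/zu; split=> //; rewrite iter_lefschetz.
by apply: zu; split=> //; rewrite iter_lefschetz uv.
Qed.

Lemma lefschetz_surj k w : (k < M)%N -> Om (M.*2 - k) w ->
  exists2 u, Om k u & kap ^+ (M - k) * u = w.
Proof.
move=> kM hw; have [z [[hz zw] _]] := lefschetz_iso KA kM hw.
by exists z => //; rewrite -iter_lefschetz.
Qed.

Lemma kap_top_neq0 : (0 < M)%N -> kap ^+ M <> 0.
Proof.
move=> M0 k0; have := lefschetz_inj M0 Om0_1 (Om0 0).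
by rewrite subn0 k0 !mul0r => /(_ erefl)/eqP; rewrite oner_eq0.
Qed.

Lemma Bplus_ZD F c u v : (forall c u v, F u -> F v -> F (c *: u + v)) ->
  F 0 -> Bplus F u -> Bplus F v -> Bplus F (c *: u + v).
Proof.
move=> FZD F0 [m [b [f [hb [hf ->]]]]] [m' [b' [f' [hb' [hf' ->]]]]].
exists (m + m')%N, (fun k => match fintype.split k with inl j => b j | inr j => b' j end).
exists (fun k => match fintype.split k with inl j => c *: f j | inr j => f' j end).
split=> [k|]; first by case: fintype.splitP.
split=> [k|]; first by case: fintype.splitP => j _ //; rewrite -[_ *: _]addr0; apply: FZD.
rewrite big_split_ord scaler_sumr; congr (_ + _); apply: eq_bigr => k _.
  by rewrite (fintype.unsplitK (inl k)) scalerAr.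
by rewrite (fintype.unsplitK (inr k)).
Qed.

(** If the value of [c] at the identity were nonzero, every element of [Omega^0]
    would lie in [B^+ Omega^0], and the fibre would be zero instead of a line. *)
Lemma Bplus_Om0 c : B c -> Bplus (Om 0) (inc c) -> c [::] = 0.
Proof.
move=> Bc [m [b [g [hb [hg cE]]]]]; apply/eqP/negPn/negP => c0.
have all u : Om 0 u -> Bplus (Om 0) u.
  move=> hu; set y := (c [::])^-1.
  have hd : B (fun X => - y * c X + eps X) by apply: flag_ZD Bc eps_flag.
  have -> : u = y *: (inc c * u) + inc (fun X => - y * c X + eps X) * u.
    rewrite (inc_linear calc) //; last exact: eps_flag.
    by rewrite (inc_one calc) mulrDl mul1r scaleNr mulNr scalerAl addrA addrN add0r.
  apply: Bplus_ZD; [exact: Om_ZD|exact: Om0| |].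
    exists m, b, (fun k => g k * u); split=> //; split=> [k|].
      exact: (deg_mul calc (hg k) hu).
    by rewrite cE mulr_suml; apply: eq_bigr => k _; rewrite mulrA.
  exists 1%N, (fun _ => fun X => - y * c X + eps X), (fun _ => u); split=> [_|].
    by split=> //; rewrite /counit /= mulNr mulVf // addNr.
  by split=> //; rewrite big_ord1.
have [ee [eF _ eind]] := HK_dim hk (leq0n M.*2).
have i0 : 'I_'C(M.*2, 0) by rewrite bin0; exact: ord0.
have := eind (fun _ => 1) _ i0 (finset.in_setT _); move=> h.
have /h/eqP : Bplus (Om 0) (\sum_(i in finset.setT) 1 *: ee i); last by rewrite oner_eq0.
apply: all; rewrite /Defs.Om /= linear_sum; apply: eq_bigr => i hi.
by rewrite scale1r; apply: eF.
Qed.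

(** The metric of [mu] is, up to a factorial, the function [c] for which
    [mu * eta = kappa^M c], where [eta] is the Hodge dual of [mu^*]. As [mu]
    is coinvariant, every translate of [c] is obtained from a translate of [eta]
    in the same way; as [mu] is in [B^+ Omega], each of them vanishes at the
    identity.
    Hence [c = 0], against positive definiteness unless [mu = 0]. *)
Lemma coinvariant_Bplus_eq0 a b mu : (0 < M)%N -> (a + b)%N = 1%N -> Om2 a b mu ->
  coinvariant mu -> Bplus (Om2 a b) mu -> mu = 0.
Proof.
move=> M0 ab hmu inv [m [bb [f [hb [hf muE]]]]].
apply/eqP/negPn/negP => mu0.
have hmu1 : Om 1 mu by rewrite -ab; apply: Om2_Om.
have hs : Om2 b a (cstar mu) by rewrite -(bideg_star cplx a b); exists mu.
have hs1 : Om 1 (cstar mu) by rewrite -ab addnC; apply: Om2_Om.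
have prim : primitive D q M e b a (cstar mu).
  split=> //; rewrite iter_lefschetz; apply: (HK_total_degree hk) (kap_mul_Om _ hs1).
  by move: ab; clear; lia.
(* One-forms are primitive for degree reasons, so the Hodge map is explicit. *)
pose eta := chodge T (cstar mu).
have heta : Om (M.*2 - 1) eta.
  have := @hodgeM b a 0 (cstar mu); rewrite addnC ab => /(_ M0 (leq0n _) prim) /=.
  rewrite /eta => ->; rewrite iter_lefschetz.
  have := kap_mul_Om (M - 0 - 1) hs1; have -> : ((M - 0 - 1).*2 + 1 = M.*2 - 1)%N by lia.
  by move=> h; rewrite -[_ *: _]addr0; apply: Om_ZD => //; apply: Om0.
have top u v : Om 1 u -> Om (M.*2 - 1) v -> exists2 c, Om 0 c & kap ^+ M * c = u * v.
  move=> hu hv; have := deg_mul calc hu hv; have -> : (1 + (M.*2 - 1) = M.*2 - 0)%N by lia.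
  by move=> /(lefschetz_surj M0); rewrite subn0.
(* The metric of [mu] is a multiple of [c]. *)
have [_ /Om0_inc[c Bc ->] cE] := top _ _ hmu1 heta.
have c0 X : c X = 0.
  have -> : c X = translate c X [::] by rewrite /translate cats0.
  have BcX := flag_translate X Bc; apply: (Bplus_Om0 BcX).
  have hg k : exists g, Om 0 g /\ kap ^+ M * g = f k * co eta X.
    have hf1 : Om 1 (f k) by rewrite -ab; apply: Om2_Om.
    by have [g ? ?] := top _ _ hf1 (co_deg X heta); exists g.
  have [g gE] := choice hg.
  exists m, bb, g; split=> //; split=> [k|]; first exact: (gE k).1.
  apply: (lefschetz_inj M0); first exact: inc_Om0.
    apply: Om_sum => k; exact: (deg_mul calc (inc_Om0 (hb k).1) (gE k).1).
  rewrite subn0 -(co_inc cov) // -co_kap_mul cE coinvariant_mul // muE mulr_suml mulr_sumr.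
  apply: eq_bigr => k _; rewrite -mulrA -(gE k).2 !mulrA; congr (_ * _).
  by rewrite kap_central.
have incc : inc c = 0.
  have := inc_linear calc 0 Bc Bc; rewrite scale0r add0r => h.
  have := inc_linear calc (-1) Bc Bc; rewrite scaleN1r addNr => <-.
  by congr (inc _); apply/funext => X; rewrite c0 mulr0 addr0.
have [m0 _] := posM mu0; move/eqP: m0; apply.
rewrite /metric; apply: big1 => k _; have [k1|k1] := eqVneq (1%N) (k : nat).
  by rewrite -k1 hmu1 -/eta -cE incc mulr0 linear0.
by rewrite (Om_diff hmu1 k1) mul0r linear0.
Qed.

Lemma inc_scale c a : B a -> inc (fun X => c * a X) = c *: inc a.
Proof.
move=> Ba; have := inc_linear calc (c - 1) Ba Ba; rewrite scalerBl scale1r subrK => <-.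
by congr (inc _); apply/funext => X; rewrite mulrBl mul1r subrK.
Qed.

Lemma co_z i j y : co (z i j) [:: torus_gen q y] =
  torus_char D q y (@cwt R r T i - cwt j) *: z i j.
Proof.
have [_ zB zE] := zfun_props q0 simpleD fundT.
rewrite /z (co_inc cov) // -inc_scale //; congr (inc _); apply/funext => w.
exact: zE.
Qed.

Lemma co_del u X c : Om 0 u -> co u X = c *: u ->
  co (cdel T u) X = c *: cdel T u /\ co (cdelbar T u) X = c *: cdelbar T u.
Proof.
move=> hu uX; have hu2 : Om2 0 0 u by rewrite (Om_bideg hu) big_ord1; apply: Om2_proj.
have h1 := del_bideg cplx hu2; have h2 := delbar_bideg cplx hu2.
have : co (d u) X = c *: d u by rewrite (co_d cov) uX linearZ.
rewrite (d_split cplx) scalerDr.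
have -> : co (cdel T u + cdelbar T u) X = co (cdel T u) X + co (cdelbar T u) X.
  by have := co_linear cov 1 (cdel T u) (cdelbar T u) X; rewrite !scale1r.
have k1 := bideg_co cplx X h1; have k2 := bideg_co cplx X h2.
move=> E; split.
  have /(congr1 (cbideg T 1 0)) := E; rewrite !linearD !linearZ /= k1 h1.
  by rewrite (Om2_diff k2) // (Om2_diff h2) // scaler0 !addr0.
have /(congr1 (cbideg T 0 1)) := E; rewrite !linearD !linearZ /= k2 h2.
by rewrite (Om2_diff k1) // (Om2_diff h1) // scaler0 !add0r.
Qed.

Lemma Bplus1 F b f : B b -> b [::] = 0 -> F f -> Bplus F (inc b * f).
Proof.
by move=> Bb b0 Ff; exists 1%N, (fun _ => b), (fun _ => f); split=> //; split=> //; rewrite big_ord1.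
Qed.

Lemma Bplus0 F : Bplus F 0.
Proof. by exists 0%N, (fun _ => eps), (fun _ => 0); split=> [[]|] //; split=> [[]|] //; rewrite big_ord0. Qed.

Lemma Bplus_co a b w y : Bplus (Om2 a b) w -> Bplus (Om2 a b) (co w [:: torus_gen q y]).
Proof.
move=> [m [bb [f [hb [hf ->]]]]]; rewrite co_sum.
have Bp1 k X X' : all (levi_gen (finset.setC (finset.set1 x))) X ->
    Bplus (Om2 a b) (co (inc (bb k)) X * co (f k) X').
  have [Bb b0] := hb k => lX; rewrite (co_inc cov) //; apply: Bplus1.
  - exact: flag_translate.
  - by rewrite /translate cats0 -[X]cat0s Bb.2 // b0 mulr0.
  - exact: (bideg_co cplx).
have BpD u v : Bplus (Om2 a b) u -> Bplus (Om2 a b) v -> Bplus (Om2 a b) (u + v).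
  move=> hu hv; rewrite -[u]scale1r; apply: Bplus_ZD hu hv; last exact: linear0.
  exact: Om2_ZD.
apply: (big_ind (Bplus (Om2 a b))) => [||k _]; [exact: Bplus0|exact: BpD|].
rewrite (co_mul cov) /torus_gen; case: eqP => _.
  by rewrite /= !big_cons big_nil addr0; apply: BpD; apply: Bp1.
by rewrite /= big_seq1; apply: Bp1.
Qed.

(** A coinvariant form has weight zero for the torus, unlike the elements of
    the given basis of the fibre. *)
Lemma coinvariant_Bplus a b (zz : 'I_(cdim T).+1 -> W) (wts : 'I_(cdim T).+1 -> 'rV[int]_r) mu :
  Phi_basis D x q (Om2 a b) (J1 D x T) zz ->
  (forall i y, co (zz i) [:: torus_gen q y] = torus_char D q y (wts i) *: zz i) ->
  (forall i, i \in J1 D x T -> exists y, torus_char D q y (wts i) != (grouplike_gen (torus_gen q y))%:R) ->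
  Om2 a b mu -> coinvariant mu -> Bplus (Om2 a b) mu.
Proof.
move=> [_ span ind] zzX zzN hmu inv; have [c hc] := span mu hmu.
suff c0 i : i \in J1 D x T -> c i = 0.
  move: hc; rewrite big1 ?subr0 // => i iJ.
  by rewrite c0 // scale0r.
move=> iJ; have [y wy] := zzN i iJ.
set ee := _%:R in wy.
have epsE : eps [:: torus_gen q y] = ee by rewrite /counit /= andbT.
have h2 := Bplus_co y hc.
have h3 : Bplus (Om2 a b) (\sum_(i in J1 D x T) (c i * (ee - torus_char D q y (wts i))) *: zz i).
  suff -> : \sum_(i in J1 D x T) (c i * (ee - torus_char D q y (wts i))) *: zz i =
      - ee *: (mu - \sum_(i in J1 D x T) c i *: zz i) +
      co (mu - \sum_(i in J1 D x T) c i *: zz i) [:: torus_gen q y].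
    by apply: Bplus_ZD => //; [exact: Om2_ZD|exact: linear0].
  have -> : co (mu - \sum_(i in J1 D x T) c i *: zz i) [:: torus_gen q y] =
      ee *: mu - \sum_(i in J1 D x T) (c i * torus_char D q y (wts i)) *: zz i.
    have -> : mu - \sum_(i in J1 D x T) c i *: zz i = -1 *: (\sum_(i in J1 D x T) c i *: zz i) + mu.
      by rewrite scaleN1r addrC.
    rewrite (co_linear cov) inv epsE scaleN1r addrC; congr (_ - _).
    rewrite (big_morph (fun w => co w [:: torus_gen q y]) (id1 := 0) (op1 := +%R)); last 2 first.
    - by move=> u v; have := co_linear cov 1 u v [:: torus_gen q y]; rewrite !scale1r.
    - by have := co_scale 0 0 [:: torus_gen q y]; rewrite !scale0r.
    by apply: eq_bigr => k _; rewrite co_scale zzX scalerA.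
  rewrite scalerBr !scaleNr opprK addrACA addNr add0r scaler_sumr -sumrB.
  by apply: eq_bigr => k _; rewrite scalerA -scalerBl mulrBr [ee * _]mulrC.
have := ind _ h3 i iJ => /eqP; rewrite mulf_eq0 subr_eq0 eq_sym [ee == _]eq_sym (negPf wy) orbF.
by rewrite eq_sym => /eqP.
Qed.

Lemma co_add u v X : co (u + v) X = co u X + co v X.
Proof. by have := co_linear cov 1 u v X; rewrite !scale1r. Qed.

(** The classes of the [del z_iN] and [delbar z_Ni] have weights
    [wt v_i - varpi_x] and [varpi_x - wt v_i], which are not zero. *)
Lemma coinvariant_Om1_eq0 mu : (0 < M)%N -> Om 1 mu -> coinvariant mu -> mu = 0.
Proof.
move=> M0 hmu inv; have [wtN zB zE] := zfun_props q0 simpleD fundT.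
have muE : mu = cbideg T 0 1 mu + cbideg T 1 0 mu.
  by rewrite {1}(Om_bideg hmu) big_ord_recl big_ord1.
have inv2 a b : (a, b) = (0, 1)%N \/ (a, b) = (1, 0)%N -> coinvariant (cbideg T a b mu).
  move=> ab X; have k1 := bideg_co cplx X (Om2_proj 0 1 mu).
  have k2 := bideg_co cplx X (Om2_proj 1 0 mu).
  have E : co mu X = co (cbideg T 0 1 mu) X + co (cbideg T 1 0 mu) X.
    by rewrite {1}muE co_add.
  rewrite inv in E; have /(congr1 (cbideg T a b)) := E; rewrite linearZ linearD /= => ->.
  case: ab => -[-> ->]; first by rewrite k1 (Om2_diff k2) // addr0.
  by rewrite k2 (Om2_diff k1) // add0r.
have [basis basisbar] := (del_basis cplx, delbar_basis cplx).
have neq i : i \in J1 D x T -> @cwt R r T i != cwt N.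
  by rewrite wtN inE => /(J1_weight_neq simpleD).
have m10 : cbideg T 1 0 mu = 0.
  have i10 := inv2 1%N 0%N (or_intror erefl).
  apply: (@coinvariant_Bplus_eq0 1 0 _ M0 _ _ i10) => //; first exact: Om2_proj.
  apply: (coinvariant_Bplus basis (wts := fun i => @cwt R r T i - cwt N)) => // [i y|i iJ|].
  - exact: (co_del (inc_Om0 (zB i N)) (co_z i N y)).1.
  - exact/(torus_char_neq q0 simpleD)/neq.
  - exact: Om2_proj.
have m01 : cbideg T 0 1 mu = 0.
  have i01 := inv2 0%N 1%N (or_introl erefl).
  apply: (@coinvariant_Bplus_eq0 0 1 _ M0 _ _ i01) => //; first exact: Om2_proj.
  apply: (coinvariant_Bplus basisbar (wts := fun i => @cwt R r T N - cwt i)) => // [i y|i iJ|].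
  - exact: (co_del (inc_Om0 (zB N i)) (co_z N i y)).2.
  - by apply: (torus_char_neq q0 simpleD); rewrite eq_sym; apply: neq.
  - exact: Om2_proj.
by rewrite muE m10 m01 addr0.
Qed.

(** Semisimplicity replaces integration over the compact quantum group: in a
    semisimple module that contains the orbit of [nu], the closed forms have an invariant complement, and
    the component of [nu] in it is coinvariant, since its translates have the
    same differential up to the counit. *)
Lemma exists_coinvariant k nu th : Om k nu -> d nu = th -> coinvariant th ->
  exists nu0, [/\ Om k nu0, coinvariant nu0 & d nu0 = th].
Proof.
move=> hnu dnu invth; have [m [a [u [Aa coE]]]] := co_tensor cov nu.
have [A [hA ssA]] := OqG_semisimple u Aa.
have -> : (fun X => \sum_(k < m) a k X *: u k) = co nu by apply/funext.
move=> Anu.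
pose K f := A f /\ exists w, [/\ Om k w, f = co w & d w = 0].
have shift_co X w : @word_shift R r W X (co w) = co (co w X).
  by apply/funext => Y; rewrite (co_coassoc cov).
have hK : stable (@word_shift R r W) K.
  split.
  - split; first exact: stable0 hA.
    exists 0; split; [exact: Om0| |exact: linear0].
    by apply/funext => X; have := co_scale 0 0 X; rewrite !scale0r.
  - move=> c f f' [A1 [w [hw fE dw]]] [A2 [w' [hw' fE' dw']]]; split; first exact: (stableZD hA).
    exists (c *: w + w'); split; first exact: Om_ZD.
      by rewrite fE fE'; apply/funext => X; rewrite (co_linear cov).
    by rewrite linearP /= dw dw' scaler0 addr0.
  - move=> X f [A1 [w [hw fE dw]]]; split; first exact: (stable_act hA).
    exists (co w X); split; [exact: co_deg|by rewrite fE shift_co|].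
    by rewrite -(co_d cov) dw; have := co_scale 0 0 X; rewrite !scale0r.
have [L [hL LA KL0 split]] := ssA K hK (fun f => @proj1 _ _).
have [f [l [[_ [w [hw fE dw]]] Ll nuE]]] := split _ Anu; rewrite fE in nuE.
have lE : l = co (nu - w).
  apply/funext => X; have := congr1 (fun f => f X) nuE => /= e1.
  rewrite -scaleN1r addrC (co_linear cov) e1 scaleN1r.
  change (l X = - co w X + (co w X + l X)).
  by rewrite addrA addNr add0r.
have d0 : d (nu - w) = th by rewrite linearB /= dnu dw subr0.
have h0 : Om k (nu - w) by rewrite -scaleN1r addrC; apply: Om_ZD.
exists (nu - w); split=> // X; move: (nu - w) lE d0 h0 => nu0 lE d0 h0.
apply/eqP; rewrite -subr_eq0; apply/eqP.
set v := _ - _; have vE : v = (- eps X) *: nu0 + co nu0 X by rewrite scaleNr addrC.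
have cov_v : co v = (- eps X) *: l + word_shift X l.
  by apply/funext => Y; rewrite vE (co_linear cov) lE shift_co.
rewrite -[v](co_counit cov); suff -> : co v = 0 by [].
have Lv : L (co v) by rewrite cov_v; apply: (stableZD hL) => //; apply: (stable_act hL).
apply: KL0 => //; split; first exact: LA.
exists v; split=> //; first by rewrite vE; apply: Om_ZD => //; apply: co_deg.
by rewrite vE linearP /= -(co_d cov) d0 invth scaleNr addNr.
Qed.

(** By the hard Lefschetz isomorphism a coinvariant primitive of [kappa^M] would
    come from a coinvariant one-form. *)
Lemma kap_top_not_exact : (0 < M)%N -> ~ exists2 nu, Om (M.*2 - 1) nu & kap ^+ M = d nu.
Proof.
move=> M0 [nu hnu dnu].
have invk : coinvariant (kap ^+ M).
  by move=> X; rewrite -[kap ^+ M]mulr1 co_kap_mul (co_one cov) scalerAr.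
have [nu0 [h0 inv0 d0]] := exists_coinvariant hnu (esym dnu) invk.
suff n0 : nu0 = 0 by apply: (kap_top_neq0 M0); rewrite -d0 n0 linear0.
have [mu hmu muE] : exists2 mu, Om 1 mu & kap ^+ (M - 1) * mu = nu0.
  have [M1|M1] := leqP M 1; last exact: lefschetz_surj.
  have M1' : M = 1%N by lia.
  by exists nu0; [move: h0; rewrite M1'|rewrite M1' mul1r].
have [M1|M1] := leqP M 1.
  have M1' : M = 1%N by lia.
  by apply: coinvariant_Om1_eq0 => //; move: h0; rewrite M1'.
rewrite -muE (coinvariant_Om1_eq0 M0 hmu) ?mulr0 // => X.
apply: (lefschetz_inj M1); first exact: co_deg.
  by rewrite -[_ *: _]addr0; apply: Om_ZD => //; apply: Om0.
by rewrite -co_kap_mul muE inv0 -muE scalerAr.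
Qed.

Lemma cohomology_kap k : (1 <= k <= M)%N -> cohomology_neq0 T k.*2.
Proof.
move=> /andP[k1 kM]; have M0 : (0 < M)%N by lia.
have hk1 : Om k.*2 (kap ^+ k).
  by have := kap_mul_Om k Om0_1; rewrite mulr1 addn0.
exists (kap ^+ k); split=> //.
  rewrite -[kap ^+ k]mulr1 d_kap_mul; suff -> : d 1 = 0 by rewrite mulr0.
  have := d_leibniz calc 1 Om0_1; rewrite !mul1r mulr1 => e1.
  by have := e1; rewrite -[X in X = _]addr0 => /addrI/esym.
move=> [u hu uE]; apply: (kap_top_not_exact M0).
exists (kap ^+ (M - k) * u).
  have := kap_mul_Om (M - k) hu; suff -> : ((M - k).*2 + k.*2.-1 = M.*2 - 1)%N by [].
  lia.
by rewrite d_kap_mul -uE -exprD subnK.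
Qed.

End Calculus.

Unset Implicit Arguments.
Local Open Scope classical_set_scope.

Theorem theorem5p9 (R : realType) (r : nat) (D : cartan_datum r) (x : 'I_r)
  (M : nat) (I : set R) (T : R -> calculus_data R r) (e : bool) :
  is_simple D -> cominuscule D x -> flag_dim D x M ->
  open I -> is_interval I -> I 1 -> (forall q, I q -> 0 < q) ->
  (forall q, I q -> is_HK_complex D x q (T q) M) ->
  kappa_sign D x 1 (T 1) e ->
  (forall q, I q -> is_kaehler D q (T q) M e) ->
  (forall q, I q -> is_hodge_map D q (T q) M e) ->
  (forall q, I q -> metric_posdef D x q (T q) M) ->
  forall q, I q ->
  forall k : nat, (1 <= k <= M)%N -> cohomology_neq0 (T q) k.*2.
Proof.
move=> simpleD _ _ _ _ _ posI HK _ KA hodgeM posM q Iq.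
exact: (cohomology_kap (posI _ Iq) simpleD (HK _ Iq) (KA _ Iq) (hodgeM _ Iq) (posM _ Iq)).
Qed.
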